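(* Assume the ABC conjecture. Let $\tfrac{p}{q}$ be a rational number with $\tfrac14 \le \tfrac{p}{q} < \tfrac12$. Then there are constants $c_1, c_2>0$ and infinitely many totally real cyclic quartic number fields $K$ such that \[ c_1 D_K^{p/q} \le M(\mathcal{O}_K) \le c_2 D_K^{p/q}. \]
   Context: For a nonconstant polynomial $f(x)=c\prod_{i=1}^d (x-\alpha_i)\in\mathbb{C}[x]$, the Mahler measure is $M(f)=|c|\prod_{|\alpha_i|\ge 1}|\alpha_i|$. For an algebraic number $\alpha$, $M(\alpha)$ is the Mahler measure of its minimal polynomial over $\mathbb{Z}$ (with content $1$). For a number field $K$ with ring of integers $\mathcal{O}_K$ and absolute discriminant $D_K$, $M(\mathcal{O}_K)=\min\{M(\alpha):\alpha\in\mathcal{O}_K,\ \mathbb{Q}(\alpha)=K\}$. A cyclic quartic field is a Galois quartic field with Galois group $\mathbb{Z}/4\mathbb{Z}$. *)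

(* Defs.v *)
From HB Require Import structures.
From mathcomp Require Import all_boot all_order all_algebra all_field.
Set Implicit Arguments. Unset Strict Implicit. Unset Printing Implicit Defensive.
Import Order.TTheory GRing.Theory Num.Theory.
Local Open Scope ring_scope.

(* All number fields are realised as subfields of algC (the algebraic closure
   of Q inside C, with its complex absolute value and partial order). *)

Definition nfield (theta : algC) : algC -> Prop :=
  fun x => exists p : {poly rat}, x = (map_poly ratr p).[theta].

Definition nf_degree (theta : algC) : nat := (size (minCpoly theta)).-1.

Definition alg_int (x : algC) : Prop :=
  exists p : {poly int}, p \is monic /\ root (map_poly intr p) x.

Definition ring_of_int (K : algC -> Prop) (x : algC) : Prop := K x /\ alg_int x.

(* Field embeddings K -> C (given as functions on algC, only their values on K
   matter). *)
Definition embedding (K : algC -> Prop) (s : algC -> algC) : Prop :=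
  s 1 = 1 /\
  (forall x y, K x -> K y -> s (x + y) = s x + s y) /\
  (forall x y, K x -> K y -> s (x * y) = s x * s y).

(* Field automorphisms of K (automatically Q-linear). *)
Definition automorphism (K : algC -> Prop) (s : algC -> algC) : Prop :=
  embedding K s /\ (forall x, K x -> K (s x)) /\
  (forall y, K y -> exists x, K x /\ s x = y).

Definition totally_real (K : algC -> Prop) : Prop :=
  forall s, embedding K s -> forall x, K x -> s x \is Num.real.

(* Cyclic quartic field Q(theta): degree 4, and Aut(K/Q) is cyclic of order 4
   (hence |Aut(K/Q)| = [K:Q], so K/Q is Galois with group Z/4Z). *)
Definition cyclic_quartic (theta : algC) : Prop :=
  let K := nfield theta in
  nf_degree theta = 4%N /\
  exists s, automorphism K s /\
    (forall i j : 'I_4, i <> j -> exists x, K x /\ iter i s x <> iter j s x) /\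
    (forall t, automorphism K t -> exists i : 'I_4, forall x, K x -> t x = iter i s x).

Definition abs_disc (K : algC -> Prop) (D : algC) : Prop :=
  exists (n : nat) (b : 'I_n -> algC) (s : 'I_n -> algC -> algC),
    (forall i, ring_of_int K (b i)) /\
    (forall y, ring_of_int K y ->
        exists c : 'I_n -> int, y = \sum_i (c i)%:~R * b i /\
          forall c' : 'I_n -> int, y = \sum_i (c' i)%:~R * b i -> c' =1 c) /\
    (forall j, embedding K (s j)) /\
    (forall j j', j <> j' -> exists x, K x /\ s j x <> s j' x) /\
    D = `| (\det (\matrix_(i, j) s j (b i))) ^+ 2 |.

Definition rootsC (f : {poly algC}) : seq algC := sval (closed_field_poly_normal f).

Definition mahler (f : {poly algC}) : algC :=
  `|lead_coef f| * \prod_(z <- rootsC f | 1 <= `|z|) `|z|.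

(* p is the minimal polynomial of alpha over Z with content 1 (and positive
   leading coefficient: zcontents p carries the sign of lead_coef p). *)
Definition minZpoly (alpha : algC) (p : {poly int}) : Prop :=
  p != 0 /\ root (map_poly intr p) alpha /\ zcontents p = 1 /\
  forall q : {poly int}, q != 0 -> root (map_poly intr q) alpha -> (size p <= size q)%N.

Definition mahler_alg (alpha m : algC) : Prop :=
  exists p, minZpoly alpha p /\ m = mahler (map_poly intr p).

Definition mahler_OK (K : algC -> Prop) (m : algC) : Prop :=
  (exists alpha, ring_of_int K alpha /\ (forall x, nfield alpha x <-> K x) /\
                 mahler_alg alpha m) /\
  (forall beta m', ring_of_int K beta -> (forall x, nfield beta x <-> K x) ->
                   mahler_alg beta m' -> m <= m').

(* x ^ r for x >= 0 real and r >= 0 rational: ((denq r)-th root of x)^(numq r). *)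
Definition rpow (x : algC) (r : rat) : algC := (`|denq r|%N).-root x ^+ `|numq r|%N.

Definition rad (n : nat) : nat := \prod_(p <- primes n) p.

(* The ABC conjecture: for every eps > 0 there is K_eps > 0 such that for all
   coprime positive integers a, b, c with a + b = c, c <= K_eps rad(abc)^(1+eps).
   (eps ranges over positive rationals, which is equivalent by monotonicity.) *)
Definition ABC : Prop :=
  forall eps : rat, 0 < eps -> exists Ke : algC, 0 < Ke /\
    forall a b c : nat, (0 < a)%N -> (0 < b)%N -> coprime a b -> a + b = c ->
      (c%:R : algC) <= Ke * rpow (rad (a * b * c))%:R (1 + eps).

(* Main.v *)
Require Import Defs.
From HB Require Import structures.
From mathcomp Require Import all_boot all_order all_algebra all_field.
From mathcomp Require Import ring lra zify.
From Stdlib Require Import ClassicalEpsilon.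
Import Order.TTheory GRing.Theory Num.Theory.
Local Open Scope ring_scope.

Set Implicit Arguments. Unset Strict Implicit. Unset Printing Implicit Defensive.

(** Let [A] and [B] be odd, with [A] and [D = B^2 + 1] squarefree and coprime. Put s^2 = D and t^2 =
    A (D + B s) = A s (s + B). Since (s - B)(s + B) = 1, the map s -> -s, t -> (s - B) t has order
    four, so K = Q(t) is a cyclic quartic field, totally real when s and t are real ([frame_cyclic],
    [frame_real]). Because [A] is odd and D is 2 modulo 4, the integers of K are exactly the span of
    1, s, t, st ([frame_integers]), and the discriminant is 256 A^2 D^3 ([frame_disc]), of order A^2
    B^6.

    Lower bound. If x0, x1, x2, x3 are the successive conjugates of a + bs + (c + ds)t, then (x0 -
    x2)(x1 - x3) = 4 (c^2 - D d^2) A s. For an integral generator the factor c^2 - D d^2 is a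
    nonzero integer, so the Mahler measure is at least A s ([height_lower]).

    Upper bound. Put t' = (s - B) t, so t t' = A s. The element x + ys - t has conjugates x + ys -
    t, x - ys - t', x + ys + t, x - ys + t'. If x is close to (t + t')/2 and 2ys is close to t - t',
    the first two are bounded and the others are O(t) and O(t'), so the measure is O(A s). Writing A
    = 2y^2 + k gives (t - t')^2 - (2ys)^2 = 2s (ks - A), so the requirement becomes |ks - A| <= C y
    ([approx_bound], [cyclic_quartic_mahler]).

    Hence M(O_K) has order A B. If B has order T^m and A has order T^n, then M has order T^(m+n) and
    the discriminant order T^(6m+2n). Taking m = q - 2p and n = 6p - q makes the exponent p/q, and
    1/4 <= p/q < 1/2 says exactly 0 < m <= n ([theorem_of_parameters]).

    What remains is to find such A, B, y, k for arbitrarily large T ([parameters]). If n = 2m, A is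
    a quadratic polynomial in B. If n < 2m, k is a power of 31 and B runs over a window near A/k. If
    n > 2m, B and y vary and A runs over a window where ks is close to A. Congruences modulo 30
    dispose of the primes 2, 3, 5. For p >= 7 a union bound suffices: the sum of p^-2 is at most
    1/12, Chebyshev's estimate makes the error terms small, and the parameters with a square factor
    or a common prime do not exhaust all of them. *)

Definition sqfree (m : nat) : Prop := forall p, prime p -> ~~ (p ^ 2 %| m)%N.

(** The squared denominator of [r] is coprime to the squared numerator, hence divides [m]; a
    nontrivial denominator would put the square of a prime into [m]. *)
Lemma sqfree_mul_sqr_int (m : nat) (r : rat) :
  sqfree m -> m%:R * r ^+ 2 \in Num.int -> r \in Num.int.
Proof.
move=> sqf /intrP[z hz].
have d0 : (denq r)%:~R != 0 :> rat by rewrite intr_eq0 denq_eq0.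
have e : (m%:Z * numq r ^+ 2 = z * denq r ^+ 2)%R.
  apply: (@intr_inj rat); rewrite !(rmorphM, rmorphXn) /= -hz -{2}(divq_num_den r).
  by field.
have e2 : (m * `|numq r| ^ 2 = `|z| * `|denq r| ^ 2)%N.
  by have := congr1 absz e; rewrite !abszM !mulnn.
have d1 : (`|denq r| ^ 2 %| m)%N.
  rewrite -(@Gauss_dvdl _ _ (`|numq r| ^ 2)); first by rewrite e2 dvdn_mull.
  by rewrite coprime_pexpl // coprime_pexpr // coprime_sym coprime_num_den.
have [d2|d2] := eqVneq `|denq r|%N 1%N.
  apply/intrP; exists (numq r); rewrite -{1}(divq_num_den r) -(gez0_abs (denq_ge0 r)) d2.
  by rewrite divr1.
have pp : prime (pdiv `|denq r|).
  by rewrite pdiv_prime // ltn_neqAle eq_sym d2 absz_gt0 denq_neq0.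
case/negP: (sqf _ pp); apply: dvdn_trans d1.
by rewrite dvdn_exp2r // pdiv_dvd.
Qed.

Lemma rat_sqr_int (r : rat) : r ^+ 2 \in Num.int -> r \in Num.int.
Proof.
move=> h; apply: (@sqfree_mul_sqr_int 1); last by rewrite mul1r.
move=> p pp; rewrite dvdn1; apply/eqP => e.
by have := prime_gt1 pp; nia.
Qed.

Lemma sqr_succ_not_sqr (B : nat) (r : rat) : (0 < B)%N -> r ^+ 2 != (B ^ 2 + 1)%:R.
Proof.
move=> B0; apply/eqP => e.
have /intrP[z ez] : r \in Num.int by apply: rat_sqr_int; rewrite e rpred_nat.
move: e; rewrite ez -rmorphXn /= pmulrn => /eqP; rewrite eqr_int => /eqP e.
have : (`|z| ^ 2 = B ^ 2 + 1)%N by have := congr1 absz e; rewrite abszX.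
rewrite -!mulnn; move: `|z|%N => w hw.
by have [h|h] := leqP w B; nia.
Qed.

(** * Coordinates on the basis 1, s, t, st *)

Definition quad := (rat * rat * rat * rat)%type.

(** The pair is (s, t). The signs of the square roots are left free, so that the four conjugate
    choices are all frames and the Galois action becomes a map on frames. *)
Definition frame (A B : nat) (f : algC * algC) : Prop :=
  f.1 ^+ 2 = (B ^ 2 + 1)%:R /\ f.2 ^+ 2 = A%:R * ((B ^ 2 + 1)%:R + B%:R * f.1).

Definition ev (f : algC * algC) (q : quad) : algC :=
  let: (a, b, c, d) := q in
  ratr a + ratr b * f.1 + (ratr c + ratr d * f.1) * f.2.

(** The images of s and t under a generator of the Galois group: ((s - B) t)^2 = A (D - B s),
    because (s - B)(s + B) = 1. *)
Definition nxt (B : nat) (f : algC * algC) : algC * algC :=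
  (- f.1, (f.1 - B%:R) * f.2).

(** The same automorphism read on coordinates, by expanding (c - d s)(s - B) t. *)
Definition twist (B : nat) (q : quad) : quad :=
  let: (a, b, c, d) := q in
  (a, - b, - (c * B%:R + d * (B ^ 2 + 1)%:R), c + d * B%:R).

Definition qmul (A B : nat) (x y : quad) : quad :=
  let: (a, b, c, d) := x in let: (a', b', c', d') := y in
  let D : rat := (B ^ 2 + 1)%:R in
  let P := c * c' + D * (d * d') in let Q := c * d' + d * c' in
  (a * a' + D * (b * b') + A%:R * D * (P + Q * B%:R),
   a * b' + b * a' + A%:R * (P * B%:R + Q * D),
   a * c' + D * (b * d') + (c * a' + D * (d * b')),
   a * d' + b * c' + (c * b' + d * a')).

Definition qadd (x y : quad) : quad :=
  let: (a, b, c, d) := x in let: (a', b', c', d') := y in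
  (a + a', b + b', c + c', d + d').

Lemma ev_add f x y : ev f (qadd x y) = ev f x + ev f y.
Proof.
by case: x => [[[a b] c] d]; case: y => [[[a' b'] c'] d'] /=; ring.
Qed.

Lemma ev_mul A B f x y : frame A B f -> ev f (qmul A B x y) = ev f x * ev f y.
Proof.
case: f => s t [/= s2 t2].
by case: x => [[[a b] c] d]; case: y => [[[a' b'] c'] d'] /=; ring: s2 t2.
Qed.

Lemma ev_rat f a : ev f (a, 0, 0, 0) = ratr a.
Proof. by rewrite /=; ring. Qed.

Lemma frame_nxt A B f : frame A B f -> frame A B (nxt B f).
Proof. by case: f => s t [/= s2 t2]; split => /=; ring: s2 t2. Qed.

Lemma frame_iter A B f i : frame A B f -> frame A B (iter i (nxt B) f).
Proof. by move=> h; elim: i => //= i; apply: frame_nxt. Qed.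

Lemma ev_nxt A B f q : frame A B f -> ev (nxt B f) q = ev f (twist B q).
Proof. by case: f => s t [/= s2 t2]; case: q => [[[a b] c] d] /=; ring: s2 t2. Qed.

Lemma ev_iter A B f q i : frame A B f ->
  ev (iter i (nxt B) f) q = ev f (iter i (twist B) q).
Proof.
move=> h; elim: i q => // i IH q.
by rewrite iterS (ev_nxt _ (frame_iter i h)) IH iterSr.
Qed.

Lemma nxt2 A B f : frame A B f -> nxt B (nxt B f) = (f.1, - f.2).
Proof. by case: f => s t [/= s2 t2]; rewrite /nxt /=; congr pair; ring: s2. Qed.

Section Frame.
Variables (A B : nat) (A0 : (0 < A)%N) (B0 : (0 < B)%N).
Let D := (B ^ 2 + 1)%N.

Lemma sqrt_free (s : algC) (a b : rat) : s ^+ 2 = D%:R ->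
  ratr a + ratr b * s = 0 -> a = 0 /\ b = 0.
Proof.
move=> s2 e; have [b0|b0] := eqVneq b 0.
  by split=> //; apply: (fmorph_inj (ratr : rat -> algC)); rewrite rmorph0 -[RHS]e b0; ring.
case/eqP: (sqr_succ_not_sqr (a / b) B0).
apply: (fmorph_inj (ratr : rat -> algC)).
have b1 : ratr b != 0 :> algC by rewrite fmorph_eq0.
rewrite rmorphXn /= rmorph_nat -s2 -sqrrN; congr (_ ^+ 2).
rewrite fmorph_div; apply: (mulIf b1); rewrite mulNr divfK //.
by apply/eqP; rewrite -subr_eq0 -opprD oppr_eq0 mulrC e.
Qed.

Lemma rat_norm_eq0 (a b : rat) : a ^+ 2 = D%:R * b ^+ 2 -> a = 0 /\ b = 0.
Proof.
move=> e; have [b0|b0] := eqVneq b 0.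
  by split=> //; move: e; rewrite b0 expr0n mulr0 => /eqP; rewrite sqrf_eq0 => /eqP.
case/eqP: (sqr_succ_not_sqr (a / b) B0).
by rewrite expr_div_n e mulfK // sqrf_eq0.
Qed.

(** Multiplying by the conjugate under t -> -t gives (a + bs)^2 = (c + ds)^2 t^2 in Q(s). Norms to Q
    then give (a^2 - D b^2)^2 = D (A (c^2 - D d^2))^2. As D is not a rational square, all four
    coordinates vanish. *)
Lemma ev_eq0 f q : frame A B f -> ev f q = 0 -> q = (0, 0, 0, 0).
Proof.
case: f => s t [/= s2 t2]; case: q => [[[a b] c] d] /= e.
have AQ : (A%:R : rat) != 0 by rewrite pnatr_eq0 -lt0n.
pose P := A%:R * (D%:R * (c ^+ 2 + D%:R * d ^+ 2) + 2 * c * d * B%:R * D%:R).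
pose Q := A%:R * (B%:R * (c ^+ 2 + D%:R * d ^+ 2) + 2 * c * d * D%:R).
have e1 : ratr (a ^+ 2 + D%:R * b ^+ 2 - P) + ratr (2 * a * b - Q) * s = 0.
  have -> : 0 = (ratr a + ratr b * s + (ratr c + ratr d * s) * t) *
     (ratr a + ratr b * s - (ratr c + ratr d * s) * t) :> algC by rewrite e mul0r.
  by rewrite /P /Q /D; ring: s2 t2.
have [/eqP] := sqrt_free s2 e1; rewrite subr_eq0 => /eqP eP /eqP.
rewrite subr_eq0 => /eqP eQ.
have e2 : (a ^+ 2 - D%:R * b ^+ 2) ^+ 2 = D%:R * (A%:R * (c ^+ 2 - D%:R * d ^+ 2)) ^+ 2.
  have -> : (a ^+ 2 - D%:R * b ^+ 2) ^+ 2 = (a ^+ 2 + D%:R * b ^+ 2) ^+ 2 - D%:R * (2 * a * b) ^+ 2 by ring.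
  by rewrite eP eQ /P /Q /D; ring.
have [e3 /eqP] := rat_norm_eq0 e2.
rewrite mulf_eq0 (negPf AQ) /= subr_eq0 => /eqP /rat_norm_eq0 [c0 d0].
have [] := @sqrt_free s a b s2; last by move=> -> ->; rewrite c0 d0.
by rewrite -[RHS]e c0 d0; ring.
Qed.

Lemma ev_inj f : frame A B f -> injective (ev f).
Proof.
move=> h [[[a b] c] d] [[[a' b'] c'] d'] e.
have /(ev_eq0 h) : ev f (a - a', b - b', c - c', d - d') = 0.
  move/eqP: e; rewrite -subr_eq0 => /eqP <- /=; ring.
by case=> /eqP + /eqP + /eqP + /eqP; rewrite !subr_eq0 => /eqP-> /eqP-> /eqP-> /eqP->.
Qed.

(** The coordinates [q'] are chosen before the frame. This uniformity is what makes values at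
    different frames conjugate in [root_conj]. *)
Lemma ev_poly (p : {poly rat}) q : exists q', forall f, frame A B f ->
  (map_poly ratr p).[ev f q] = ev f q'.
Proof.
elim/poly_ind: p => [|p c [q' IH]].
  by exists (0, 0, 0, 0) => f _; rewrite rmorph0 horner0 /=; ring.
exists (qadd (qmul A B q' q) (c, 0, 0, 0)) => f h.
rewrite rmorphD rmorphM /= map_polyX map_polyC /= hornerMXaddC IH // ev_add (ev_mul _ _ h).
by rewrite ev_rat.
Qed.

Lemma root_conj f g q (p : {poly rat}) : frame A B f -> frame A B g ->
  root (map_poly ratr p) (ev f q) -> root (map_poly ratr p) (ev g q).
Proof.
move=> hf hg; have [q' hq] := ev_poly p q.
rewrite !rootE !hq // => /eqP /(ev_eq0 hf) ->.
by apply/eqP => /=; ring.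
Qed.

Lemma nfieldP f x : frame A B f -> nfield f.2 x <-> exists q, x = ev f q.
Proof.
move=> h; split=> [[p ->]|[q ->]].
  have [q hq] := ev_poly p (0, 0, 1, 0); exists q; rewrite -hq //.
  by congr (_.[_]) => /=; ring.
case: f h => s t [/= s2 t2]; case: q => [[[a b] c] d].
have AQ : (A%:R : algC) != 0 by rewrite pnatr_eq0 -lt0n.
have BQ : (B%:R : algC) != 0 by rewrite pnatr_eq0 -lt0n.
(* s is recovered from t as (t^2 / A - D) / B. *)
pose S : {poly rat} := (B%:R^-1)%:P * ((A%:R^-1)%:P * ('X * 'X) - (D%:R)%:P).
exists (a%:P + b%:P * S + (c%:P + d%:P * S) * 'X).
have -> : s = (map_poly ratr S).[t].
  rewrite /S !(rmorphM, rmorphB) /= !map_polyC /= map_polyX !hornerE /= !fmorphV !rmorph_nat -[A%:R^-1 * t * t]mulrA -expr2 t2 /D.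
  by field; rewrite BQ AQ.
by rewrite !(rmorphM, rmorphD) /= !map_polyC /= map_polyX !hornerE.
Qed.

End Frame.

(** * The Galois group is cyclic of order four *)

(** Coordinates are unique by [ev_inj], so on the field this inverts [ev f]; elsewhere the value is
    arbitrary, which is harmless since embeddings matter only on the field. *)
Definition coord (f : algC * algC) (x : algC) : quad :=
  epsilon (inhabits (0, 0, 0, 0)) (fun q => x = ev f q).

Definition sigma (B : nat) (f : algC * algC) (x : algC) : algC :=
  ev (nxt B f) (coord f x).

Section Galois.
Variables (A B : nat) (A0 : (0 < A)%N) (B0 : (0 < B)%N).
Variables (f : algC * algC) (hf : frame A B f).
Let D := (B ^ 2 + 1)%N.
Let K := nfield f.2.

Let nfP x : K x <-> exists q, x = ev f q := nfieldP A0 B0 x hf.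

Lemma ev_nf q : K (ev f q).
Proof. by apply/nfP; exists q. Qed.

Lemma coord_ev q : coord f (ev f q) = q.
Proof.
apply: (ev_inj A0 B0 hf); symmetry.
by apply: (epsilon_spec (inhabits (0, 0, 0, 0)) (fun q' => ev f q = ev f q')); exists q.
Qed.

Lemma sigma_ev q : sigma B f (ev f q) = ev f (twist B q).
Proof. by rewrite /sigma coord_ev (ev_nxt _ hf). Qed.

Lemma iter_sigma_ev i q : iter i (sigma B f) (ev f q) = ev (iter i (nxt B) f) q.
Proof.
rewrite (ev_iter _ _ hf); elim: i q => // i IH q.
by rewrite iterSr sigma_ev IH iterSr.
Qed.

Lemma iter_sigma_embedding i : embedding K (iter i (sigma B f)).
Proof.
have hi := frame_iter i hf.
split; last split.
- by have := iter_sigma_ev i (1, 0, 0, 0); rewrite !ev_rat rmorph1.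
- move=> _ _ /nfP[q ->] /nfP[q' ->].
  by rewrite -ev_add !iter_sigma_ev ev_add.
- move=> _ _ /nfP[q ->] /nfP[q' ->].
  by rewrite -(ev_mul _ _ hf) !iter_sigma_ev (ev_mul _ _ hi).
Qed.

Lemma iter_nxt4 : iter 4 (nxt B) f = f.
Proof.
by rewrite 2!iterS (nxt2 (frame_iter 2 hf)) /= opprK; case: (f) hf => s t [/= s2 _]; congr pair; ring: s2.
Qed.

Lemma iter_twist4 q : iter 4 (twist B) q = q.
Proof. by apply: (ev_inj A0 B0 hf); rewrite -(ev_iter _ _ hf) iter_nxt4. Qed.

Lemma sigma_automorphism : automorphism K (sigma B f).
Proof.
split; first exact: (iter_sigma_embedding 1).
split=> [_ /nfP[q ->]|_ /nfP[q ->]].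
  by rewrite sigma_ev; apply: ev_nf.
exists (ev f (iter 3 (twist B) q)); split; first exact: ev_nf.
by rewrite sigma_ev -iterS iter_twist4.
Qed.

Lemma embedding_rat s a : embedding K s -> s (ratr a) = ratr a.
Proof.
move=> [s1 [sD sM]].
have Kr r : K (ratr r) by rewrite -(ev_rat f); apply: ev_nf.
have s0 : s 0 = 0.
  by have := sD _ _ (Kr 0) (Kr 0); rewrite rmorph0 addr0 => /eqP; rewrite -subr_eq subrr eq_sym => /eqP.
have sn (n : nat) : s n%:R = n%:R.
  elim: n => // n IH; rewrite -addn1 natrD sD ?IH ?s1 //.
    by have := Kr n%:R; rewrite rmorph_nat.
  by have := Kr 1; rewrite rmorph1.
have sN x : K x -> s (- x) = - s x.
  move=> Kx; apply/eqP; rewrite eq_sym -subr_eq0 -opprD oppr_eq0 -sD ?subrr ?s0 //.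
  by case/nfP: Kx => [[[[a' b'] c'] d'] ->]; apply/nfP; exists (- a', - b', - c', - d') => /=; ring.
have si (n : int) : s n%:~R = n%:~R.
  case: n => n; first exact: sn.
  rewrite NegzE rmorphN /= sN ?sn //.
  by have := Kr n.+1%:R; rewrite rmorph_nat.
have d0 : (denq a)%:~R != 0 :> algC by rewrite intr_eq0 denq_eq0.
apply: (mulIf d0).
rewrite -[X in _ * X = _]si -sM //; last by have := Kr (denq a)%:~R; rewrite ratr_int.
rewrite [ratr a * _]divfK // si.
Qed.

(** An embedding is determined by the images of s and t. The first is s or -s, and either choice
    leaves two square roots for the image of t; the four resulting pairs are the iterates of
    [nxt]. *)
Lemma embedding_iter s : embedding K s ->
  exists i : 'I_4, forall x, K x -> s x = iter i (sigma B f) x.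
Proof.
move=> hs; have [s1 [sD sM]] := hs.
have Kf1 : K f.1 by apply/nfP; exists (0, 1, 0, 0) => /=; ring.
have Kf2 : K f.2 by apply/nfP; exists (0, 0, 1, 0) => /=; ring.
have Kr r : K (ratr r) by rewrite -(ev_rat f); apply: ev_nf.
have KM x y : K x -> K y -> K (x * y).
  by move=> /nfP[q ->] /nfP[q' ->]; apply/nfP; exists (qmul A B q q'); rewrite (ev_mul _ _ hf).
have KD x y : K x -> K y -> K (x + y).
  by move=> /nfP[q ->] /nfP[q' ->]; apply/nfP; exists (qadd q q'); rewrite ev_add.
have sE q : s (ev f q) = ev (s f.1, s f.2) q.
  case: q => [[[a b] c] d] /=.
  have k1 v := KM _ _ (Kr v) Kf1; have k2 u v := KD _ _ (Kr u) (k1 v).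
  rewrite (sD _ _ (k2 a b) (KM _ _ (k2 c d) Kf2)) (sM _ _ (k2 c d) Kf2).
  by rewrite !(sD _ _ (Kr _) (k1 _)) !(sM _ _ (Kr _) Kf1) !(embedding_rat _ hs).
have [f1 f2] := hf.
have sn (n : nat) : s n%:R = n%:R by have := embedding_rat n%:R hs; rewrite rmorph_nat.
have Kn (n : nat) : K n%:R by have := Kr n%:R; rewrite rmorph_nat.
have e1 : s f.1 ^+ 2 = f.1 ^+ 2 by rewrite expr2 -sM // -expr2 f1 sn.
have e2 : s f.2 ^+ 2 = A%:R * (D%:R + B%:R * s f.1).
  have k1 := KM _ _ (Kn B) Kf1; have k2 := KD _ _ (Kn D) k1.
  rewrite expr2 -sM // -expr2 f2 (sM _ _ (Kn A) k2) (sD _ _ (Kn D) k1).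
  by rewrite (sM _ _ (Kn B) Kf1) !sn.
suff [i hi] : exists i : 'I_4, (s f.1, s f.2) = iter i (nxt B) f.
  by exists i => _ /nfP[q ->]; rewrite sE iter_sigma_ev hi.
move/eqP: e1; rewrite eqf_sqr => /orP[]/eqP e1.
  move: e2; rewrite e1 -f2 => /eqP; rewrite eqf_sqr => /orP[]/eqP e2.
    by exists ord0; rewrite e2; case: (f).
  by exists (inord 2); rewrite inordK //= (nxt2 hf) e2.
have e3 : s f.2 ^+ 2 = ((f.1 - B%:R) * f.2) ^+ 2.
  by have [_ /= ->] := frame_nxt hf; rewrite e2 e1.
move/eqP: e3; rewrite eqf_sqr => /orP[]/eqP e3.
  by exists (inord 1); rewrite inordK //= e1 e3.
exists (inord 3); rewrite inordK //= (nxt2 (frame_nxt hf)) e1 e3 //=.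
Qed.

(** If two conjugates coincide, (c, d) solves a nonsingular homogeneous linear system. The
    identities closed by [ring] solve these systems by Cramer's rule, using D - B^2 = 1. *)
Lemma conj_uniq a b c d : (c, d) != (0, 0) ->
  uniq [seq ev (iter i (nxt B) f) (a, b, c, d) | i <- iota 0 4].
Proof.
move=> cd.
have fin : ~ (2 * c = 0 /\ 2 * d = 0).
  case=> /eqP c0 /eqP d0; move: c0 d0 cd; rewrite !mulf_eq0 /= => /eqP-> /eqP->.
  by rewrite eqxx.
have n01 : ~ (c = - (c * B%:R + d * (B ^ 2 + 1)%:R) /\ d = c + d * B%:R).
  move=> [/eqP]; rewrite -subr_eq0 => /eqP e1 /eqP; rewrite -subr_eq0 => /eqP e2.
  apply: fin; split.
    rewrite -[RHS](mulr0 (1 - B%:R)) -{1}e1.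
    transitivity ((1 - B%:R) * (c - - (c * B%:R + d * (B ^ 2 + 1)%:R)) - (B ^ 2 + 1)%:R * (d - (c + d * B%:R))).
      by ring.
    by rewrite e1 e2; ring.
  transitivity ((c - - (c * B%:R + d * (B ^ 2 + 1)%:R)) + (1 + B%:R) * (d - (c + d * B%:R))).
    by ring.
  by rewrite e1 e2; ring.
have n03 : ~ (c = (c * B%:R + d * (B ^ 2 + 1)%:R) /\ d = - (c + d * B%:R)).
  move=> [/eqP]; rewrite -subr_eq0 => /eqP e1 /eqP; rewrite -subr_eq0 => /eqP e2.
  apply: fin; split.
    transitivity ((1 + B%:R) * (c - (c * B%:R + d * (B ^ 2 + 1)%:R)) + (B ^ 2 + 1)%:R * (d - - (c + d * B%:R))).
      by ring.
    by rewrite e1 e2; ring.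
  transitivity ((1 - B%:R) * (d - - (c + d * B%:R)) - (c - (c * B%:R + d * (B ^ 2 + 1)%:R))).
    by ring.
  by rewrite e1 e2; ring.
have n13 : ~ (c * B%:R + d * (B ^ 2 + 1)%:R = 0 /\ c + d * B%:R = 0).
  move=> [e1 e2]; apply: fin; split.
    transitivity (2 * ((B ^ 2 + 1)%:R * (c + d * B%:R) - B%:R * (c * B%:R + d * (B ^ 2 + 1)%:R))).
      by ring.
    by rewrite e1 e2; ring.
  transitivity (2 * ((c * B%:R + d * (B ^ 2 + 1)%:R) - B%:R * (c + d * B%:R))).
    by ring.
  by rewrite e1 e2; ring.
have E0 : ev (iter 0 (nxt B) f) (a, b, c, d) = ev f (a, b, c, d) by [].
have E1 : ev (iter 1 (nxt B) f) (a, b, c, d) =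
    ev f (a, - b, - (c * B%:R + d * (B ^ 2 + 1)%:R), c + d * B%:R).
  by rewrite (ev_iter _ _ hf).
have E2 : ev (iter 2 (nxt B) f) (a, b, c, d) = ev f (a, b, - c, - d).
  by rewrite (ev_iter _ _ hf) /=; ring.
have E3 : ev (iter 3 (nxt B) f) (a, b, c, d) =
    ev f (a, - b, c * B%:R + d * (B ^ 2 + 1)%:R, - (c + d * B%:R)).
  by rewrite (ev_iter _ _ hf) /=; ring.
have inj := inj_eq (ev_inj A0 B0 hf).
change (uniq [:: ev (iter 0 (nxt B) f) (a, b, c, d); ev (iter 1 (nxt B) f) (a, b, c, d);
  ev (iter 2 (nxt B) f) (a, b, c, d); ev (iter 3 (nxt B) f) (a, b, c, d)]).
rewrite E0 E1 E2 E3 !cons_uniq !inE !inj !negb_or.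
have half x : x = - x :> rat -> 2 * x = 0.
  by move=> e; rewrite -(subrr x) {3}e; ring.
do !(apply/andP; split) => //; apply/eqP => -[].
- by move=> _ e1 e2; apply: n01.
- by move=> /half e1 /half e2; apply: fin.
- by move=> _ e1 e2; apply: n03.
- move=> _ e1 e2; apply: n03; split; first by apply: oppr_inj.
  by rewrite e2 opprK.
- move=> /esym/half/eqP + /half/eqP; rewrite !mulf_eq0 /= => /eqP e1 /eqP e2.
  by apply: n13.
- move=> _ e1 e2; apply: n01; split; first by rewrite -e1 opprK.
  by apply: oppr_inj.
Qed.

Lemma conj_root_size (p : {poly rat}) a b c d : (c, d) != (0, 0) -> p != 0 ->
  root (map_poly ratr p) (ev f (a, b, c, d)) -> (4 < size p)%N.
Proof.
move=> cd p0 hr.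
have := @max_poly_roots _ (map_poly ratr p : {poly algC})
  [seq ev (iter i (nxt B) f) (a, b, c, d) | i <- iota 0 4].
rewrite size_map_poly map_poly_eq0 size_map size_iota; apply => //.
  by apply/allP => _ /mapP[i _ ->]; apply: (root_conj A0 B0 hf (frame_iter i hf)).
exact: conj_uniq.
Qed.

Lemma frame_degree : nf_degree f.2 = 4%N.
Proof.
rewrite /nf_degree; have [p [-> pm] hp] := minCpolyP f.2.
rewrite size_map_poly.
have e2 : f.2 = ev f (0, 0, 1, 0) by rewrite /=; ring.
have : (4 < size p)%N.
  apply: (@conj_root_size p 0 0 1 0) => //; first exact: monic_neq0.
  by rewrite -e2 hp.
suff : (size p <= 5)%N by case: (size p) => // [[|[|[|[|[|[|?]]]]]]].
pose c2 : rat := - (2 * A%:R * D%:R).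
have [c0 ec0] : exists c : rat, c = (A%:R * D%:R) ^+ 2 - (A%:R * B%:R) ^+ 2 * D%:R by eexists.
(* This is (X^2 - A D)^2 - A^2 B^2 D, which kills t because t^2 - A D = A B s. *)
pose P : {poly rat} := 'X^4 + (c2 *: 'X^2 + c0%:P).
have sP : size P = 5%N.
  rewrite /P size_polyDl size_polyXn // ltnS (leq_trans (size_polyD _ _)) // geq_max.
  rewrite (leq_trans (size_scale_leq _ _)) ?size_polyXn //.
  by rewrite (leq_trans (size_polyC_leq1 _)).
rewrite -sP dvdp_leq -?size_poly_eq0 ?sP // -hp rootE.
rewrite /P !rmorphD /= linearZ /= map_polyC !map_polyXn !hornerE /=.
have [f1 f21] := hf.
by apply/eqP; rewrite /c2 ec0 /D; ring: f1 f21.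
Qed.

Lemma iter_sigma_neq (i j : 'I_4) : i <> j ->
  exists x, K x /\ iter i (sigma B f) x <> iter j (sigma B f) x.
Proof.
move/eqP => ij; exists (ev f (0, 0, 1, 0)); split; first exact: ev_nf.
rewrite !iter_sigma_ev; apply/eqP.
have := conj_uniq 0 0 (isT : (1, 0) != (0, 0) :> rat * rat).
set l := map _ _ => ul.
have nl (k : 'I_4) : nth 0 l k = ev (iter k (nxt B) f) (0, 0, 1, 0).
  by rewrite (nth_map 0%N) ?size_iota ?nth_iota.
by rewrite -!nl nth_uniq ?size_map ?size_iota.
Qed.

Lemma frame_cyclic : cyclic_quartic f.2.
Proof.
split; first exact: frame_degree.
exists (sigma B f); split; first exact: sigma_automorphism.
by split=> [|t [ht _]]; [exact: iter_sigma_neq | exact: embedding_iter].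
Qed.

Lemma frame_real : f.1 \is Num.real -> f.2 \is Num.real -> totally_real K.
Proof.
move=> r1 r2 s /embedding_iter[i hi] x Kx; rewrite hi //.
case/nfP: Kx => [[[[a b] c] d] ->]; rewrite iter_sigma_ev (ev_iter _ _ hf).
have rr (a' : rat) : (ratr a' : algC) \is Num.real by exact: (Creal_Crat (Crat_rat a')).
case: (iter i _ _) => [[[a' b'] c'] d'] /=.
exact: (realD (realD (rr a') (realM (rr b') r1)) (realM (realD (rr c') (realM (rr d') r1)) r2)).
Qed.

End Galois.

(** * The ring of integers *)

Lemma sqfree_mul m n : coprime m n -> sqfree m -> sqfree n -> sqfree (m * n).
Proof.
move=> co hm hn p pp; apply/negP => hd.
have [pm|pm] := boolP (p %| m)%N.
  case/negP: (hm p pp); rewrite -(@Gauss_dvdl _ _ n) //.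
  by rewrite coprime_pexpl //; apply: coprime_dvdl pm co.
case/negP: (hn p pp); rewrite -(@Gauss_dvdr _ m) //.
by rewrite coprime_pexpl // prime_coprime.
Qed.

Lemma eq_mem_pred (T : Type) (P : {pred T}) x y : x = y -> x \in P -> y \in P.
Proof. by move->. Qed.

Lemma sqfree2 : sqfree 2.
Proof.
move=> p pp; apply/negP => /dvdn_leq -/(_ isT).
by have := prime_gt1 pp; rewrite -mulnn; nia.
Qed.

Lemma alg_int_Aint x : alg_int x <-> x \in Aint.
Proof.
split=> [[p [pm px]]|hx].
  apply: (root_monic_Aint px); first exact: monic_map.
  by apply/polyOverP => i; rewrite coef_map /= rpred_int.
have [p hp] := floorpP hx; exists p; split.
  have := minCpoly_monic x; rewrite hp !monicE lead_coef_map_inj //; last exact: intr_inj.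
  by rewrite -[1](mulr1z 1) eqr_int.
by rewrite -hp root_minCpoly.
Qed.

Lemma int_parity (x : int) : exists y, x = 2 * y \/ x = 2 * y + 1.
Proof. by exists (x %/ 2)%Z; lia. Qed.

Lemma even_of_norm (M N z j : int) :
  M * M - (4 * j + 2) * (N * N) = 4 * z -> (exists m, M = 2 * m) /\ (exists n, N = 2 * n).
Proof.
have [m [->|->]] := int_parity M; have [n [->|->]] := int_parity N => e.
- by split; [exists m | exists n].
- by exfalso; lia.
- by exfalso; lia.
- by exfalso; lia.
Qed.

(** The two left-hand sides are the coordinates of the norm to Q(s), for doubled coordinates a, b,
    c, e. With A and B odd and D congruent to 2 modulo 4, the equations successively force a, c, e
    and b to be even. *)
Lemma even_of_rel_norm (A' B' a b c e z1 z2 : int) :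
  let A := 2 * A' + 1 in let B := 2 * B' + 1 in let D := B * B + 1 in
  a * a + D * (b * b) - A * D * (c * c + D * (e * e) + 2 * c * e * B) = 4 * z1 ->
  2 * a * b - A * ((c * c + D * (e * e)) * B + 2 * c * e * D) = 4 * z2 ->
  [/\ exists x, a = 2 * x, exists x, b = 2 * x, exists x, c = 2 * x & exists x, e = 2 * x].
Proof.
move=> A B D.
have eD : D = 4 * (B' * B' + B') + 2 by rewrite /D /B; ring.
clearbody D; rewrite /A /B eD => e1 e2 {eD}.
set j := B' * B' + B' in e1 e2; clearbody j.
have [x [ex|ex]] := int_parity a; last by exfalso; rewrite ex in e1; lia.
rewrite {}ex in e1 e2 *.
have [y [ey|ey]] := int_parity c; last by exfalso; rewrite ey in e2; lia.
rewrite {}ey in e1 e2 *.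
have [w [ew|ew]] := int_parity e; last by exfalso; rewrite ew in e2; lia.
rewrite {}ew in e1 e2 *.
have [v [ev|ev]] := int_parity b; last by exfalso; rewrite ev in e1; lia.
by split; [exists x|exists v|exists y|exists w].
Qed.

Section Integers.
Variables (A B : nat) (Aodd : odd A) (Bodd : odd B).
Let D := (B ^ 2 + 1)%N.
Hypotheses (sqA : sqfree A) (sqD : sqfree D) (coAD : coprime A D).

Let A0 : (0 < A)%N. Proof. by case: A Aodd. Qed.
Let B0 : (0 < B)%N. Proof. by case: B Bodd. Qed.

Lemma conj_Aint f g q : frame A B f -> frame A B g ->
  ev f q \in Aint -> ev g q \in Aint.
Proof.
move=> hf hg /alg_int_Aint [p [pm px]]; apply/alg_int_Aint; exists p; split=> //.
have e : map_poly intr p = map_poly ratr (map_poly intr p : {poly rat}) :> {poly algC}.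
  by rewrite -map_poly_comp; apply: eq_map_poly => x /=; rewrite ratr_int.
by move: px; rewrite e; apply: (root_conj A0 B0).
Qed.

Lemma ratr_Aint (a : rat) : (ratr a : algC) \in Aint -> a \in Num.int.
Proof. by move=> h; rewrite -Cint_rat; apply: Cint_rat_Aint => //; apply: Crat_rat. Qed.

Lemma D_mod4 : exists j : int, (D%:R : rat) = (4 * j + 2)%:~R.
Proof.
exists (Posz (B./2 * B./2 + B./2)%N).
rewrite /D -[in LHS](odd_double_half B) Bodd -mul2n.
by rewrite !(rmorphM, rmorphD) /=; ring.
Qed.

(** Trace and norm are integral, so 2a and 2b are integers by squarefreeness of D; since D is 2
    modulo 4, [even_of_norm] excludes half-integers. *)
Lemma quadratic_int f (a b : rat) : frame A B f ->
  ratr a + ratr b * f.1 \in Aint -> a \in Num.int /\ b \in Num.int.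
Proof.
move=> hf.
have -> : ratr a + ratr b * f.1 = ev f (a, b, 0, 0) by rewrite /=; ring.
move=> h1; have h2 := conj_Aint hf (frame_nxt hf) h1.
have [f1 f2] := hf.
have /ratr_Aint/intrP[M eM] : ratr (2 * a) \in Aint.
  have -> : ratr (2 * a) = ev f (a, b, 0, 0) + ev (nxt B f) (a, b, 0, 0) by rewrite /=; ring.
  exact: rpredD.
have /ratr_Aint/intrP[z ez] : ratr (a ^+ 2 - D%:R * b ^+ 2) \in Aint.
  have -> : ratr (a ^+ 2 - D%:R * b ^+ 2) = ev f (a, b, 0, 0) * ev (nxt B f) (a, b, 0, 0).
    by rewrite /D /=; ring: f1.
  exact: rpredM.
have /(sqfree_mul_sqr_int sqD)/intrP[N eN] : D%:R * (2 * b) ^+ 2 \in Num.int.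
  have -> : D%:R * (2 * b) ^+ 2 = (2 * a) ^+ 2 - 4 * (a ^+ 2 - D%:R * b ^+ 2) by ring.
  by rewrite eM ez rpredB ?rpredX ?rpredM ?rpred_int ?rpred_nat.
have [j ej] := D_mod4.
have [] := @even_of_norm M N z j.
  apply: (@intr_inj rat); rewrite !(rmorphM, rmorphB, rmorphN, rmorphD) /= -eM -eN -ez ej.
  by rewrite !(rmorphM, rmorphD) /=; ring.
move=> [m em] [n en]; split; apply/intrP.
  by exists m; apply: (@mulfI _ (2 : rat)) => //; rewrite eM em rmorphM.
by exists n; apply: (@mulfI _ (2 : rat)) => //; rewrite eN en rmorphM.
Qed.

Lemma frame_Aint f : frame A B f -> f.1 \in Aint /\ f.2 \in Aint.
Proof.
move=> [f1 f2].
have sqrtA x : x ^+ 2 \in Aint -> x \in Aint.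
  move=> hx; apply: (@root_monic_Aint (minCpoly (x ^+ 2) \Po 'X^2)).
  - by rewrite rootE horner_comp hornerXn -rootE root_minCpoly.
  - rewrite monicE lead_coef_comp ?size_polyXn // lead_coefXn expr1n mulr1.
    by rewrite -monicE minCpoly_monic.
  - by apply: polyOver_comp => //; rewrite polyOverXn.
have h1 : f.1 \in Aint by apply: (sqrtA); rewrite f1; apply: Aint_Cnat; exact: natr_nat.
split=> //; apply: sqrtA; rewrite f2.
by rewrite rpredM ?rpredD ?rpredM ?rpred_nat.
Qed.

(** Combinations of conjugates lying in Q(s) bound the denominators of all coordinates by 2; the
    norm to Q(s), read modulo 4, removes the remaining halves. *)
Lemma frame_integers f a b c d : frame A B f -> ev f (a, b, c, d) \in Aint ->
  [/\ a \in Num.int, b \in Num.int, c \in Num.int & d \in Num.int].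
Proof.
move=> hf hy; have [f1 f2] := hf.
have [s_int t_int] := frame_Aint hf.
have y1 := conj_Aint hf (frame_iter 1 hf) hy.
have y2 := conj_Aint hf (frame_iter 2 hf) hy.
have y3 := conj_Aint hf (frame_iter 3 hf) hy.
have Bint : (B%:R : algC) \in Aint by rewrite rpred_nat.
have [/intrP[a1 ea] /intrP[b1 eb]] : 2 * a \in Num.int /\ 2 * b \in Num.int.
  apply: (quadratic_int hf); apply: (eq_mem_pred _ (rpredD hy y2)) => /=; ring: f1.
(* Since t^2 (s - B) = A s, the element in [h] equals 4 A s (c + d s)^2, and these are its
   coordinates on 1, s. *)
have [i1 i2] : 2 * A%:R * (2 * c) * (2 * d) * D%:R \in Num.int /\
    A%:R * ((2 * c) ^+ 2 + D%:R * (2 * d) ^+ 2) \in Num.int.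
  have h : (ev f (a, b, c, d) - ev (iter 2 (nxt B) f) (a, b, c, d)) ^+ 2 * (f.1 - B%:R) \in Aint.
    by rewrite rpredM ?rpredX ?rpredB.
  apply: (quadratic_int hf); apply: (eq_mem_pred _ h) => /=; rewrite /D; ring: f1 f2.
have [_ i3] : (0 : rat) \in Num.int /\ A%:R * ((2 * c) ^+ 2 - D%:R * (2 * d) ^+ 2) \in Num.int.
  have h : (ev f (a, b, c, d) - ev (iter 2 (nxt B) f) (a, b, c, d)) *
      (ev (iter 1 (nxt B) f) (a, b, c, d) - ev (iter 3 (nxt B) f) (a, b, c, d)) \in Aint.
    by rewrite rpredM ?rpredB.
  apply: (quadratic_int hf); apply: (eq_mem_pred _ h) => /=; rewrite /D; ring: f1 f2.
have co2A : coprime 2 A by rewrite coprime2n.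
(* Adding [i2] and [i3] isolates 2A (2c)^2, and 2A is squarefree because A is odd. *)
have /intrP[c1 ec] : 2 * c \in Num.int.
  apply: (@sqfree_mul_sqr_int (2 * A)); first exact: sqfree_mul sqfree2 sqA.
  by apply: (eq_mem_pred _ (rpredD i2 i3)); ring.
have [j ej] := D_mod4.
have [A' eA] : exists A' : int, (A%:R : rat) = (2 * A' + 1)%:~R.
  exists (Posz A./2); rewrite -[in LHS](odd_double_half A) Aodd -mul2n.
  by rewrite !(rmorphM, rmorphD) /=; ring.
(* Subtracting [i3] from [i2] leaves 2AD (2d)^2 = A D' (4d)^2 with D = 2D' and A D' squarefree. The
   extra factor 2 in the denominator is removed next by parity. *)
have /intrP[e1 ee] : 4 * d \in Num.int.
  have [D' eD] : exists D', D = (2 * D')%N.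
    by exists D./2; rewrite mul2n -[LHS]odd_double_half /D addn1 /= oddX Bodd.
  apply: (@sqfree_mul_sqr_int (A * D')).
    apply: sqfree_mul => //.
      by apply: (coprime_dvdr _ coAD); rewrite eD; apply: dvdn_mull.
    move=> p pp; apply: contra (sqD pp) => h.
    by rewrite eD; apply: dvdn_mull.
  have -> : (A * D')%:R * (4 * d) ^+ 2 = A%:R * ((2 * c) ^+ 2 + D%:R * (2 * d) ^+ 2) - A%:R * ((2 * c) ^+ 2 - D%:R * (2 * d) ^+ 2).
    by rewrite eD; ring.
  exact: rpredB.
have [e2 ee2] : exists e2, e1 = 2 * e2.
  have /intrP[z ez] : A%:R * D%:R * (2 * d) ^+ 2 \in Num.int.
    have -> : A%:R * D%:R * (2 * d) ^+ 2 = A%:R * ((2 * c) ^+ 2 + D%:R * (2 * d) ^+ 2) - A%:R * (2 * c) ^+ 2 by ring.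
    apply: rpredB => //.
    by rewrite ec; apply: rpredM; [apply: rpred_nat|apply: rpredX; apply: rpred_int].
  have e4 : (2 * A' + 1) * (4 * j + 2) * (e1 * e1) = 4 * z.
    apply: (@intr_inj rat); rewrite !(rmorphM) /= -ez -ee -ej -eA; ring.
  have [x [ex|ex]] := int_parity e1; first by exists x.
  exfalso; move: e4; rewrite ex.
  pose P := 2 * A' * j + A' + j; pose q := x * x + x.
  have -> : (2 * A' + 1) * (4 * j + 2) * ((2 * x + 1) * (2 * x + 1)) =
    4 * (4 * P * q + P + 2 * q) + 2 by rewrite /P /q; ring.
  by move: (4 * P * q + P + 2 * q) => W; lia.
have ed : 2 * d = e2%:~R.
  apply: (@mulfI _ (2 : rat)) => //; have -> : 2 * (2 * d) = 4 * d by ring.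
  by rewrite ee ee2 rmorphM.
have [/intrP[z1 ez1] /intrP[z2 ez2]] :
    a ^+ 2 + D%:R * b ^+ 2 - A%:R * D%:R * (c ^+ 2 + D%:R * d ^+ 2 + 2 * c * d * B%:R) \in Num.int /\
    2 * a * b - A%:R * ((c ^+ 2 + D%:R * d ^+ 2) * B%:R + 2 * c * d * D%:R) \in Num.int.
  apply: (quadratic_int hf); apply: (eq_mem_pred _ (rpredM hy y2)) => /=; rewrite /D; ring: f1 f2.
have [B' eB] : exists B' : int, (B%:R : rat) = (2 * B' + 1)%:~R.
  exists (Posz B./2); rewrite -[in LHS](odd_double_half B) Bodd -mul2n.
  by rewrite !(rmorphM, rmorphD) /=; ring.
have eD : (D%:R : rat) = B%:R * B%:R + 1 by rewrite /D; ring.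
have [] := @even_of_rel_norm A' B' a1 b1 c1 e2 z1 z2.
- apply: (@intr_inj rat); rewrite !(rmorphM, rmorphD, rmorphB, rmorphN) /=.
  rewrite -ez1 -ea -eb -ec -ed eD eA eB !(rmorphM, rmorphD) /=; ring.
- apply: (@intr_inj rat); rewrite !(rmorphM, rmorphD, rmorphB, rmorphN) /=.
  rewrite -ez2 -ea -eb -ec -ed eD eA eB !(rmorphM, rmorphD) /=; ring.
move=> [x1 g1] [x2 g2] [x3 g3] [x4 g4].
have fin (u : rat) (v w : int) : 2 * u = v%:~R -> v = 2 * w -> u \in Num.int.
  move=> eu ev; apply/intrP; exists w; apply: (@mulfI _ (2 : rat)) => //.
  by rewrite eu ev rmorphM.
by split; [apply: fin ea g1|apply: fin eb g2|apply: fin ec g3|apply: fin ed g4].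
Qed.
End Integers.

(** * The discriminant *)

Lemma det_mx2 (R : comRingType) (M : 'M[R]_2) : \det M = M 0 0 * M 1 1 - M 0 1 * M 1 0.
Proof.
rewrite (expand_det_row _ 0) !big_ord_recl big_ord0 /cofactor !det_mx11 !mxE /=.
have e0 : lift (0 : 'I_2) (0 : 'I_1) = 1 by apply: val_inj.
have e1 : lift (1 : 'I_2) (0 : 'I_1) = 0 by apply: val_inj.
rewrite e0 e1 /bump /=; ring.
Qed.

Definition quad_basis (i : 'I_4) : quad :=
  nth (0, 0, 0, 0) [:: (1, 0, 0, 0); (0, 1, 0, 0); (0, 0, 1, 0); (0, 0, 0, 1)] i.

Definition i0 : 'I_4 := ord0.
Definition i1 : 'I_4 := lift ord0 ord0.
Definition i2 : 'I_4 := lift ord0 (lift ord0 ord0).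
Definition i3 : 'I_4 := lift ord0 (lift ord0 (lift ord0 ord0)).

Lemma ord4P (P : 'I_4 -> Prop) : P i0 -> P i1 -> P i2 -> P i3 -> forall i, P i.
Proof.
move=> h0 h1 h2 h3 [[|[|[|[|//]]]] hi].
- by move: h0; congr P; apply: val_inj.
- by move: h1; congr P; apply: val_inj.
- by move: h2; congr P; apply: val_inj.
- by move: h3; congr P; apply: val_inj.
Qed.

Lemma sum_basis f (c : 'I_4 -> int) :
  \sum_i (c i)%:~R * ev f (quad_basis i) =
  ev f ((c i0)%:~R, (c i1)%:~R, (c i2)%:~R, (c i3)%:~R).
Proof.
rewrite !big_ord_recl big_ord0 /quad_basis /= -/i0 -/i1 -/i2 -/i3.
ring.
Qed.

Section Disc.
Variables (A B : nat) (Aodd : odd A) (Bodd : odd B).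
Let D := (B ^ 2 + 1)%N.
Hypotheses (sqA : sqfree A) (sqD : sqfree D) (coAD : coprime A D).
Variables (f : algC * algC) (hf : frame A B f).
Let K := nfield f.2.

Let A0 : (0 < A)%N. Proof. by case: A Aodd. Qed.
Let B0 : (0 < B)%N. Proof. by case: B Bodd. Qed.

Lemma ring_of_intP y : ring_of_int K y <->
  exists a b c d : int, y = ev f (a%:~R, b%:~R, c%:~R, d%:~R).
Proof.
split=> [[/(nfieldP A0 B0 _ hf) [[[[a b] c] d] ->]]|[a [b [c [d ->]]]]].
  move/alg_int_Aint/(frame_integers Aodd Bodd sqA sqD coAD hf).
  by case=> /intrP[a' ->] /intrP[b' ->] /intrP[c' ->] /intrP[d' ->]; exists a', b', c', d'.
split; first exact: (ev_nf A0 B0 hf).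
have [s_int t_int] := frame_Aint hf.
apply/alg_int_Aint; rewrite /= !ratr_int.
by rewrite !(rpredD, rpredM) ?rpred_int.
Qed.

Let M : 'M[algC]_4 := \matrix_(i, j) ev (iter j (nxt B) f) (quad_basis i).

(** [M] times its transpose is the Gram matrix of the trace form. It splits into a block on 1, s and
    a block on t, st, and D - B^2 = 1 simplifies the second determinant. *)
Lemma gram_det : \det M ^+ 2 = (256 * A ^ 2 * D ^ 3)%:R.
Proof.
have [f1 f2] := hf.
rewrite expr2 -{2}det_tr -det_mulmx.
pose d2 (x y z w : algC) : 'M_2 := \matrix_(i < 2, j < 2)
  (if i == 0 then (if j == 0 then x else y) else (if j == 0 then z else w)).
have -> : M *m M^T = block_mx (d2 4 0 0 (4 * D%:R)) 0 0
  (d2 (4 * A%:R * D%:R) (4 * A%:R * B%:R * D%:R)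
      (4 * A%:R * B%:R * D%:R) (4 * A%:R * D%:R ^+ 2)) :> 'M_(2 + 2).
  apply/matrixP => i j; rewrite !mxE.
  have -> : \sum_k M i k * M^T k j = ev f (quad_basis i) * ev f (quad_basis j) +
    (ev (iter 1 (nxt B) f) (quad_basis i) * ev (iter 1 (nxt B) f) (quad_basis j) +
    (ev (iter 2 (nxt B) f) (quad_basis i) * ev (iter 2 (nxt B) f) (quad_basis j) +
     ev (iter 3 (nxt B) f) (quad_basis i) * ev (iter 3 (nxt B) f) (quad_basis j))).
    by rewrite !big_ord_recl big_ord0 !mxE addr0.
  case: (splitP i) => i' ei; rewrite !mxE; case: (splitP j) => j' ej; rewrite !mxE /quad_basis ei ej.
  - case: i' j' {ei ej} => [[|[|//]] hi] [[|[|//]] hj]; rewrite -?val_eqE /= /D; ring: f1 f2.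
  - case: i' j' {ei ej} => [[|[|//]] hi] [[|[|//]] hj] /=; ring: f1 f2.
  - case: i' j' {ei ej} => [[|[|//]] hi] [[|[|//]] hj] /=; ring: f1 f2.
  - case: i' j' {ei ej} => [[|[|//]] hi] [[|[|//]] hj]; rewrite -?val_eqE /= /D; ring: f1 f2.
rewrite (@det_ublock _ 2 2) !det_mx2 !mxE -?val_eqE /= /D; ring.
Qed.

Lemma frame_disc : abs_disc K (256 * A ^ 2 * D ^ 3)%:R.
Proof.
exists 4%N, (fun i => ev f (quad_basis i)), (fun j => iter j (sigma B f)).
split.
  move=> i; apply/ring_of_intP.
  by elim/ord4P: i; [exists 1, 0, 0, 0|exists 0, 1, 0, 0|exists 0, 0, 1, 0|exists 0, 0, 0, 1].
split.
  move=> y /ring_of_intP [a [b [c [d ->]]]].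
  pose g (i : 'I_4) : int := nth 0 [:: a; b; c; d] i.
  exists g; rewrite sum_basis /g /=; split=> // c'; rewrite sum_basis.
  move=> e; have := @ev_inj A B A0 B0 f hf (a%:~R, b%:~R, c%:~R, d%:~R) _ e.
  case=> e0 e1 e2 e3.
  by elim/ord4P => /=; apply: (@intr_inj rat); symmetry.
split; first by move=> j; exact: (iter_sigma_embedding A0 B0 hf).
split; first exact: (iter_sigma_neq A0 B0 hf).
have <- : M = \matrix_(i, j) iter j (sigma B f) (ev f (quad_basis i)).
  by apply/matrixP => i j; rewrite !mxE (iter_sigma_ev A0 B0 hf).
by rewrite gram_det ger0_norm // ler0n.
Qed.
End Disc.

(** * Mahler measures of integral generators *)

Definition height (l : seq algC) : algC := \prod_(z <- l | 1 <= `|z|) `|z|.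

Lemma mahler_prod (c : algC) (l : seq algC) : c != 0 ->
  mahler (c *: \prod_(z <- l) ('X - z%:P)) = `|c| * height l.
Proof.
move=> c0; rewrite /mahler /rootsC; case: closed_field_poly_normal => r /= hr.
have lc : lead_coef (c *: \prod_(z <- l) ('X - z%:P)) = c.
  by rewrite lead_coefZ lead_coef_prod_XsubC mulr1.
rewrite lc in hr *.
congr (_ * _); apply: perm_big; rewrite perm_sym; apply: prod_XsubC_eq.
by apply: (scalerI c0).
Qed.

(** The maximum of 1 and |z|, which makes the Mahler product run over all roots. *)
Definition cut (z : algC) : algC := if 1 <= `|z| then `|z| else 1.

Lemma height_cut l : height l = \prod_(z <- l) cut z.
Proof. by rewrite /height big_mkcond. Qed.

Lemma cut_ge1 z : 1 <= cut z.
Proof. by rewrite /cut; case: ifP. Qed.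

Lemma norm_le_cut z : `|z| <= cut z.
Proof.
rewrite /cut; case: ifPn => // h.
by rewrite ltW // real_ltNge ?normr_real ?real1.
Qed.

Lemma cut_le z c : 1 <= c -> `|z| <= c -> cut z <= c.
Proof. by rewrite /cut; case: ifP. Qed.

Lemma height_ge1 l : 1 <= height l.
Proof.
rewrite height_cut; elim: l => [|z l IH]; first by rewrite big_nil.
by rewrite big_cons mulr_ege1 // cut_ge1.
Qed.

Lemma norm_le_height z l : z \in l -> `|z| <= height l.
Proof.
rewrite height_cut; elim: l => // w l IH; rewrite in_cons big_cons => /orP[/eqP <-|/IH h].
  rewrite (le_trans (norm_le_cut z)) // ler_peMr ?(le_trans ler01) ?cut_ge1 //.
  by rewrite -height_cut height_ge1.
rewrite (le_trans h) // ler_peMl ?cut_ge1 //.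
by rewrite -height_cut (le_trans ler01) ?height_ge1.
Qed.

Lemma norm_sub_le_cut x y : `|x - y| <= 2 * (cut x * cut y).
Proof.
have x0 := le_trans ler01 (cut_ge1 x); have y0 := le_trans ler01 (cut_ge1 y).
rewrite (le_trans (ler_normB _ _)) // [2]/(1 + 1) mulrDl mul1r lerD //.
  by rewrite (le_trans (norm_le_cut x)) // ler_peMr ?cut_ge1.
by rewrite (le_trans (norm_le_cut y)) // ler_peMl ?cut_ge1.
Qed.

Section Mahler.
Variables (A B : nat) (A0 : (0 < A)%N) (B0 : (0 < B)%N).
Let D := (B ^ 2 + 1)%N.
Variables (f : algC * algC) (hf : frame A B f).
Let K := nfield f.2.

Definition iquad (q : int * int * int * int) : quad :=
  let: (a, b, c, d) := q in (a%:~R, b%:~R, c%:~R, d%:~R).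

Definition conjs (q : int * int * int * int) : seq algC :=
  [seq ev (iter i (nxt B) f) (iquad q) | i <- iota 0 4].

(** The element lies outside the quadratic subfield Q(s); for elements of K this amounts to
    generating K, as [gen_nfield] and [gen_of_nfield] show. *)
Definition gen (q : int * int * int * int) : bool :=
  let: (a, b, c, d) := q in (c, d) != (0, 0).

Lemma gen_rat a b c d : gen (a, b, c, d) -> (c%:~R, d%:~R) != (0, 0) :> rat * rat.
Proof. by rewrite /gen !xpair_eqE !intr_eq0. Qed.

Lemma conjs_uniq q : gen q -> uniq (conjs q).
Proof.
by case: q => [[[a b] c] d] /gen_rat h; apply: (conj_uniq A0 B0 hf).
Qed.

Lemma intr_ratr_poly (p : {poly int}) :
  map_poly intr p = map_poly ratr (map_poly intr p : {poly rat}) :> {poly algC}.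
Proof. by rewrite -map_poly_comp; apply: eq_map_poly => x /=; rewrite ratr_int. Qed.

Lemma conjs_root q (p : {poly int}) :
  root (map_poly intr p) (ev f (iquad q)) -> all (root (map_poly intr p : {poly algC})) (conjs q).
Proof.
rewrite intr_ratr_poly => h; apply/allP => _ /mapP[i _ ->].
exact: (root_conj A0 B0 hf (frame_iter i hf)).
Qed.

Lemma size_intr (p : {poly int}) : size (map_poly intr p : {poly algC}) = size p.
Proof. by apply: size_map_inj_poly => //; apply: intr_inj. Qed.

Lemma root_size_gt4 q (p : {poly int}) : gen q -> p != 0 ->
  root (map_poly intr p) (ev f (iquad q)) -> (4 < size p)%N.
Proof.
move=> hq p0 /conjs_root hr.
have := max_poly_roots _ hr (conjs_uniq hq).
rewrite size_intr size_map size_iota; apply.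
by rewrite -size_poly_eq0 size_intr size_poly_eq0.
Qed.

Lemma conj_poly q : exists P : {poly int},
  [/\ P \is monic, size P = 5%N & root (map_poly intr P) (ev f (iquad q))].
Proof.
case: q => [[[a b] c] d].
pose Dz : int := D%:R; pose Az : int := A%:R; pose Bz : int := B%:R.
(* With e = X - a, the product of X - x0 and X - x2 is e^2 + k - s (2be + l). Its norm (e^2 + k)^2 -
   D (2be + l)^2 is the quartic expanded through [r2], [r1], [r0]. *)
pose k := b * b * Dz - Az * ((c * c + Dz * d * d) * Dz + 2 * c * d * Bz * Dz).
pose l := Az * ((c * c + Dz * d * d) * Bz + 2 * c * d * Dz).
have [r2 er2] : exists r : int, r = 2 * k - 4 * Dz * b * b by eexists.
have [r1 er1] : exists r : int, r = - (4 * Dz * b * l) by eexists.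
have [r0 er0] : exists r : int, r = k * k - Dz * l * l by eexists.
pose e : {poly int} := 'X - a%:P.
pose R : {poly int} := r2 *: e ^+ 2 + (r1 *: e + r0%:P).
have em : e \is monic by rewrite monicXsubC.
have se n : size (e ^+ n) = n.+1.
  by rewrite size_exp_XsubC.
have sR : (size R < size (e ^+ 4))%N.
  rewrite se ltnS (leq_trans (size_polyD _ _)) // geq_max.
  rewrite (leq_trans (size_scale_leq _ _)) ?se //= (leq_trans (size_polyD _ _)) // geq_max.
  rewrite (leq_trans (size_scale_leq _ _)) ?size_XsubC //=.
  by rewrite (leq_trans (size_polyC_leq1 _)).
exists (e ^+ 4 + R); split.
- by rewrite monicE lead_coefDl // -monicE monic_exp.
- by rewrite size_polyDl // se.
have [f1 f2] := hf.
have ee : map_poly intr e = 'X - (a%:~R)%:P :> {poly algC}.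
  by rewrite /e rmorphB /= map_polyX map_polyC.
rewrite /R rootE; move: ee; clearbody e => ee.
rewrite !(rmorphD, rmorphXn) /= !linearZ /= rmorphXn /= map_polyC /= ee.
rewrite !hornerE /= !ratr_int er2 er1 er0 /k /l /Dz /Az /Bz /D.
by apply/eqP; ring: f1 f2.
Qed.

Lemma conj_poly_prod q (P : {poly int}) : gen q -> size P = 5%N ->
  root (map_poly intr P) (ev f (iquad q)) ->
  map_poly intr P = (lead_coef P)%:~R *: \prod_(z <- conjs q) ('X - z%:P) :> {poly algC}.
Proof.
move=> hq sP hr; have uc := conjs_uniq hq.
rewrite {1}(@all_roots_prod_XsubC _ (map_poly intr P) (conjs q)) ?uniq_rootsE //.
- by rewrite lead_coef_map_inj //; apply: intr_inj.
- by rewrite size_intr sP size_map size_iota.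
- exact: conjs_root.
Qed.

(** The four distinct conjugates exhaust the roots, so [p] is an integer multiple of the monic
    quartic from [conj_poly]; content 1 makes [p] itself monic. *)
Lemma minZpoly_mahler q p : gen q -> minZpoly (ev f (iquad q)) p ->
  mahler (map_poly intr p) = height (conjs q).
Proof.
move=> hq [p0 [pr [pc pmin]]].
have [P [Pm sP Pr]] := conj_poly q.
have sp : size p = 5%N.
  apply/eqP; rewrite eqn_leq (root_size_gt4 hq p0 pr) andbT -sP pmin //.
  by rewrite monic_neq0.
have ep := conj_poly_prod hq sp pr; have eP := conj_poly_prod hq sP Pr.
have l1 : lead_coef p = 1.
  rewrite -pc; have -> : p = lead_coef p *: P.
    apply: (map_inj_poly (@intr_inj algC)) => //.
    by rewrite linearZ /= eP ep (monicP Pm) scale1r.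
  by rewrite zcontentsZ lead_coefZ (monicP Pm) (zcontents_monic Pm).
by rewrite ep l1 mahler_prod ?oner_eq0 // normr1 mul1r.
Qed.

Lemma minZpoly_exists q : gen q -> exists p, minZpoly (ev f (iquad q)) p.
Proof.
move=> hq; have [P [Pm sP Pr]] := conj_poly q.
exists P; split; first exact: monic_neq0.
split=> //; split; first exact: zcontents_monic.
by move=> p p0 pr; rewrite sP (root_size_gt4 hq p0 pr).
Qed.

Lemma sum_basis_rat (c : 'I_4 -> rat) :
  \sum_i ratr (c i) * ev f (quad_basis i) = ev f (c i0, c i1, c i2, c i3).
Proof.
rewrite !big_ord_recl big_ord0 /quad_basis /= -/i0 -/i1 -/i2 -/i3; ring.
Qed.

(** The matrix of 1, al, al^2, al^3 in the basis is invertible: a kernel vector would be a nonzero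
    polynomial of degree below 4 vanishing at al. *)
Lemma gen_nfield q : gen q -> forall x, nfield (ev f (iquad q)) x <-> K x.
Proof.
move=> hq x; split=> [[p ->]|].
  by have [q' ->] := ev_poly A B p (iquad q); last exact: hf; apply: (ev_nf A0 B0 hf).
set al := ev f (iquad q).
have [pw hpw] : exists pw : nat -> quad, forall i, ev f (pw i) = al ^+ i.
  exists (fun i => iter i (qmul A B (iquad q)) (1, 0, 0, 0)).
  elim=> [|i IH] /=; first by rewrite expr0; ring.
  by rewrite (ev_mul _ _ hf) IH exprS.
pose cf (p : quad) (j : 'I_4) : rat :=
  let: (a, b, c, d) := p in nth 0 [:: a; b; c; d] j.
have evcf p : ev f p = \sum_j ratr (cf p j) * ev f (quad_basis j).
  by rewrite sum_basis_rat; case: p => [[[a b] c] d].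
pose N : 'M[rat]_4 := \matrix_(i, j) cf (pw i) j.
have evN (v : 'rV[rat]_4) :
    \sum_j ratr ((v *m N) 0 j) * ev f (quad_basis j) = (map_poly ratr (rVpoly v)).[al].
  rewrite (@horner_coef_wide _ 4) ?size_map_poly ?size_poly //.
  under eq_bigr => j _ do rewrite mxE rmorph_sum /= mulr_suml.
  rewrite exchange_big /=; apply: eq_bigr => i _.
  rewrite coef_map /= coef_rVpoly_ord -hpw evcf mulr_sumr.
  by apply: eq_bigr => j _; rewrite ?mxE; ring.
have uN : N \in unitmx.
  rewrite -row_free_unit; apply: inj_row_free => v vN.
  have /eqP hr : (map_poly ratr (rVpoly v)).[al] = 0.
    by rewrite -evN vN big1 // => j _; rewrite mxE rmorph0 mul0r.
  have [v0|v0] := eqVneq (rVpoly v) 0; first by rewrite -[v]rVpolyK v0 linear0.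
  have : (4 < size (rVpoly v))%N.
    case: q hq @al hpw evN hr => [[[a b] c] d] /gen_rat cd al hpw evN hr.
    exact: (conj_root_size A0 B0 hf cd v0 hr).
  by rewrite ltnNge size_poly.
move=> /(nfieldP A0 B0 _ hf) [p ->].
pose w : 'rV[rat]_4 := \row_j cf p j.
exists (rVpoly (w *m invmx N)); rewrite -evN mulmxKV // evcf.
by apply: eq_bigr => j _; rewrite mxE.
Qed.

(** An element of Q(s) is fixed by the square of the generator, which sends t to -t, so t cannot be
    a polynomial in it. *)
Lemma gen_of_nfield q : (forall x, nfield (ev f (iquad q)) x <-> K x) -> gen q.
Proof.
move=> h; case: q h => [[[a b] c] d] h; rewrite /gen; apply/negP => /eqP[c0 d0].
have /h [p hp] : K f.2.
  by apply/(nfieldP A0 B0 _ hf); exists (0, 0, 1, 0) => /=; ring.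
have [q' hq] := ev_poly A B p (iquad (a, b, c, d)).
have h0 := hq _ hf; have h2 := hq _ (frame_iter 2 hf).
have e2 : ev (iter 2 (nxt B) f) (iquad (a, b, c, d)) = ev f (iquad (a, b, c, d)).
  by rewrite c0 d0 /=; ring.
rewrite e2 -hp (ev_iter _ _ hf) in h2; rewrite -hp in h0.
have e3 : f.2 = ev f (0, 0, 1, 0) by rewrite /=; ring.
have q'e : q' = (0, 0, 1, 0) by apply: (ev_inj A0 B0 hf); rewrite -h0.
move: h2; rewrite q'e {1}e3 => h2; have := ev_inj A0 B0 hf h2.
rewrite /=; case=> e _; have /eqP : (1 : rat) = - 1 by rewrite {1}e; ring.
by [].
Qed.

Lemma height_conjs q : height (conjs q) =
  cut (ev f (iquad q)) * (cut (ev (iter 1 (nxt B) f) (iquad q)) *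
  (cut (ev (iter 2 (nxt B) f) (iquad q)) * cut (ev (iter 3 (nxt B) f) (iquad q)))).
Proof. by rewrite height_cut big_map /= !big_cons big_nil mulr1. Qed.

(** In (x0 - x2)(x1 - x3) = 4 z A s, the integer z = c^2 - D d^2 is nonzero because D is not a
    square; the left side is at most 4 times the height by [norm_sub_le_cut]. *)
Lemma height_lower q : gen q -> A%:R * `|f.1| <= height (conjs q).
Proof.
move=> hq; have [f1 f2] := hf.
set x0 := ev f (iquad q); set x1 := ev (iter 1 (nxt B) f) (iquad q).
set x2 := ev (iter 2 (nxt B) f) (iquad q); set x3 := ev (iter 3 (nxt B) f) (iquad q).
have [z z0 ez] : exists2 z : int, z != 0 & (x0 - x2) * (x1 - x3) = 4 * z%:~R * (A%:R * f.1).
  case: q hq @x0 @x1 @x2 @x3 => [[[a b] c] d] hq x0 x1 x2 x3.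
  exists (c * c - D%:R * d * d).
    apply/eqP => e; have := gen_rat hq.
    have [] := @rat_norm_eq0 B B0 c%:~R d%:~R; last by move=> -> ->; rewrite eqxx.
    apply/eqP; rewrite -subr_eq0; apply/eqP.
    by transitivity ((c * c - D%:R * d * d)%:~R : rat); [rewrite /D; ring | rewrite e].
  by rewrite /x0 /x1 /x2 /x3 /D /=; ring: f1 f2.
have h1 : `|(x0 - x2) * (x1 - x3)| <= 4 * height (conjs q).
  rewrite normrM height_conjs -/x0 -/x1 -/x2 -/x3.
  have -> : 4 * (cut x0 * (cut x1 * (cut x2 * cut x3))) =
    (2 * (cut x0 * cut x2)) * (2 * (cut x1 * cut x3)) by ring.
  by apply: ler_pM; rewrite ?normr_ge0 ?norm_sub_le_cut.
rewrite -(@ler_pM2l _ 4) // (le_trans _ h1) // ez !normrM !normr_nat -mulrA.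
rewrite ler_pM2l // ler_peMl ?mulr_ge0 ?normr_ge0 ?ler0n //.
by rewrite -intr_norm ler1z -gtz0_ge1 normr_gt0.
Qed.

(** A Northcott argument: every conjugate is bounded by the height, and the coordinates are
    recovered linearly from the four conjugates. *)
Lemma height_bound (h : algC) : exists N : nat, forall a b c d : int,
  height (conjs (a, b, c, d)) <= h ->
  [/\ (`|a| < N)%N, (`|b| < N)%N, (`|c| < N)%N & (`|d| < N)%N].
Proof.
have [f1 f2] := hf.
have s0 : f.1 != 0.
  by apply/eqP => e; move/eqP: f1; rewrite e expr0n /= eq_sym pnatr_eq0 addn1.
have t0 : f.2 != 0.
  apply/eqP => e; have /(ev_eq0 A0 B0 hf) // : ev f (0, 0, 1, 0) = 0.
  by rewrite /= e; ring.
have sB : (f.1 - B%:R) != 0.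
  apply/eqP => e; have /(ev_eq0 A0 B0 hf) // : ev f (- B%:R, 1, 0, 0) = 0.
  by rewrite /= -[RHS]e; ring.
pose w1 := `|f.1|^-1; pose w2 := `|f.2|^-1; pose w3 := `|(f.1 - B%:R) * f.2|^-1.
pose W := h + h * w1 + (h * w2 + h * w3) + (h * w2 + h * w3) * w1.
pose N := (Num.bound W).+1.
exists N => a b c d hh.
have h0 : 0 <= h by apply: le_trans hh; apply: le_trans ler01 (height_ge1 _).
have ub i : (i < 4)%N -> `|ev (iter i (nxt B) f) (iquad (a, b, c, d))| <= h.
  by move=> hi; apply: le_trans hh; apply: norm_le_height; apply/mapP; exists i; rewrite ?mem_iota.
have u0 := ub 0%N isT; have u1 := ub 1%N isT; have u2 := ub 2%N isT; have u3 := ub 3%N isT.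
move: u0 u1 u2 u3.
set x0 := ev (iter 0 _ _) _; set x1 := ev (iter 1 _ _) _.
set x2 := ev (iter 2 _ _) _; set x3 := ev (iter 3 _ _) _ => u0 u1 u2 u3.
have four y z : 4 * y = z -> `|z| <= h + h + (h + h) -> `|y| <= h.
  move=> e; rewrite -e normrM normr_nat; have -> : h + h + (h + h) = 4 * h by ring.
  by rewrite ler_pM2l.
have two (y z : algC) : 2 * y = z -> forall k, `|z| <= k + k -> `|y| <= k.
  move=> e k; rewrite -e normrM normr_nat; have -> : k + k = 2 * k by ring.
  by rewrite ler_pM2l.
have ba : `|a%:~R : algC| <= h.
  apply: (four _ (x0 + x2 + (x1 + x3))); first by rewrite /x0 /x1 /x2 /x3 /=; ring: f1.
  by apply: le_trans (ler_normD _ _) _; apply: lerD; apply: le_trans (ler_normD _ _) _; apply: lerD.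
have bb : `|b%:~R * f.1 : algC| <= h.
  apply: (four _ (x0 + x2 + (- x1 - x3))); first by rewrite /x0 /x1 /x2 /x3 /=; ring: f1.
  by apply: le_trans (ler_normD _ _) _; apply: lerD; apply: le_trans (ler_normD _ _) _; apply: lerD; rewrite ?normrN.
have bp : `|(c%:~R + d%:~R * f.1) * f.2 : algC| <= h.
  apply: (two _ (x0 - x2)); first by rewrite /x0 /x2 /=; ring: f1.
  by apply: le_trans (ler_normB _ _) _; apply: lerD.
have bm : `|(c%:~R - d%:~R * f.1) * ((f.1 - B%:R) * f.2) : algC| <= h.
  apply: (two _ (x1 - x3)); first by rewrite /x1 /x3 /=; ring: f1.
  by apply: le_trans (ler_normB _ _) _; apply: lerD.
have dv (y z : algC) : z != 0 -> forall k, `|y * z| <= k -> `|y| <= k * `|z|^-1.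
  by move=> z0 k; rewrite normrM -ler_pdivlMr ?invr_gt0 ?normr_gt0 // invrK.
have {}bb := dv _ _ s0 _ bb; have {}bp := dv _ _ t0 _ bp.
have {}bm := dv _ _ (mulf_neq0 sB t0) _ bm.
have bc : `|c%:~R : algC| <= h * w2 + h * w3.
  apply: (two _ ((c%:~R + d%:~R * f.1) + (c%:~R - d%:~R * f.1))); first by ring.
  apply: le_trans (ler_normD _ _) _; apply: lerD.
    by apply: le_trans bp _; rewrite lerDl mulr_ge0 // invr_ge0.
  by apply: le_trans bm _; rewrite lerDr mulr_ge0 // invr_ge0.
have bd : `|d%:~R : algC| <= (h * w2 + h * w3) * w1.
  apply: dv s0 _ _; apply: (two _ ((c%:~R + d%:~R * f.1) - (c%:~R - d%:~R * f.1))); first by ring.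
  apply: le_trans (ler_normB _ _) _; apply: lerD.
    by apply: le_trans bp _; rewrite lerDl mulr_ge0 // invr_ge0.
  by apply: le_trans bm _; rewrite lerDr mulr_ge0 // invr_ge0.
have p1 : 0 <= w1 by rewrite invr_ge0.
have p2 : 0 <= w2 by rewrite invr_ge0.
have p3 : 0 <= w3 by rewrite invr_ge0.
have q1 : 0 <= h * w1 by rewrite mulr_ge0.
have q2 : 0 <= h * w2 + h * w3 by rewrite addr_ge0 ?mulr_ge0.
have q3 : 0 <= (h * w2 + h * w3) * w1 by rewrite mulr_ge0.
have W0 : 0 <= W by exact: addr_ge0 (addr_ge0 (addr_ge0 h0 q1) q2) q3.
have fin (z : int) k : `|z%:~R : algC| <= k -> k <= W -> (`|z| < N)%N.
  move=> h1 h2; rewrite ltnS ltnW // -(ltr_nat algC) natr_absz intr_norm.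
  exact: le_lt_trans (le_trans h1 h2) (archi_boundP W0).
have [g1 g2 g3 g4] : [/\ h <= W, h * w1 <= W, h * w2 + h * w3 <= W & (h * w2 + h * w3) * w1 <= W].
  rewrite /W; move: (h * w1) (h * w2 + h * w3) ((h * w2 + h * w3) * w1) q1 q2 q3 => x y z x0' y0' z0'.
  split.
  - by rewrite -!addrA lerDl; do !apply: addr_ge0.
  - by rewrite -!addrA addrCA lerDl; do !apply: addr_ge0.
  - by rewrite addrAC lerDr; do !apply: addr_ge0.
  - by rewrite lerDr; do !apply: addr_ge0.
by split; [apply: fin ba _|apply: fin bb _|apply: fin bc _|apply: fin bd _].
Qed.
End Mahler.

Lemma height_real l : height l \is Num.real.
Proof. by apply: ger0_real; apply: le_trans ler01 (height_ge1 l). Qed.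

Section Minimum.
Variables (A B : nat) (A0 : (0 < A)%N) (B0 : (0 < B)%N).
Variables (f : algC * algC) (hf : frame A B f).

(** Comparison with the generator t confines the search to a finite box of integer coordinates. *)
Lemma height_min : exists2 q, gen q &
  forall q', gen q' -> height (conjs B f q) <= height (conjs B f q').
Proof.
pose hR q : algR := in_algR (height_real (conjs B f q)).
have [N hN] := height_bound A0 B0 hf (height (conjs B f (0, 0, 1, 0))).
pose I := ('I_(N + N) * 'I_(N + N) * ('I_(N + N) * 'I_(N + N)))%type.
pose v (i : 'I_(N + N)) : int := (i : nat)%:Z - N%:Z.
pose toq (i : I) := (v i.1.1, v i.1.2, v i.2.1, v i.2.2).
have v_surj (z : int) : (`|z| < N)%N -> exists i, v i = z.
  move=> hz; have hi : (`|(z + N%:Z)%R| < N + N)%N by lia.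
  by exists (Ordinal hi); rewrite /v /=; lia.
have toq_surj q : height (conjs B f q) <= height (conjs B f (0, 0, 1, 0)) -> exists i, toq i = q.
  case: q => [[[a b] c] d] /hN[/v_surj[ia ea] /v_surj[ib eb] /v_surj[ic ec] /v_surj[id ed]].
  by exists ((ia, ib), (ic, id)); rewrite /toq /= ea eb ec ed.
have [i0' e0] := toq_surj (0, 0, 1, 0) (lexx _).
have g0 : gen (toq i0') by rewrite e0.
case: (@arg_minP _ _ I i0' (fun i => gen (toq i)) (fun i => hR (toq i)) g0) => i gi hi.
exists (toq i) => // q' gq'.
have := hi _ g0; rewrite e0 => h0.
have [|] := real_leP (height_real (conjs B f q')) (height_real (conjs B f (0, 0, 1, 0))).
  by move=> /toq_surj[j ej]; have := hi j; rewrite ej => /(_ gq').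
by move=> /ltW; apply: le_trans.
Qed.
End Minimum.

(** * A generator of small Mahler measure *)

(** With w = t - t' - 2ys, the two small conjugates differ from -w/2 and w/2 by x - (t + t')/2,
    which is at most 1 in size. The other two arise by adding 2t and 2t'. *)
Lemma approx_bound (R : realFieldType) (A B y k C s t t' x : R) :
  0 < s -> s ^+ 2 = B ^+ 2 + 1 -> 1 <= B -> 1 <= A -> 0 < t ->
  t ^+ 2 = A * (B ^+ 2 + 1 + B * s) -> t' = (s - B) * t -> A = 2 * y ^+ 2 + k -> 0 < y -> 0 <= C ->
  k * s <= A + C * y -> A <= k * s + C * y -> x <= (t + t') / 2 -> (t + t') / 2 < x + 1 ->
  let c := C + 2 in
  [/\ `|x + y * s - t| <= c, `|x - y * s - t'| <= c,
      `|x + y * s + t| <= (2 + c) * t /\ `|x - y * s + t'| <= (2 + 2 * c) * t',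
      1 <= (2 + c) * t /\ 1 <= (2 + 2 * c) * t' & t * t' = A * s].
Proof.
move=> s0 s2 B1 A1 t0 t2 et eA y0 C0 k1 k2 x1 x2 c.
have sB : B < s by rewrite -(@ltr_pXn2r _ 2) ?nnegrE //; lra.
have sB1 : s <= B + 1.
  by rewrite -(@ler_pXn2r _ 2) ?nnegrE //; [rewrite s2; nra | lra | lra].
have tt : t * t' = A * s.
  by rewrite et; transitivity ((s - B) * t ^+ 2); [ring | rewrite t2; ring: s2].
have t'0 : 0 < t' by rewrite et mulr_gt0 // subr_gt0.
have t1 : 1 <= t.
  rewrite -(@ler_pXn2r _ 2) ?nnegrE //; last by apply: ltW.
  by rewrite t2 expr1n; nra.
have et2 : t' ^+ 2 = A * (s * (s - B)).
  by rewrite et; transitivity ((s - B) ^+ 2 * t ^+ 2); [ring | rewrite t2; ring: s2].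
(* Multiplied by s + B, the right side is s, because s^2 - B^2 = 1. This only gives t' >= 1/2, hence
   the doubled constant in front of t'. *)
have hs : 1 / 2 <= s * (s - B).
  have e : s * (s - B) * (s + B) = s by transitivity (s * (s ^+ 2 - B ^+ 2)); [ring | rewrite s2; ring].
  have p : 0 < s + B by lra.
  rewrite -(ler_pM2r p) e; lra.
have t'1 : 1 <= 2 * t'.
  rewrite -(@ler_pXn2r _ 2) ?nnegrE //; last by rewrite mulr_ge0 // ltW.
  by rewrite exprMn et2 expr1n; nra.
have tt' : t' <= t by rewrite et ler_piMl ?(ltW t0) //; lra.
(* The key identity. The second factor is at least 2ys and |ks - A| <= C y, so |w| <= C follows. *)
have ew : (t - t' - 2 * y * s) * (t - t' + 2 * y * s) = 2 * s * (k * s - A).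
  transitivity (t ^+ 2 + t' ^+ 2 - 2 * (t * t') - 4 * y ^+ 2 * s ^+ 2); first by ring.
  by rewrite t2 et2 tt eA; ring: s2.
have p0 : 0 < y * s by rewrite mulr_gt0.
set w := t - t' - 2 * y * s in ew.
have hw1 : w <= C.
  rewrite -(ler_pM2r (_ : 0 < t - t' + 2 * y * s)); last by lra.
  rewrite ew; apply: (@le_trans _ _ (2 * s * (C * y))); first by rewrite ler_pM2l; lra.
  by rewrite [leLHS](_ : _ = C * (2 * y * s)) ?ler_wpM2l //; [lra | ring].
have hw2 : - C <= w.
  rewrite -(ler_pM2r (_ : 0 < t - t' + 2 * y * s)); last by lra.
  rewrite ew; apply: (@le_trans _ _ (2 * s * - (C * y))); last by rewrite ler_pM2l; lra.
  by rewrite [leRHS](_ : _ = - C * (2 * y * s)) ?ler_wnM2l //; [lra | lra | ring].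
have a1 : `|x + y * s - t| <= c by rewrite ler_norml /c; apply/andP; split; rewrite /w in hw1 hw2; lra.
have a2 : `|x - y * s - t'| <= c by rewrite ler_norml /c; apply/andP; split; rewrite /w in hw1 hw2; lra.
have c0 : 2 <= c by rewrite /c; lra.
split=> //.
- split.
    apply: (@le_trans _ _ (c + 2 * t)); last by nra.
    by move: a1; rewrite !ler_norml => /andP[? ?]; apply/andP; split; lra.
  apply: (@le_trans _ _ (c + 2 * t')); last by nra.
  by move: a2; rewrite !ler_norml => /andP[? ?]; apply/andP; split; lra.
- by split; nra.
Qed.

Lemma mahler_OK_height (A B : nat) (f : algC * algC) (q : int * int * int * int) :
  odd A -> odd B -> sqfree A -> sqfree (B ^ 2 + 1) -> coprime A (B ^ 2 + 1) ->
  frame A B f -> gen q ->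
  (forall q', gen q' -> height (conjs B f q) <= height (conjs B f q')) ->
  mahler_OK (nfield f.2) (height (conjs B f q)).
Proof.
move=> Ao Bo sA sD co hf gq qmin.
have A0 : (0 < A)%N by case: (A) Ao.
have B0 : (0 < B)%N by case: (B) Bo.
have ok := ring_of_intP Ao Bo sA sD co hf.
split.
  exists (ev f (iquad q)); split; first by case: q {gq qmin} => [[[a b] c] d]; apply/ok; exists a, b, c, d.
  split; first exact: (gen_nfield A0 B0 hf).
  have [p hp] := minZpoly_exists A0 B0 hf gq.
  by exists p; split=> //; rewrite (minZpoly_mahler A0 B0 hf gq hp).
move=> be m' /ok[a [b [c [d ->]]]] hb [p [hp ->]].
have gq' : gen (a, b, c, d) by apply: (gen_of_nfield A0 B0 hf).
by rewrite (@minZpoly_mahler A B A0 B0 f hf (a, b, c, d) p gq' hp); apply: qmin.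
Qed.

Lemma cyclic_quartic_mahler (C : nat) : exists C2 : nat, forall A B y k : nat,
  odd A -> odd B -> sqfree A -> sqfree (B ^ 2 + 1) -> coprime A (B ^ 2 + 1) ->
  A = (2 * y ^ 2 + k)%N -> (0 < y)%N ->
  ((A - C * y) ^ 2 <= k ^ 2 * (B ^ 2 + 1) <= (A + C * y) ^ 2)%N ->
  exists theta M s : algC,
    [/\ totally_real (nfield theta), cyclic_quartic theta,
        abs_disc (nfield theta) (256 * A ^ 2 * (B ^ 2 + 1) ^ 3)%:R,
        mahler_OK (nfield theta) M &
        [/\ 0 <= s, s ^+ 2 = (B ^ 2 + 1)%:R, A%:R * s <= M & M <= C2%:R * (A%:R * s)]].
Proof.
(* The product of the constants for the four conjugates: C + 2 twice, then C + 4 in front of t and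
   2C + 6 in front of t'. *)
exists ((C + 2) * (C + 2) * ((C + 4) * (2 * C + 6)))%N => A B y k Ao Bo sA sD co eA y0 /andP[k1 k2].
have A0 : (0 < A)%N by case: (A) Ao.
have B0 : (0 < B)%N by case: (B) Bo.
pose s : algR := Num.sqrt (B ^ 2 + 1)%:R.
have s0 : 0 < s by rewrite sqrtr_gt0 ltr0n addn1.
have s2 : s ^+ 2 = B%:R ^+ 2 + 1 by rewrite sqr_sqrtr ?ler0n // natrD natrX.
pose t : algR := Num.sqrt (A%:R * ((B ^ 2 + 1)%:R + B%:R * s)).
have p0 : 0 < A%:R * ((B ^ 2 + 1)%:R + B%:R * s) :> algR.
  by rewrite mulr_gt0 ?ltr0n // addr_gt0 ?mulr_gt0 ?ltr0n // addn1.
have t0 : 0 < t by rewrite sqrtr_gt0.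
have t2 : t ^+ 2 = A%:R * (B%:R ^+ 2 + 1 + B%:R * s) by rewrite sqr_sqrtr ?ltW // natrD natrX.
pose f : algC * algC := (algRval s, algRval t).
have hf : frame A B f.
  split; rewrite /f /=.
    by transitivity (algRval (s ^+ 2)); [ring | rewrite s2; ring].
  by transitivity (algRval (t ^+ 2)); [ring | rewrite t2; ring].
pose t' := (s - B%:R) * t.
pose x : int := Num.floor ((t + t') / 2).
have B1 : 1 <= B%:R :> algR by rewrite ler1n.
have A1 : 1 <= A%:R :> algR by rewrite ler1n.
have ks : k%:R * s <= A%:R + C%:R * y%:R.
  rewrite -(@ler_pXn2r _ 2) ?nnegrE //; last 2 first.
  - by rewrite mulr_ge0 ?ler0n // ltW.
  - by rewrite addr_ge0 ?mulr_ge0 ?ler0n.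
  rewrite exprMn s2; have : ((k ^ 2 * (B ^ 2 + 1))%N%:R : algR) <= ((A + C * y) ^ 2)%N%:R by rewrite ler_nat.
  by rewrite natrM !natrX !natrD natrM natrX.
have ks' : A%:R <= k%:R * s + C%:R * y%:R.
  (* The natural-number difference A - C y is truncated; when it is zero the inequality is
     immediate. *)
  have [h|h] := leqP A (C * y).
    apply: (@le_trans _ _ (C%:R * y%:R)); first by rewrite -natrM ler_nat.
    by rewrite lerDr mulr_ge0 ?ler0n // ltW.
  rewrite -lerBlDr -(@ler_pXn2r _ 2) ?nnegrE //; last 2 first.
  - by rewrite subr_ge0 -natrM ler_nat ltnW.
  - by rewrite mulr_ge0 ?ler0n // ltW.
  rewrite exprMn s2; have : (((A - C * y) ^ 2)%N%:R : algR) <= (k ^ 2 * (B ^ 2 + 1))%N%:R by rewrite ler_nat.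
  by rewrite natrM !natrX !natrD natrB ?natrM ?natrX // ltnW.
have [] := @approx_bound algR A%:R B%:R y%:R k%:R C%:R s t t' x%:~R s0 s2 B1 A1 t0 t2 erefl _ _ _ ks ks' _ _.
- by rewrite eA natrD natrM natrX.
- by rewrite ltr0n.
- by rewrite ler0n.
- exact: floor_le.
- by have := floorD1_gt ((t + t') / 2); rewrite rmorphD /=.
move=> b0 b1 [b2 b3] [b4 b5] ett.
have [q gq qmin] := height_min A0 B0 hf.
exists f.2, (height (conjs B f q)), f.1; split.
- by apply: (frame_real A0 B0 hf); apply: algRvalP.
- exact: (frame_cyclic A0 B0 hf).
- exact: (frame_disc Ao Bo sA sD co hf).
- exact: (mahler_OK_height Ao Bo sA sD co hf gq qmin).
split.
- by apply: ltW; exact: s0.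
- by case: hf.
- have := height_lower B0 hf gq; rewrite ger0_norm //; apply: ltW; exact: s0.
(* The element x + ys - t with x the integer part of (t + t')/2. *)
have gq0 : gen (x, y%:Z, -1, 0) by [].
apply: le_trans (qmin _ gq0) _; rewrite height_conjs.
have cutR (z c : algR) : 1 <= c -> `|z| <= c -> cut (algRval z) <= algRval c.
  by move=> c1 zc; apply: cut_le.
have e0 : ev f (iquad (x, y%:Z, -1, 0)) = algRval (x%:~R + y%:R * s - t).
  by rewrite /=; ring.
have e1 : ev (iter 1 (nxt B) f) (iquad (x, y%:Z, -1, 0)) = algRval (x%:~R - y%:R * s - t').
  by rewrite /t' /=; ring.
have e2 : ev (iter 2 (nxt B) f) (iquad (x, y%:Z, -1, 0)) = algRval (x%:~R + y%:R * s + t).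
  by have [/= f1 _] := hf; rewrite /=; ring: f1.
have e3 : ev (iter 3 (nxt B) f) (iquad (x, y%:Z, -1, 0)) = algRval (x%:~R - y%:R * s + t').
  by have [/= f1 _] := hf; rewrite /t' /=; ring: f1.
have c1 : 1 <= C%:R + 2 :> algR by rewrite -natrD ler1n addn2.
rewrite e0 e1 e2 e3.
apply: (@le_trans _ _ (algRval ((C%:R + 2) * ((C%:R + 2) * ((2 + (C%:R + 2)) * t * ((2 + 2 * (C%:R + 2)) * t'))))))%R; last first.
  have -> : (C%:R + 2) * ((C%:R + 2) * ((2 + (C%:R + 2)) * t * ((2 + 2 * (C%:R + 2)) * t'))) =
     ((C + 2) * (C + 2) * ((C + 4) * (2 * C + 6)))%N%:R * (t * t') by rewrite !(natrM, natrD); ring.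
  rewrite ett; rewrite le_eqVlt; apply/orP; left; apply/eqP; ring.
have cut0 z : 0 <= cut z := le_trans ler01 (cut_ge1 z).
exact: (ler_pM (cut0 _) (mulr_ge0 (cut0 _) (mulr_ge0 (cut0 _) (cut0 _))) (cutR _ _ c1 b0)
  (ler_pM (cut0 _) (mulr_ge0 (cut0 _) (cut0 _)) (cutR _ _ c1 b1)
    (ler_pM (cut0 _) (cut0 _) (cutR _ _ b4 b2) (cutR _ _ b5 b3)))).
Qed.

(** * Reduction to the choice of parameters *)

(** The last condition is |ks - A| <= C y with s the square root of B^2 + 1, squared so as to stay
    among natural numbers. *)
Definition admissible (C A B y k : nat) : Prop :=
  [/\ odd A, odd B, sqfree A, sqfree (B ^ 2 + 1) & coprime A (B ^ 2 + 1)] /\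
  [/\ A = (2 * y ^ 2 + k)%N, (0 < y)%N &
      ((A - C * y) ^ 2 <= k ^ 2 * (B ^ 2 + 1) <= (A + C * y) ^ 2)%N].

Lemma mahler_OK_unique (K K' : algC -> Prop) M M' :
  (forall x, K x <-> K' x) -> mahler_OK K M -> mahler_OK K' M' -> M = M'.
Proof.
move=> e [[a [ra [ga ma]]] hK] [[a' [ra' [ga' ma']]] hK'].
apply/le_anti/andP; split.
  apply: (hK a') => //; first by case: ra' => /e ? ?.
  by move=> x; rewrite ga' e.
apply: (hK' a) => //; first by case: ra => /e ? ?.
by move=> x; rewrite ga -e.
Qed.

(** Used to get pairwise distinct fields: the minimum depends only on the field by
    [mahler_OK_unique], so strictly increasing minima separate them. *)
Lemma strictly_increasing_choice (G : algC -> algC -> Prop) :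
  (forall x M, G x M -> 0 <= M) ->
  (forall N : nat, exists x M, G x M /\ N%:R < M) ->
  exists (x M : nat -> algC), (forall i, G (x i) (M i)) /\ {homo M : i j / (i < j)%N >-> i < j}.
Proof.
move=> G0 hG.
have pick N : {xM : algC * algC | G xM.1 xM.2 /\ N%:R < xM.2}.
  by apply: constructive_indefinite_description; have [x [M h]] := hG N; exists (x, M).
pose step (xM : algC * algC) := sval (pick (Num.bound xM.2)).
pose u i := iter i step (sval (pick 0%N)).
have uG i : G (u i).1 (u i).2.
  by case: i => [|i]; exact: proj1 (svalP (pick _)).
exists (fun i => (u i).1), (fun i => (u i).2); split=> //.
apply: homo_ltn => [y x z|i]; first exact: lt_trans.
have -> : u i.+1 = step (u i) by [].
have h : (u i).2 < (Num.bound (u i).2)%:R := archi_boundP (G0 _ _ (uG i)).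
exact: lt_trans h (proj2 (svalP (pick _))).
Qed.

(** If D is comparable to T^(4q), then D^(p/q) is comparable to T^(4p); since L >= 1, L also bounds
    its own q-th root. *)
Lemma rpow_bounds (p q L : nat) (D : algC) (T : nat) :
  (0 < q)%N -> (1 <= L)%N -> 0 <= D ->
  D <= L%:R * T%:R ^+ (4 * q) -> T%:R ^+ (4 * q) <= L%:R * D ->
  q.-root D ^+ p <= L%:R ^+ p * T%:R ^+ (4 * p) /\ T%:R ^+ (4 * p) <= L%:R ^+ p * q.-root D ^+ p.
Proof.
move=> q0 L1 D0 h1 h2; set w := q.-root D.
have w0 : 0 <= w by rewrite rootC_ge0.
have wq : w ^+ q = D by rewrite rootCK.
have L1' : 1 <= L%:R :> algC by rewrite ler1n.
have L0 : 0 <= L%:R :> algC by rewrite ler0n.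
have Lq : L%:R <= L%:R ^+ q :> algC by rewrite -{1}(expr1 L%:R) ler_weXn2l.
have T0 : 0 <= T%:R :> algC by rewrite ler0n.
have T4 : 0 <= T%:R ^+ 4 :> algC by rewrite exprn_ge0.
have a1 : w <= L%:R * T%:R ^+ 4.
  rewrite -(@ler_pXn2r _ q) // ?nnegrE ?mulr_ge0 // wq exprMn -exprM (le_trans h1) //.
  by rewrite ler_wpM2r // exprn_ge0.
have a2 : T%:R ^+ 4 <= L%:R * w.
  rewrite -(@ler_pXn2r _ q) // ?nnegrE ?mulr_ge0 // [(L%:R * w) ^+ q]exprMn wq -exprM (le_trans h2) //.
  by rewrite ler_wpM2r.
rewrite !exprM -!exprMn; split; apply: lerXn2r; rewrite ?nnegrE ?mulr_ge0 //.
Qed.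

Lemma theorem_of_parameters (r : rat) :
  (forall m n : nat, (0 < m <= n)%N -> exists2 C : nat, (0 < C)%N & forall T0 : nat,
    exists T A B y k : nat, [/\ (T0 <= T)%N, (0 < T)%N, admissible C A B y k,
      (T ^ m <= C * B)%N /\ (B <= C * T ^ m)%N & (T ^ n <= C * A)%N /\ (A <= C * T ^ n)%N]) ->
  1 / 4 <= r -> r < 1 / 2 ->
  exists c1 c2 : algC, 0 < c1 /\ 0 < c2 /\
  exists theta : nat -> algC,
    (forall n m : nat, n <> m -> ~ (forall x, nfield (theta n) x <-> nfield (theta m) x)) /\
    (forall n : nat,
       totally_real (nfield (theta n)) /\ cyclic_quartic (theta n) /\
       exists D M : algC, abs_disc (nfield (theta n)) D /\ mahler_OK (nfield (theta n)) M /\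
         c1 * rpow D r <= M /\ M <= c2 * rpow D r).
Proof.
have g1 b : (0 < b -> b ^ 2 + 1 <= 4 * b ^ 2)%N by lia.
have g2 c a b : (c * (a * (2 * b)) <= 2 * c * (a * b))%N by lia.
have g3 c a b : (c * a * (c * b) = c ^ 2 * (a * b))%N by rewrite -mulnn; lia.
have g4 c a b : (2048 * (c ^ 2 * a) * (c ^ 6 * b) <= 2048 * c ^ 8 * (a * b))%N.
  by rewrite (expnD c 2 6); lia.
have g5 b : (0 < b -> b ^ 2 + 1 <= 2 * b ^ 2)%N by lia.
have g6 c l t ab : (t <= c * ab -> l * t <= c * l * ab)%N by nia.
have g7 c c2 t ab : (ab <= c * t -> 2 * c2 * ab <= 2 * c2 * c * t)%N by nia.
have g8 p q : (q <= 4 * p -> 2 * p < q -> 6 * p - q + (q - 2 * p) = 4 * p)%N by lia.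
have g9 p q : (q <= 4 * p -> 2 * p < q -> (6 * p - q) * 2 + (q - 2 * p) * 6 = 4 * q)%N by lia.
have g11 a b c : (b <= 2 ^ 3 * c -> 256 * a * b <= 2048 * a * c)%N by nia.
have g10 p q : (q <= 4 * p -> 2 * p < q -> 0 < q - 2 * p <= 6 * p - q)%N by lia.
move=> hpar r1 r2.
pose p := `|numq r|%N; pose q := `|denq r|%N.
have q0 : (0 < q)%N by rewrite absz_gt0 denq_neq0.
have rE : r * q%:R = p%:R.
  rewrite /p /q !natr_absz !ger0_norm ?denq_ge0 ?numq_ge0 //; last by lra.
  by rewrite -{1}(divq_num_den r) divfK // intr_eq0 denq_neq0.
have qpos : 0 < q%:R :> rat by rewrite ltr0n.
have pq1 : (q <= 4 * p)%N by rewrite -(ler_nat rat) natrM -rE; nra.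
have pq2 : (2 * p < q)%N by rewrite -(ltr_nat rat) natrM -rE; nra.
(* Solving m + n = 4p and 6m + 2n = 4q gives these exponents. *)
have [|C C0 hC] := hpar (q - 2 * p)%N (6 * p - q)%N; first exact: g10.
have [C2 hC2] := cyclic_quartic_mahler C.
(* 256 A^2 (B^2 + 1)^3 is at most 256 A^2 (2 B^2)^3 = 2048 A^2 B^6, and the eight factors of A and B
   each cost one C. *)
pose L := (2048 * C ^ 8)%N.
have L1 : (1 <= L)%N by rewrite muln_gt0 expn_gt0 C0.
have C2R : 0 < (2 * C2.+1 * C ^ 2 * L ^ p)%:R :> algC.
  by rewrite ltr0n !muln_gt0 !expn_gt0 C0 L1.
pose c1 : algC := ((C ^ 2 * L ^ p)%:R)^-1; pose c2 : algC := (2 * C2.+1 * C ^ 2 * L ^ p)%:R.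
have c1' : 0 < (C ^ 2 * L ^ p)%:R :> algC by rewrite ltr0n !muln_gt0 !expn_gt0 C0 L1.
exists c1, c2; split; first by rewrite invr_gt0.
split=> //.
pose G theta M := [/\ totally_real (nfield theta), cyclic_quartic theta, mahler_OK (nfield theta) M,
   0 <= M & exists D, [/\ abs_disc (nfield theta) D, c1 * rpow D r <= M & M <= c2 * rpow D r]].
have [||th [M [hG hM]]] := @strictly_increasing_choice G.
- by move=> x M [].
(* The lower bound C (N + 1) on T forces A > N, and therefore M > N. *)
- move=> N; have [T [A [B [y [k [T0 Tpos hadm [B1 B2] [A1 A2]]]]]]] := hC (C * N.+1)%N.
  case: hadm => [[Ao Bo sA sD co] [eA y0 kk]].
  have [theta [M [s [tr cq ad mo [s0 s2 M1 M2]]]]] := hC2 A B y k Ao Bo sA sD co eA y0 kk.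
  have B0 : (0 < B)%N by case: (B) Bo.
  have A0 : (0 < A)%N by case: (A) Ao.
  have sB : B%:R <= s.
    by rewrite -(@ler_pXn2r _ 2) ?nnegrE ?ler0n // s2 -natrX ler_nat leq_addr.
  have sB2 : s <= (2 * B)%:R.
    by rewrite -(@ler_pXn2r _ 2) ?nnegrE ?ler0n // s2 -natrX ler_nat expnMn; apply: g1.
  have MAB : (A * B)%:R <= M.
    by apply: le_trans M1; rewrite natrM ler_wpM2l ?ler0n.
  have MAB2 : M <= (2 * C2.+1 * (A * B))%:R.
    apply: le_trans M2 _; apply: (@le_trans _ _ (C2.+1%:R * (A%:R * (2 * B)%:R))).
      by apply: ler_pM; rewrite ?mulr_ge0 ?ler0n ?ler_nat // ler_wpM2l ?ler0n.
    by rewrite -!natrM ler_nat; apply: g2.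
  have Tp : (T ^ (6 * p - q) * T ^ (q - 2 * p) = T ^ (4 * p))%N by rewrite -expnD g8.
  have Tq : ((T ^ (6 * p - q)) ^ 2 * (T ^ (q - 2 * p)) ^ 6 = T ^ (4 * q))%N.
    by rewrite -!expnM -expnD g9.
  have E1 : (T ^ (4 * p) <= C ^ 2 * (A * B))%N.
    by rewrite -Tp (leq_trans (leq_mul A1 B1)) // g3.
  have E2 : (A * B <= C ^ 2 * T ^ (4 * p))%N.
    by rewrite -Tp (leq_trans (leq_mul A2 B2)) // g3.
  set DK := (256 * A ^ 2 * (B ^ 2 + 1) ^ 3)%N in ad.
  have F1 : (T ^ (4 * q) <= C ^ 8 * DK)%N.
    rewrite -Tq; apply: (@leq_trans ((C * A) ^ 2 * (C * B) ^ 6)).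
      by rewrite leq_mul // leq_exp2r.
    rewrite !expnMn mulnACA -expnD leq_mul // /DK -mulnA -[leqLHS]mul1n leq_mul //.
    by rewrite leq_mul // (expnM B 2 3) leq_exp2r // leq_addr.
  have F2 : (DK <= 2048 * C ^ 8 * T ^ (4 * q))%N.
    rewrite -Tq; apply: (@leq_trans (2048 * (C * T ^ (6 * p - q)) ^ 2 * (C * T ^ (q - 2 * p)) ^ 6)).
      apply: (@leq_trans (2048 * A ^ 2 * B ^ 6)).
        have h3 : ((B ^ 2 + 1) ^ 3 <= 2 ^ 3 * B ^ 6)%N.
          by rewrite (expnM B 2 3) -expnMn leq_exp2r //; apply: g5.
        rewrite /DK; apply: g11 h3.
      by rewrite leq_mul // ?leq_mul // leq_exp2r.
    by rewrite !expnMn; apply: g4.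
  have [R1 R2] : q.-root (DK%:R : algC) ^+ p <= L%:R ^+ p * T%:R ^+ (4 * p) /\
      T%:R ^+ (4 * p) <= L%:R ^+ p * q.-root DK%:R ^+ p :> algC.
    apply: rpow_bounds => //; rewrite -natrX -natrM ler_nat //.
    by rewrite (leq_trans F1) // leq_mul // /L leq_pmull.
  exists theta, M; split; last first.
    apply: lt_le_trans MAB; rewrite ltr_nat.
    have t1 : (C * N.+1 <= C * (A * B))%N.
      apply: leq_trans T0 _; apply: (@leq_trans (T ^ (6 * p - q))).
        by rewrite -{1}(expn1 T) leq_pexp2l //; case/andP: (g10 _ _ pq1 pq2) => /leq_trans; apply.
      by apply: leq_trans A1 _; rewrite leq_mul2l leq_pmulr // orbT.
    by move: t1; rewrite leq_pmul2l.
  split=> //; first by apply: le_trans MAB; rewrite ler0n.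
  exists DK%:R; split=> //; rewrite /rpow -/p -/q.
    rewrite /c1 mulrC ler_pdivrMr // (le_trans R1) // -!natrX -natrM.
    apply: (@le_trans _ _ ((C ^ 2 * L ^ p) * (A * B))%N%:R); first by rewrite ler_nat; apply: g6.
    by rewrite natrM mulrC ler_wpM2r ?ler0n.
  apply: le_trans MAB2 _.
  apply: (@le_trans _ _ (2 * C2.+1 * C ^ 2 * T ^ (4 * p))%:R); first by rewrite ler_nat; apply: g7.
  by rewrite /c2 natrM [leRHS](_ : _ = (2 * C2.+1 * C ^ 2)%:R * (L%:R ^+ p * q.-root DK%:R ^+ p)) ?natrX ?ler_wpM2l ?ler0n // natrM natrX mulrA.
exists th; split.
  move=> i j ij same; have := mahler_OK_unique same.
  case: (hG i) => _ _ mi _ _; case: (hG j) => _ _ mj _ _ => /(_ _ _ mi mj) e.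
  have [h|h|//] := ltngtP i j; first by have := hM _ _ h; rewrite e ltxx.
  by have := hM _ _ h; rewrite e ltxx.
move=> i; case: (hG i) => tr cq mo _ [D [ad h1 h2]].
by split=> //; split=> //; exists D, (M i).
Qed.

(** * Counting solutions of congruences *)

Lemma sum_nat_card n (P : pred nat) :
  (\sum_(x < n) P x)%N = #|[set x : 'I_n | P x]|.
Proof. by rewrite -sum1dep_card [RHS]big_mkcond /=; apply: eq_bigr => i _; case: (P i). Qed.

Lemma count_residue n m c : (0 < m)%N ->
  (\sum_(x < n) (x == c %[mod m]) <= n %/ m + 1)%N.
Proof.
move=> m0; rewrite (sum_nat_card n (fun x => x == c %[mod m])).
have h (x : 'I_n) : (x %/ m < n %/ m + 1)%N.
  by rewrite addn1 ltnS leq_div2r // ltnW.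
rewrite -[leqRHS]card_ord.
pose g (x : 'I_n) := Ordinal (h x).
apply: (@leq_trans #|g @: [set x : 'I_n | x == c %[mod m]]|); last exact: max_card.
rewrite card_in_imset // => x y; rewrite !inE => /eqP hx /eqP hy /(congr1 val) /= e.
by apply: val_inj; rewrite /= (divn_eq x m) (divn_eq y m) e hx hy.
Qed.

Lemma count_linear p e u v n : prime p -> ~~ (p %| u)%N ->
  (\sum_(x < n) (p ^ e %| u * x + v) <= n %/ p ^ e + 1)%N.
Proof.
move=> pp pu; have m0 : (0 < p ^ e)%N by rewrite expn_gt0 prime_gt0.
rewrite (sum_nat_card n (fun x => p ^ e %| u * x + v)%N).
have [->|[c hc]] := set_0Vmem [set x : 'I_n | (p ^ e %| u * x + v)%N]; first by rewrite cards0.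
apply: leq_trans (count_residue n c m0); rewrite (sum_nat_card n (fun x => x == c %[mod p ^ e])).
apply/subset_leq_card/subsetP => x; rewrite !inE in hc * => hx.
have co : coprime (p ^ e) u by rewrite coprimeXl // prime_coprime.
wlog le : x c hc hx / (c <= x)%N.
  by move=> h; have [|/ltnW] := leqP c x; [exact: h | rewrite eq_sym => /h; apply].
rewrite eqn_mod_dvd // -(Gauss_dvdr _ co) mulnBr.
by rewrite -(subnDr v) dvdn_sub.
Qed.

(* Two roots of a quadratic congruence modulo an odd prime power agree up to sign. *)
Lemma count_quadratic p e a u v k n : prime p -> odd p ->
  ~~ (p %| a)%N -> ~~ (p %| u)%N -> ~~ (p %| k)%N -> (0 < e)%N ->
  (\sum_(x < n) (p ^ e %| a * (u * x + v) ^ 2 + k) <= 2 * (n %/ p ^ e + 1))%N.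
Proof.
have gen1 (U V w : nat) : (U <= V -> 2 * (V + w) = V + w + (U + w) + (V - U))%N by lia.
have gen2 (U V w : nat) : (U + (w + (V + w)) = V + (w + (U + w)))%N by lia.
move=> pp po pa pu pk e0.
rewrite (sum_nat_card n (fun x => p ^ e %| a * (u * x + v) ^ 2 + k)%N).
have [->|[c hc]] := set_0Vmem [set x : 'I_n | (p ^ e %| a * (u * x + v) ^ 2 + k)%N].
  by rewrite cards0.
pose S1 := [set x : 'I_n | (p ^ e %| u * x + (v + (u * c + v)))%N].
pose S2 := [set x : 'I_n | x == c %[mod p ^ e]].
apply: (@leq_trans #|S1 :|: S2|); last first.
  rewrite cardsU (leq_trans (leq_subr _ _)) // mul2n -addnn leq_add //.
    by have := @count_linear p e u (v + (u * c + v)) n pp pu; rewrite (sum_nat_card n (fun x => p ^ e %| u * x + (v + (u * c + v)))%N).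
  by have := @count_residue n (p ^ e) c; rewrite (sum_nat_card n (fun x => x == c %[mod p ^ e])); apply; rewrite expn_gt0 prime_gt0.
apply/subset_leq_card/subsetP => x; rewrite !inE in hc * => hx.
have co : coprime (p ^ e) u by rewrite coprimeXl // prime_coprime.
have coa : coprime (p ^ e) a by rewrite coprimeXl // prime_coprime.
have hz (z : nat) : (p ^ e %| a * z ^ 2 + k)%N -> ~~ (p %| z)%N.
  move=> h; apply: contra pk => pz.
  have : (p %| a * z ^ 2 + k)%N by apply: dvdn_trans h; rewrite dvdn_exp.
  by rewrite dvdn_addr // dvdn_mull // dvdn_exp.
have key (x' c' : nat) : (c' <= x')%N -> (p ^ e %| a * (u * c' + v) ^ 2 + k)%N ->
   (p ^ e %| a * (u * x' + v) ^ 2 + k)%N ->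
   (p ^ e %| u * x' + (v + (u * c' + v)))%N || (x' == c' %[mod p ^ e]).
  move=> le h1 h2.
  have d : (p ^ e %| (u * x' + v + (u * c' + v)) * (u * (x' - c')))%N.
    rewrite -(Gauss_dvdr _ coa); have := dvdn_sub h2 h1; rewrite subnDr -mulnBr subn_sqr.
    have -> : (u * (x' - c') = (u * x' + v) - (u * c' + v))%N by rewrite mulnBr subnDr.
    by rewrite [X in (_ %| a * X)%N -> _]mulnC.
  (* The prime cannot divide both factors of the difference of squares: it would divide 2(u x' + v),
     hence u x' + v since it is odd, contradicting [hz]. *)
  rewrite addnA; have [pd|pd] := boolP (p %| u * x' + v + (u * c' + v))%N; last first.
    by rewrite Gauss_dvdr ?coprimeXl ?prime_coprime // in d; apply/orP; right; rewrite eqn_mod_dvd // -(Gauss_dvdr _ co).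
  have npd : ~~ (p %| u * (x' - c'))%N.
    apply/negP => pd2; case/negP: (hz _ h2).
    have : (p %| 2 * (u * x' + v))%N.
      have -> : (2 * (u * x' + v) = u * x' + v + (u * c' + v) + u * (x' - c'))%N.
        by rewrite mulnBr; apply: gen1; rewrite leq_mul2l le orbT.
      by rewrite dvdn_add.
    rewrite Euclid_dvdM // => /orP[|//]; rewrite dvdn_prime2 // => /eqP p2.
    by rewrite p2 in po.
  by rewrite mulnC Gauss_dvdr ?coprimeXl ?prime_coprime // in d; rewrite d.
have [le|/ltnW le] := leqP c x; first exact: key.
have := key _ _ le hx hc; rewrite eq_sym; by rewrite gen2.
Qed.

(** * Sums over primes and Chebyshev's bound *)

(** These primes are odd, and for N = 2j + 1 one has 1/N^2 <= 1/(4j) - 1/(4(j + 1)); the sum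
    telescopes from j = 3. *)
Lemma sum_inv_sqr_primes N :
  \sum_(7 <= p < N | prime p) (p%:R ^+ 2)^-1 <= 1 / 12 :> rat.
Proof.
have [c hc] : exists c : rat, c = 1 / 12 by eexists.
rewrite -hc; have c0 : 0 <= c by rewrite hc; lra.
have [h|h] := leqP N 7; first by rewrite big_geq.
suff : \sum_(7 <= p < N | prime p) (p%:R ^+ 2)^-1 <= c - (4 * (N./2)%:R)^-1 :> rat.
  by move/le_trans; apply; rewrite lerBlDr lerDl invr_ge0 mulr_ge0.
elim: N h => [|N IH]; first by rewrite ltn0.
rewrite ltnS leq_eqVlt => /orP[/eqP<-|h].
  rewrite big_mkcond big_nat1 [prime 7](_ : _ = true); last by [].
  by rewrite [8./2](_ : _ = 4%N); [rewrite hc; lra | by []].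
rewrite big_mkcond big_nat_recr ?(ltnW h) //= -big_mkcond /=.
have [No|Ne] := boolP (odd N); last first.
  have -> : prime N = false by apply: contraNF Ne => pN; have [e2|//] := even_prime pN; rewrite e2 in h.
  by rewrite addr0 uphalf_half (negPf Ne) add0n IH.
have eN : N = (N./2 * 2 + 1)%N by rewrite -{1}(odd_double_half N) No addnC muln2.
rewrite uphalf_half No /= add1n.
have j0 : (2 < N./2)%N by lia.
set j := N./2 in eN j0 *.
apply: (@le_trans _ _ (c - (4 * j%:R)^-1 + (N%:R ^+ 2)^-1)).
  by apply: lerD; [exact: IH | case: ifP => // _; rewrite invr_ge0 exprn_ge0].
have j0' : (0 < j)%N by rewrite (ltn_trans _ j0).
have N0 : (0 < N)%N by rewrite eN addn1.
have jp : 0 < j%:R :> rat by rewrite ltr0n.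
have e : (4 * j%:R)^-1 - (4 * j.+1%:R)^-1 = (4 * j%:R * (j%:R + 1))^-1 :> rat.
  by rewrite -addn1 natrD; field; rewrite !gt_eqF // addr_gt0.
have : (N%:R ^+ 2)^-1 <= (4 * j%:R * (j%:R + 1))^-1 :> rat.
  rewrite lef_pV2 ?posrE ?exprn_gt0 ?mulr_gt0 ?addr_gt0 ?ltr0n //.
  by rewrite eN natrD natrM; lra.
by rewrite -e; move: (N%:R ^- 2) ((4 * j%:R)^-1) ((4 * j.+1%:R)^-1) => a b d h2; lra.
Qed.

Lemma sum_inv_sqr_tail Z N : (0 < Z)%N ->
  \sum_(Z.+1 <= p < N | prime p) (p%:R ^+ 2)^-1 <= Z%:R^-1 :> rat.
Proof.
move=> Z0; have [h|h] := leqP N Z.+1; first by rewrite big_geq // invr_ge0.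
suff : \sum_(Z.+1 <= p < N | prime p) (p%:R ^+ 2)^-1 <= Z%:R^-1 - (N.-1)%:R^-1 :> rat.
  by move/le_trans; apply; rewrite lerBlDr lerDl invr_ge0.
elim: N h => [|N IH]; first by rewrite ltn0.
rewrite ltnS leq_eqVlt => /orP[/eqP<-|h].
  rewrite big_mkcond big_nat1 /=; case: ifP => _.
    have zp : 0 < Z%:R :> rat by rewrite ltr0n.
    have -> : Z%:R^-1 - Z.+1%:R^-1 = (Z%:R * (Z%:R + 1))^-1 :> rat.
      by rewrite -addn1 natrD; field; rewrite !gt_eqF // addr_gt0.
    rewrite lef_pV2 ?posrE ?exprn_gt0 ?mulr_gt0 ?addr_gt0 ?ltr0n //.
    by rewrite -addn1 natrD; nra.
  by rewrite subr_ge0 lef_pV2 ?posrE ?ltr0n // ler_nat.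
rewrite big_mkcond big_nat_recr ?(ltnW h) //= -big_mkcond /=.
have N1 : (0 < N.-1)%N by lia.
apply: (@le_trans _ _ (Z%:R^-1 - N.-1%:R^-1 + (N%:R ^+ 2)^-1)).
  by apply: lerD; [exact: IH | case: ifP => // _; rewrite invr_ge0 exprn_ge0].
set j := N.-1 in N1 *; have eN : N = j.+1 by rewrite /j; lia.
have N0 : (0 < N)%N by rewrite eN.
have jp : 0 < j%:R :> rat by rewrite ltr0n.
have e : j%:R^-1 - j.+1%:R^-1 = (j%:R * (j%:R + 1))^-1 :> rat.
  by rewrite -addn1 natrD; field; rewrite !gt_eqF // addr_gt0.
have : (N%:R ^+ 2)^-1 <= (j%:R * (j%:R + 1))^-1 :> rat.
  rewrite lef_pV2 ?posrE ?exprn_gt0 ?mulr_gt0 ?addr_gt0 ?ltr0n //.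
  by rewrite eN -addn1 natrD; nra.
by rewrite -e eN /=; move: (j.+1%:R ^- 2) (j%:R^-1) (j.+1%:R^-1) (Z%:R^-1) => a b d g h2; lra.
Qed.

(** Each dyadic block of the harmonic sum contributes at most 1. *)
Lemma sum_inv_le_log J N : (N <= 2 ^ J)%N ->
  \sum_(7 <= q < N | prime q) q%:R^-1 <= J%:R :> rat.
Proof.
move=> hN.
apply: (@le_trans _ _ (\sum_(1 <= q < 2 ^ J) q%:R^-1)).
  apply: (@le_trans _ _ (\sum_(1 <= q < N) q%:R^-1)).
    have [h|h] := leqP N 7.
      by rewrite big_geq // sumr_ge0 // => i _; rewrite invr_ge0.
    rewrite [leRHS](@big_cat_nat _ _ _ 7) //=; last exact: ltnW.
    rewrite -[leLHS]add0r; apply: lerD; first by rewrite sumr_ge0 // => i _; rewrite invr_ge0.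
    by rewrite big_mkcond /=; apply: ler_sum => i _; case: ifP; rewrite // invr_ge0.
  have [N0|N0] := posnP N; first by rewrite N0 big_geq // sumr_ge0 // => i _; rewrite invr_ge0.
  rewrite [leRHS](@big_cat_nat _ _ _ N) //=.
  by rewrite lerDl sumr_ge0 // => i _; rewrite invr_ge0.
elim: J {N hN} => [|J IH]; first by rewrite big_geq.
have p0 : (0 < 2 ^ J)%N by rewrite expn_gt0.
rewrite (@big_cat_nat _ _ _ (2 ^ J)) //=; last by rewrite leq_exp2l.
rewrite -natr1; apply: lerD; first exact: IH.
apply: (@le_trans _ _ (\sum_(2 ^ J <= i < 2 ^ J.+1) ((2 ^ J)%N%:R^-1 : rat))).
  rewrite !big_nat; apply: ler_sum => i /andP[h _].
  by rewrite lef_pV2 ?posrE ?ltr0n ?ler_nat // (leq_trans p0).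
rewrite sumr_const_nat expnS mul2n -addnn addnK -[_ *+ _]mulr_natl mulfV //.
by rewrite pnatr_eq0 -lt0n.
Qed.

Lemma prod_primes_dvd (s : seq nat) m : uniq s -> all prime s -> all (dvdn^~ m) s ->
  (\prod_(p <- s) p %| m)%N.
Proof.
elim: s => [|p s IH]; first by rewrite big_nil dvd1n.
rewrite big_cons /= => /andP[ps us] /andP[pp sp] /andP[pm sm].
rewrite Gauss_dvd; first by rewrite pm IH.
rewrite prime_coprime // Euclid_dvd_prod // big_has; apply/hasPn => q qs.
rewrite dvdn_prime2 //; last exact: (allP sp).
by apply/eqP => e; move: ps; rewrite e qs.
Qed.

Lemma prod_ge_exp (s : seq nat) c : all (leq c) s -> (c ^ size s <= \prod_(p <- s) p)%N.
Proof.
elim: s => [|p s IH] /=; first by rewrite big_nil.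
by move=> /andP[cp cs]; rewrite big_cons expnS leq_mul // IH.
Qed.

Lemma sum_prime_divisors J M a : (0 < a < 2 ^ J)%N ->
  (\sum_(7 <= q < M | prime q) (q %| a) <= J)%N.
Proof.
move=> /andP[a0 aJ].
pose s := [seq q <- index_iota 7 M | prime q && (q %| a)%N].
have -> : (\sum_(7 <= q < M | prime q) (q %| a) = size s)%N.
  by rewrite size_filter -sum1_count [RHS]big_mkcondr.
have s1 : all prime s by apply/allP => q; rewrite mem_filter => /andP[/andP[]].
have s2 : (\prod_(p <- s) p %| a)%N.
  apply: prod_primes_dvd => //; first by rewrite filter_uniq // iota_uniq.
  by apply/allP => q; rewrite mem_filter => /andP[/andP[]].
have s3 : (2 ^ size s <= \prod_(p <- s) p)%N.
  by apply: prod_ge_exp; apply/allP => q /(allP s1)/prime_gt1.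
rewrite -ltnS -(@ltn_exp2l 2) // (leq_ltn_trans (leq_trans s3 (dvdn_leq a0 s2))) //.
by rewrite (ltn_trans aJ) // ltn_exp2l.
Qed.

Definition primepi (N : nat) : nat := \sum_(0 <= p < N | prime p) 1.

(** Every prime strictly between n and 2n divides the central binomial coefficient, which is at most
    4^n. *)
Lemma central_bin_primes n : (0 < n)%N ->
  (n ^ (\sum_(n.+1 <= p < 2 * n | prime p) 1) <= 2 ^ (2 * n))%N.
Proof.
move=> n0; pose s := [seq q <- index_iota n.+1 (2 * n) | prime q].
have -> : (\sum_(n.+1 <= p < 2 * n | prime p) 1 = size s)%N.
  by rewrite size_filter -sum1_count.
have b1 : ('C(2 * n, n) <= 2 ^ (2 * n))%N.
  have h : (n < (2 * n).+1)%N by lia.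
  have e : (2 ^ (2 * n) = (1 + 1) ^ (2 * n))%N by [].
  rewrite e expnDn (bigD1 (Ordinal h)) //= !exp1n !muln1.
  exact: leq_addr.
apply: leq_trans b1; apply: (@leq_trans (\prod_(p <- s) p)).
  apply: prod_ge_exp; apply/allP => q; rewrite mem_filter mem_index_iota.
  by case/and3P => _ /ltnW.
apply: dvdn_leq; first by rewrite bin_gt0; lia.
apply: prod_primes_dvd; first by rewrite filter_uniq // iota_uniq.
  by apply/allP => q; rewrite mem_filter => /andP[].
apply/allP => q; rewrite mem_filter mem_index_iota => /and3P[pq h1 h2].
have e := @bin_fact (2 * n) n _.
have : (q %| (2 * n)`!)%N by rewrite dvdn_fact // prime_gt0 // ltnW.
rewrite -e; last by lia.
have nf : ~~ (q %| n`!)%N.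
  have [h|h] := boolP (q %| n`!)%N => //; exfalso.
  have : forall k, (k < q)%N -> ~~ (q %| k`!)%N.
    elim=> [|k IH] hk; first by rewrite fact0 gtnNdvd // prime_gt1.
    by rewrite factS Euclid_dvdM // negb_or gtnNdvd //= IH // ltnW.
  by move=> /(_ n h1); rewrite h.
have e2 : (2 * n - n = n)%N by lia.
by rewrite e2 !Euclid_dvdM // (negPf nf) !orbF.
Qed.

Lemma primepi_pow J : (3 <= J)%N -> (J * primepi (2 ^ J) <= 4 * 2 ^ J)%N.
Proof.
elim: J => // J IH; rewrite ltnS leq_eqVlt => /orP[/eqP<-|h].
  by rewrite /primepi unlock.
have IHJ := IH h.
pose c := (\sum_((2 ^ J).+1 <= p < 2 * 2 ^ J | prime p) 1)%N.
have hc : (J * c <= 2 * 2 ^ J)%N.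
  have := @central_bin_primes (2 ^ J); rewrite expn_gt0 => /(_ isT).
  by rewrite -expnM leq_exp2l.
have np : prime (2 ^ J) = false.
  by case: J h {IH IHJ c hc} => [|[|J]] // _; rewrite !expnS mulnA; apply/negP => /primeP[_ /(_ 2)]; rewrite dvdn_mulr // => /(_ isT)/orP[|] //; have := expn_gt0 2 J; lia.
have e : primepi (2 ^ J.+1) = (primepi (2 ^ J) + c)%N.
  rewrite /primepi expnS (@big_cat_nat _ _ _ (2 ^ J)) //=; last by rewrite mul2n -addnn leq_addr.
  congr addn; rewrite big_ltn_cond ?np //.
  by rewrite mul2n -addnn -[X in (X < _)%N]addn0 ltn_add2l expn_gt0.
rewrite e expnS; nia.
Qed.

Lemma primepi_le e N : (0 < e)%N -> (2 ^ (8 * e) <= N)%N -> (e * primepi N <= N)%N.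
Proof.
move=> e0 hN.
have N0 : (0 < N)%N by apply: leq_trans hN; rewrite expn_gt0.
pose J := trunc_log 2 N.
have [J1 J2] : (2 ^ J <= N)%N /\ (N < 2 ^ J.+1)%N.
  by have /andP[] := @trunc_log_bounds 2 N isT N0.
have J3 : (8 * e <= J)%N by apply: trunc_log_max.
have h1 : (primepi N <= primepi (2 ^ J.+1))%N.
  rewrite /primepi [leqRHS](@big_cat_nat _ _ _ N) //=; last exact: ltnW.
  exact: leq_addr.
have h2 := @primepi_pow J.+1; rewrite expnS in h2.
have {}h2 : (J.+1 * primepi (2 ^ J.+1) <= 8 * 2 ^ J)%N by rewrite expnS; apply: leq_trans (h2 _) _; lia.
have h3 : (8 * e * primepi N <= 8 * N)%N.
  apply: (@leq_trans (J.+1 * primepi (2 ^ J.+1))); first by apply: leq_mul => //; lia.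
  by apply: leq_trans h2 _; rewrite leq_mul2l.
by rewrite -(leq_pmul2l (_ : 0 < 8)%N) // mulnA.
Qed.

Lemma primepi_eventually e : (0 < e)%N ->
  exists N0, forall N, (N0 <= N)%N -> (e * primepi N <= N)%N.
Proof. by move=> e0; exists (2 ^ (8 * e))%N => N hN; apply: primepi_le. Qed.

(** * Sieving values of quadratic polynomials *)

Definition quadval (a u v k x : nat) : nat := (a * (u * x + v) ^ 2 + k)%N.

(** Primes dividing [a], [u] or [k] are allowed provided they never divide a value; all others obey
    [count_quadratic]. *)
Definition sievable (a u v k : nat) : Prop := forall p x, prime p -> (7 <= p)%N ->
  (p %| quadval a u v k x)%N -> [&& ~~ (p %| a)%N, ~~ (p %| u)%N & ~~ (p %| k)%N].

Lemma odd_prime7 p : prime p -> (7 <= p)%N -> odd p.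
Proof. by move=> pp h; have [e|] := even_prime pp; [rewrite e in h|]. Qed.

Lemma count_sievable a u v k p e n : sievable a u v k -> prime p -> (7 <= p)%N -> (0 < e)%N ->
  (\sum_(x < n) (p ^ e %| quadval a u v k x))%:R <= 2 * (n%:R / (p ^ e)%:R + 1) :> rat.
Proof.
move=> hs pp p7 e0; have m0 : 0 < (p ^ e)%:R :> rat by rewrite ltr0n expn_gt0 prime_gt0.
have [/and3P[h1 h2 h3]|h] := boolP [&& ~~ (p %| a)%N, ~~ (p %| u)%N & ~~ (p %| k)%N].
  apply: (@le_trans _ _ (2 * (n %/ p ^ e + 1))%:R).
    by rewrite ler_nat; apply: count_quadratic => //; apply: odd_prime7.
  rewrite natrM natrD ler_pM2l // lerD2r ler_pdivlMr // -natrM ler_nat.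
  exact: leq_divM.
rewrite big1 ?mulr_ge0 ?addr_ge0 ?divr_ge0 ?ler0n // => x _.
case: (boolP (p ^ e %| _)%N) => // hd; case/negP: h; apply: (hs p x) => //.
by apply: dvdn_trans hd; rewrite dvdn_exp.
Qed.

Lemma sum_primes_le (N : nat) (c : rat) : 0 <= c ->
  \sum_(7 <= p < N | prime p) c <= c * (primepi N)%:R.
Proof.
move=> c0; rewrite /primepi natr_sum mulr_sumr.
have [h|h] := leqP N 7.
  by rewrite big_geq // sumr_ge0 // => i _; rewrite mulr1.
rewrite [leRHS](@big_cat_nat _ _ _ 7) //=; last exact: ltnW.
rewrite -[leLHS]add0r; apply: lerD; first by rewrite sumr_ge0 // => i _; rewrite mulr1.
by apply: ler_sum => i _; rewrite mulr1.
Qed.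

(** Each prime contributes at most 2n/p^2 + 2; the squares sum to at most 1/12. *)
Lemma sum_sqr_dvd a u v k n N : sievable a u v k ->
  (\sum_(x < n) \sum_(7 <= p < N | prime p) (p ^ 2 %| quadval a u v k x))%:R
    <= n%:R / 6 + 2 * (primepi N)%:R :> rat.
Proof.
move=> hs; rewrite exchange_big /= natr_sum.
apply: (@le_trans _ _ (\sum_(7 <= p < N | prime p) (2 * n%:R * (p%:R ^+ 2)^-1 + 2))).
  rewrite big_nat_cond [leRHS]big_nat_cond; apply: ler_sum => p /andP[/andP[p7 _] pp].
  by apply: le_trans (count_sievable _ hs pp p7 _) _ => //; rewrite natrX mulrDr mulr1 mulrA.
rewrite big_split /= -mulr_sumr; apply: lerD; last exact: sum_primes_le.
have := sum_inv_sqr_primes N; have : 0 <= n%:R :> rat by rewrite ler0n.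
by move: (\sum_(_ <= _ < _ | _) _) (n%:R) => S x x0 hS; nra.
Qed.

(** The weight 1/q turns the count 2n/q + 2 into 2n/q^2 + 2/q; the first part converges, the second
    is logarithmic. *)
Lemma sum_inv_dvd a u v k n N J : sievable a u v k -> (N <= 2 ^ J)%N ->
  \sum_(x < n) \sum_(7 <= q < N | prime q) (q %| quadval a u v k x)%:R / q%:R
    <= n%:R / 6 + 2 * J%:R :> rat.
Proof.
move=> hs hN; rewrite exchange_big /=.
apply: (@le_trans _ _ (\sum_(7 <= p < N | prime p) (2 * n%:R * (p%:R ^+ 2)^-1 + 2 * p%:R^-1))).
  rewrite big_nat_cond [leRHS]big_nat_cond; apply: ler_sum => p /andP[/andP[p7 _] pp].
  have p0 : 0 < p%:R :> rat by rewrite ltr0n prime_gt0.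
  rewrite -mulr_suml -natr_sum ler_pdivrMr //.
  have := @count_sievable a u v k p 1 n hs pp p7 isT; rewrite expn1 => /le_trans; apply.
  rewrite le_eqVlt; apply/orP; left; apply/eqP; field.
  by rewrite gt_eqF.
rewrite big_split /= -!mulr_sumr; apply: lerD; last by rewrite ler_pM2l // sum_inv_le_log.
have := sum_inv_sqr_primes N; have : 0 <= n%:R :> rat by rewrite ler0n.
by move: (\sum_(_ <= _ < _ | _) _) (n%:R) => S x x0 hS; nra.
Qed.

Lemma prime_lt7 p : prime p -> (p < 7)%N -> [\/ p = 2, p = 3 | p = 5].
Proof. by case: p => [|[|[|[|[|[|[|p]]]]]]] // _ _; constructor. Qed.

Lemma sqfree_sieve a N : (0 < a < N ^ 2)%N -> ~~ (4 %| a)%N -> ~~ (9 %| a)%N -> ~~ (25 %| a)%N ->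
  (\sum_(7 <= p < N | prime p) (p ^ 2 %| a) = 0)%N -> sqfree a.
Proof.
move=> /andP[a0 aN] h4 h9 h25 h p pp; apply/negP => hd.
have [p7|p7] := leqP 7 p; last by case: (prime_lt7 pp p7) hd => ->; apply/negP.
have pN : (p < N)%N.
  by rewrite -(@ltn_exp2r _ _ 2) // (leq_ltn_trans _ aN) // dvdn_leq.
move/eqP: h; rewrite sum_nat_seq_eq0 => /allP /(_ p).
by rewrite mem_index_iota p7 pN pp hd /= => /(_ isT).
Qed.

Lemma coprime_primes a d : (0 < a)%N ->
  (forall p, prime p -> (p %| a)%N -> (p %| d)%N -> False) -> coprime a d.
Proof.
move=> a0 h; apply/negPn/negP => hg.
have g0 : (0 < gcdn a d)%N by rewrite gcdn_gt0 a0.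
have pp : prime (pdiv (gcdn a d)) by rewrite pdiv_prime // ltn_neqAle eq_sym hg.
have := pdiv_dvd (gcdn a d); rewrite dvdn_gcd => /andP[].
exact: h.
Qed.

Lemma coprime_sieve a d N : (0 < a < N)%N -> ~~ (2 %| a)%N -> ~~ (3 %| a)%N -> ~~ (5 %| a)%N ->
  (\sum_(7 <= q < N | prime q) ((q %| a) * (q %| d)) = 0)%N -> coprime a d.
Proof.
move=> /andP[a0 aN] h2 h3 h5 h; apply: coprime_primes => // p pp pa pd.
have [p7|p7] := leqP 7 p.
  have pN : (p < N)%N by rewrite (leq_ltn_trans _ aN) // dvdn_leq.
  move/eqP: h; rewrite sum_nat_seq_eq0 => /allP /(_ p).
  by rewrite mem_index_iota p7 pN pp pa pd /= => /(_ isT).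
by case: (prime_lt7 pp p7) pa => ->; apply/negP.
Qed.

Lemma admissible_ineq (C A B y k : nat) : (A <= k * B + C * y)%N -> (k * (B + 1) <= A + C * y)%N ->
  ((A - C * y) ^ 2 <= k ^ 2 * (B ^ 2 + 1) <= (A + C * y) ^ 2)%N.
Proof.
move=> h1 h2; apply/andP; split.
  apply: (@leq_trans ((k * B) ^ 2)); first by rewrite leq_exp2r // leq_subLR addnC.
  by rewrite expnMn leq_mul2l leq_addr orbT.
apply: (@leq_trans ((k * (B + 1)) ^ 2)); last by rewrite leq_exp2r.
by rewrite expnMn leq_mul2l sqrnD; apply/orP; right; lia.
Qed.

Lemma sum_nat_lt_exists n (F : nat -> nat) :
  (\sum_(x < n) F x < n)%N -> exists2 x, (x < n)%N & F x = 0%N.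
Proof.
move=> h; have [/existsP[x /eqP hx]|] := boolP [exists x : 'I_n, F x == 0%N].
  by exists x.
rewrite negb_exists => /forallP hF; exfalso; move: h; rewrite ltnNge => /negP; apply.
rewrite -[X in (X <= _)%N]card_ord -sum1_card; apply: leq_sum => x _.
by rewrite lt0n.
Qed.

Lemma prime7_ndvd p a : prime p -> (7 <= p)%N -> (0 < a)%N ->
  all (fun q => q < 7)%N (primes a) -> ~~ (p %| a)%N.
Proof.
move=> pp p7 a0 /allP h; apply/negP => hd.
by have := h p; rewrite mem_primes pp a0 hd ltnNge p7 => /(_ isT).
Qed.

Lemma sievable_D v : sievable 1 30 v 1.
Proof.
move=> p x pp p7 _; have p1 : ~~ (p %| 1)%N by rewrite dvdn1 neq_ltn (leq_trans _ p7) ?orbT.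
by rewrite p1 andbT /=; apply: prime7_ndvd.
Qed.

Lemma critical_mod w : let A := (2 * (30 * w + 1) ^ 2 + (2 * (30 * w + 1) + 3))%N in
  [/\ ~~ (2 %| A)%N, ~~ (3 %| A)%N & ~~ (5 %| A)%N].
Proof. by rewrite /= -mulnn; split; lia. Qed.

Lemma D_mod w : let D := ((30 * w + 1) ^ 2 + 1)%N in
  [/\ ~~ (4 %| D)%N, ~~ (3 %| D)%N & ~~ (5 %| D)%N].
Proof. by rewrite /= -mulnn; split; lia. Qed.

Lemma sqr_ndvd d a : ~~ (d %| a)%N -> ~~ (d * d %| a)%N.
Proof. by apply: contra; apply: dvdn_trans; apply: dvdn_mulr. Qed.

Lemma sqfree_D w N : ((30 * w + 1) ^ 2 + 1 < N ^ 2)%N ->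
  (\sum_(7 <= p < N | prime p) (p ^ 2 %| (30 * w + 1) ^ 2 + 1) = 0)%N -> sqfree ((30 * w + 1) ^ 2 + 1).
Proof.
move=> hN h; have [h4 h3 h5] := D_mod w.
apply: (@sqfree_sieve _ N) => //; first by rewrite hN addn1.
- exact: (sqr_ndvd h3).
- exact: (sqr_ndvd h5).
Qed.

Lemma sqfree_A a N : (0 < a < N ^ 2)%N -> ~~ (2 %| a)%N -> ~~ (3 %| a)%N -> ~~ (5 %| a)%N ->
  (\sum_(7 <= p < N | prime p) (p ^ 2 %| a) = 0)%N -> sqfree a.
Proof.
move=> hN h2 h3 h5; apply: sqfree_sieve => //.
- exact: (sqr_ndvd h2).
- exact: (sqr_ndvd h3).
- exact: (sqr_ndvd h5).
Qed.

Lemma sum_dvd_mul N c a : (\sum_(7 <= p < N | prime p) (p ^ 2 %| c * a) = 0)%N ->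
  (\sum_(7 <= p < N | prime p) (p ^ 2 %| a) = 0)%N.
Proof.
move=> h; apply/eqP; rewrite -leqn0; apply: leq_trans (eq_leq h); apply: leq_sum => p _.
by case: (boolP (p ^ 2 %| a)%N) => // hd; rewrite dvdn_mull.
Qed.

(** A common divisor divides 2B + 1, and (2B + 1)^2 + 5 = 4 (B^2 + 1) + 2 (2B + 1). *)
Lemma critical_gcd p B : (p %| 2 * B ^ 2 + (2 * B + 3))%N -> (p %| B ^ 2 + 1)%N -> (p %| 5)%N.
Proof.
move=> pA pD.
have h1 : (p %| 2 * B + 1)%N.
  rewrite -(@dvdn_addr (2 * (B ^ 2 + 1))) ?dvdn_mull //.
  by have -> : (2 * (B ^ 2 + 1) + (2 * B + 1) = 2 * B ^ 2 + (2 * B + 3))%N by lia.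
rewrite -(@dvdn_addr ((2 * B + 1) * (2 * B + 1))) ?dvdn_mull //.
have -> : ((2 * B + 1) * (2 * B + 1) + 5 = 4 * (B ^ 2 + 1) + 2 * (2 * B + 1))%N by rewrite -mulnn; lia.
by rewrite dvdn_add // dvdn_mull.
Qed.

(** * The regime n = 2m *)

(** With y = B and k = 2B + 3, kB differs from A by B - 3, so closeness is automatic. Only
    squarefreeness of two quadratics in one variable is sieved; coprimality follows from
    [critical_gcd]. *)
Lemma parameters_critical (m : nat) : (0 < m)%N -> exists2 C : nat, (0 < C)%N & forall T0 : nat,
  exists T A B y k : nat, [/\ (T0 <= T)%N, (0 < T)%N, admissible C A B y k,
    (T ^ m <= C * B)%N /\ (B <= C * T ^ m)%N &
    (T ^ (2 * m) <= C * A)%N /\ (A <= C * T ^ (2 * m))%N].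
Proof.
have [C hC] : exists C, (100 * 100 <= C)%N by eexists; exact: leqnn.
(* The two sieves lose at most X/3 + 4 pi(100 X); the factor 1600 bounds the second term by X/4. *)
have [N0 hN0] := @primepi_eventually 1600 isT.
move=> m0; exists C => [|T0]; first by lia.
have [T [T0T N0T T1]] : exists T, [/\ (T0 <= T)%N, (N0 <= T)%N & (0 < T)%N].
  by exists (T0 + N0 + 1)%N; split; lia.
have [X [eX TX]] : exists X, X = (T ^ m)%N /\ (T <= X)%N.
  by exists (T ^ m)%N; split=> //; rewrite -{1}(expn1 T) leq_pexp2l.
have X1 : (0 < X)%N by apply: leq_trans TX.
have [N eN] : exists N, N = (100 * X)%N by eexists.
have hpi : (1600 * primepi N <= N)%N by apply: hN0; lia.
have s1 := @sievable_D (30 * X + 1)%N.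
(* This polynomial is (2B + 1)^2 + 5 = 2A, which avoids the linear term of A. *)
have s2 : sievable 1 60 (60 * X + 3) 5.
  move=> p x pp p7 _; have p1 : ~~ (p %| 1)%N by rewrite dvdn1 neq_ltn (leq_trans _ p7) ?orbT.
  by rewrite p1 /=; apply/andP; split; apply: prime7_ndvd.
have [] := @sum_nat_lt_exists X (fun x =>
    (\sum_(7 <= p < N | prime p) (p ^ 2 %| quadval 1 30 (30 * X + 1) 1 x)) +
    (\sum_(7 <= p < N | prime p) (p ^ 2 %| quadval 1 60 (60 * X + 3) 5 x)))%N.
  rewrite big_split /= -(ltr_nat rat) natrD.
  have h1 := sum_sqr_dvd X N s1; have h2 := sum_sqr_dvd X N s2.
  apply: le_lt_trans (lerD h1 h2) _.
  have X1' : 0 < X%:R :> rat by rewrite ltr0n.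
  have : (1600 * primepi N)%:R <= N%:R :> rat by rewrite ler_nat.
  rewrite eN !natrM; lra.
move=> x hx /eqP; rewrite addn_eq0 => /andP[/eqP z1 /eqP z2].
clear hpi s1 s2 hN0 N0T N0 m0.
have [w ew] : exists w, w = (X + x)%N by eexists.
have [B eB] : exists B, B = (30 * w + 1)%N by eexists.
have e1 : quadval 1 30 (30 * X + 1) 1 x = (B ^ 2 + 1)%N by rewrite /quadval mul1n eB ew; congr (_ ^ 2 + 1)%N; lia.
pose A := (2 * B ^ 2 + (2 * B + 3))%N.
have e2 : quadval 1 60 (60 * X + 3) 5 x = (2 * A)%N.
  by rewrite /quadval mul1n /A eB ew -!mulnn; lia.
rewrite e1 in z1; rewrite {}e2 in z2; move/sum_dvd_mul: z2 => z2.
have [A2 A3 A5] : [/\ ~~ (2 %| A)%N, ~~ (3 %| A)%N & ~~ (5 %| A)%N].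
  by rewrite /A eB; apply: critical_mod.
have wX : (w < 2 * X)%N by rewrite ew; lia.
have wX' : (X <= w)%N by rewrite ew; lia.
have AN : (A < N ^ 2)%N by rewrite /A eB eN -!mulnn; nia.
have DN : (B ^ 2 + 1 < N ^ 2)%N by rewrite eB eN -!mulnn; nia.
have A0 : (0 < A)%N by rewrite /A; lia.
exists T, A, B, B, (2 * B + 3)%N; split=> //.
- split; split=> //.
  + by move: A2; rewrite dvdn2 negbK.
  + by rewrite eB; lia.
  + by apply: (@sqfree_A _ N) => //; rewrite A0.
  + by rewrite eB in z1 DN *; apply: sqfree_D DN z1.
  + apply: coprime_primes => // p pp pA pD.
    have p5 := critical_gcd pA pD.
    by move: p5; rewrite dvdn_prime2 // => /eqP e; rewrite e (negPf A5) in pA.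
  + by rewrite eB; lia.
  + by apply: admissible_ineq; rewrite /A -?mulnn; nia.
- by rewrite -eX eB; split; nia.
- rewrite mulnC expnM -eX /A eB -!mulnn; split; nia.
Qed.

(** * Sieving in several variables *)

Lemma sum_lt_exists n c (G : nat -> nat) :
  (\sum_(x < n) G x < n * c)%N -> exists2 x, (x < n)%N & (G x < c)%N.
Proof.
move=> h; have [/existsP[x hx]|] := boolP [exists x : 'I_n, (G x < c)%N].
  by exists x.
rewrite negb_exists => /forallP hF; exfalso; move: h; rewrite ltnNge => /negP; apply.
rewrite -[X in (X * _)%N]card_ord -sum_nat_const; apply: leq_sum => x _.
by rewrite leqNgt.
Qed.

Lemma disjoint_sum (b0 : nat -> nat) (len Y : nat) (g : nat -> nat) :
  (forall x, (b0 x + len <= b0 x.+1)%N) ->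
  (\sum_(x < Y) \sum_(i < len) g (b0 x + i) <= \sum_(i < b0 Y - b0 0) g (b0 0 + i))%N.
Proof.
move=> h.
have mono x : (b0 0 <= b0 x)%N.
  by elim: x => // x IH; apply: leq_trans IH _; apply: leq_trans (h x); apply: leq_addr.
elim: Y => [|Y IH]; first by rewrite big_ord0.
rewrite big_ord_recr /=; apply: leq_trans (leq_add IH (leqnn _)) _.
have -> : (b0 Y.+1 - b0 0 = (b0 Y - b0 0) + (len + (b0 Y.+1 - (b0 Y + len))))%N.
  by have := h Y; have := mono Y; lia.
rewrite !big_split_ord /= leq_add2l.
apply: leq_trans (leq_addr _ _); apply: eq_leq; apply: eq_bigr => i _.
by congr g; have := mono Y; lia.
Qed.

(** For fixed x only the primes dividing [f x] matter, at most [J] of them, and each spoils at most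
    2(len/q + 1) indices i; the main term is the weighted sum over x in the first hypothesis. *)
Lemma sum_gcd (f : nat -> nat) (v : nat -> nat -> nat) n len N J :
  \sum_(x < n) \sum_(7 <= q < N | prime q) (q %| f x)%:R / q%:R <= n%:R / 6 + 2 * J%:R :> rat ->
  (forall x, (x < n)%N -> (0 < f x < 2 ^ J)%N) ->
  (forall x q, (x < n)%N -> prime q -> (7 <= q)%N ->
     (\sum_(i < len) (q %| v x i))%:R <= 2 * (len%:R / q%:R + 1) :> rat) ->
  (\sum_(x < n) \sum_(i < len) \sum_(7 <= q < N | prime q) ((q %| f x) * (q %| v x i)))%:R
    <= len%:R * n%:R / 3 + 4 * len%:R * J%:R + 2 * n%:R * J%:R :> rat.
Proof.
move=> h1 hJ hv.
apply: (@le_trans _ _ (\sum_(x < n) (2 * len%:R * (\sum_(7 <= q < N | prime q) (q %| f x)%:R / q%:R) + 2 * J%:R))).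
  rewrite natr_sum; apply: ler_sum => x _; rewrite exchange_big /= natr_sum.
  apply: (@le_trans _ _ (\sum_(7 <= q < N | prime q) ((q %| f x)%:R * (2 * (len%:R / q%:R + 1))))).
    rewrite big_nat_cond [leRHS]big_nat_cond; apply: ler_sum => q /andP[/andP[q7 _] pq].
    by rewrite -big_distrr /= natrM ler_wpM2l ?ler0n // hv.
  have : (\sum_(7 <= q < N | prime q) (q %| f x))%:R <= J%:R :> rat.
    by rewrite ler_nat; apply: sum_prime_divisors; apply: hJ.
  rewrite natr_sum => hs.
  have -> : \sum_(7 <= q < N | prime q) ((q %| f x)%:R * (2 * (len%:R / q%:R + 1))) =
     2 * len%:R * (\sum_(7 <= q < N | prime q) (q %| f x)%:R / q%:R) + 2 * \sum_(7 <= q < N | prime q) (q %| f x)%:R :> rat.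
    rewrite !mulr_sumr -big_split /=; apply: eq_bigr => q _; ring.
  by rewrite lerD2l ler_pM2l.
rewrite big_split /= -mulr_sumr sumr_const card_ord -mulr_natl.
have l0 : 0 <= len%:R :> rat by rewrite ler0n.
apply: le_trans (lerD (ler_wpM2l _ h1) (lexx _)) _; first by rewrite mulr_ge0.
by rewrite le_eqVlt; apply/orP; left; apply/eqP; field.
Qed.

(** * The regime n < 2m *)

Lemma pow31_mod s : exists w, (31 ^ s = 30 * w + 1)%N.
Proof.
elim: s => [|s [w IH]]; first by exists 0%N.
by exists (31 * w + 1)%N; rewrite expnS IH; lia.
Qed.

(** Among primes from 7 on, only 31 divides 930 or 31^s. Since v is -1 modulo 31, the values are 2
    modulo 31, or 3 when s = 0, so 31 never divides them. *)
Lemma sievable_A v s : (v = 30 %[mod 31])%N -> sievable 2 930 v (31 ^ s).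
Proof.
move=> hv p x pp p7 hd.
have n31 : p != 31.
  have [c ec] : exists c, v = (31 * c + 30)%N.
    by exists (v %/ 31)%N; rewrite {1}(divn_eq v 31) hv mulnC.
  apply: contraTneq hd => ->; rewrite /quadval ec.
  have -> : (930 * x + (31 * c + 30) = 31 * (30 * x + c) + 30)%N by clear; lia.
  move: (30 * x + c)%N => z; rewrite -mulnn; case: s => [|s]; first by clear; lia.
  by rewrite expnS; move: (31 ^ s)%N => t; clear; lia.
have p2 : ~~ (p %| 2)%N by apply: prime7_ndvd.
have p30 : ~~ (p %| 30)%N by apply: prime7_ndvd.
have p31 : ~~ (p %| 31)%N by rewrite dvdn_prime2.
rewrite p2 -[930%N]/(30 * 31)%N Euclid_dvdM // (negPf p30) p31 /=.
by rewrite (Euclid_dvdX _ _ pp) (negPf p31).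
Qed.

Lemma small_range_cast (u r y : nat) :
  u%:R <= (180 * 961 * (r * y) + 3720 * r + 1)%N%:R :> rat ->
  u%:R <= 180 * 961 * (r%:R * y%:R) + 3720 * r%:R + 1 :> rat.
Proof. by move=> h; lra. Qed.

(** As shares of all pairs, the main terms are 1/4 for squares in D, 1/6 for squares in A and 1/3
    for common primes; the remaining quarter absorbs the errors. *)
Lemma small_arith (r y j P1 P2 : rat) : 1 <= r -> 1000 <= y ->
  1000 * 1000 * P1 <= 10 * (1000 * 1000) * (r * y) -> 1000 * 1000 * P2 <= 3000 * y ->
  461 * j <= y -> 461 * j <= r ->
  (180 * 961 * (r * y) + 3720 * r + 1) / 6 + 2 * P1 + 120 * 961 * r * (y / 6 + 2 * P2) +
  (120 * 961 * r * y / 3 + 4 * (120 * 961 * r) * j + 2 * y * j) < y * (120 * 961 * r).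
Proof.
move=> r1 y0 p1 p2 p3 p4; have r0 : 0 < r by lra.
have y1 : 0 <= y by lra.
have q2 := ler_wpM2l (ltW r0) p2; have q3 := ler_wpM2l (ltW r0) p3.
have q4 := ler_wpM2l y1 p4; have q5 := ler_wpM2l (ltW r0) y0.
by lra.
Qed.

Lemma quadval_D b i : quadval 1 30 (30 * b + 1) 1 i = ((30 * (b + i) + 1) ^ 2 + 1)%N.
Proof. by rewrite /quadval mul1n mulnDr [(30 * b + 30 * i)%N]addnC addnA. Qed.

Lemma small_cast1 (P N r y : nat) : (1000 * 1000 * P <= N)%N -> N = (10 * (1000 * 1000) * (r * y))%N ->
  1000 * 1000 * P%:R <= 10 * (1000 * 1000) * (r%:R * y%:R) :> rat.
Proof.
move=> h e; have {h} : (1000 * 1000 * P)%N%:R <= N%:R :> rat by rewrite ler_nat.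
by rewrite e => h; lra.
Qed.

Lemma small_cast2 (P N y : nat) : (1000 * 1000 * P <= N)%N -> N = (3000 * y)%N ->
  1000 * 1000 * P%:R <= 3000 * y%:R :> rat.
Proof.
move=> h e; have {h} : (1000 * 1000 * P)%N%:R <= N%:R :> rat by rewrite ler_nat.
by rewrite e => h; lra.
Qed.

Lemma cast461 (j y : nat) : (461 * j <= y)%N -> 461 * j%:R <= y%:R :> rat.
Proof.
move=> h; have {h} : (461 * j)%N%:R <= y%:R :> rat by rewrite ler_nat.
by move=> h; lra.
Qed.

Lemma small_cast_len (len r : nat) : len = (120 * 961 * r)%N -> len%:R = 120 * 961 * r%:R :> rat.
Proof. by move=> ->; lra. Qed.

Section Small.
Variables (Y k R J s N1 N2 len : nat).
Hypotheses (kE : k = (31 ^ s)%N) (YE : Y = (k * R)%N) (R0 : (0 < R)%N).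
Hypotheses (N1E : N1 = (10 * (1000 * 1000) * (R * Y))%N) (N2E : N2 = (3000 * Y)%N).
Hypothesis lenE : len = (120 * 961 * R)%N.
Hypotheses (hpi1 : (1000 * 1000 * primepi N1 <= N1)%N) (hpi2 : (1000 * 1000 * primepi N2 <= N2)%N).
Hypotheses (hJ : (N2 ^ 2 <= 2 ^ J)%N) (JY : (461 * J <= Y)%N) (JR : (461 * J <= R)%N) (Y1 : (1000 <= Y)%N).

Let f := quadval 2 930 (930 * Y + 30) k.
Let b0 x := (f x %/ (30 * k))%N.

Let k0 : (0 < k)%N. Proof. by rewrite kE expn_gt0. Qed.
Let kY : (k <= Y)%N. Proof. by rewrite YE leq_pmulr. Qed.

(** Windows of B for consecutive x are disjoint, so squares in D can be sieved over one long
    interval; a single window is too short compared with the primes to be tested. *)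
Lemma b0_step x : (b0 x + len <= b0 x.+1)%N.
Proof.
have h0 : (0 < 30 * k)%N by rewrite muln_gt0.
rewrite /b0 addnC -divnMDl // leq_div2r //.
(* This choice of [len] matches the growth of f: consecutive values differ by at least 4 times 930^2
   Y = 3600 times 961 Y. *)
rewrite lenE /f /quadval; have -> : (120 * 961 * R * (30 * k) = 3600 * 961 * Y)%N by rewrite YE; clear; lia.
rewrite -!mulnn; clear; nia.
Qed.

Lemma b0_range : (b0 Y - b0 0 <= 180 * 961 * (R * Y) + 3720 * R + 1)%N.
Proof.
have h0 : (0 < 30 * k)%N by rewrite muln_gt0.
have h1 : (b0 Y * (30 * k) <= f Y)%N by apply: leq_divM.
have h2 : (f 0 < (b0 0 + 1) * (30 * k))%N by rewrite addn1; apply: ltn_ceil.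
have e : (f Y = f 0 + 30 * k * (180 * 961 * (R * Y) + 3720 * R))%N.
  rewrite /f /quadval -!mulnn muln0 add0n.
  have e1 : (30 * k * (180 * 961 * (R * Y) + 3720 * R) = 54 * 100 * 961 * (Y * Y) + 120 * 930 * Y)%N by rewrite YE; clear; lia.
  by rewrite e1; clear; lia.
rewrite leq_subLR -ltnS -(ltn_pmul2r h0); apply: leq_ltn_trans h1 _; rewrite e.
move: h2; move: (b0 0) (f 0) (180 * 961 * (R * Y) + 3720 * R)%N => u v w; clear; nia.
Qed.

Lemma f_bounds x : (x <= Y)%N -> (f x < N2 ^ 2)%N /\ (60 * 961 * (30 * k) * (R * Y) <= f x)%N.
Proof.
move=> hx; have e1 : (60 * 961 * (30 * k) * (R * Y) = 1800 * 961 * (Y * Y))%N by rewrite YE; clear; lia.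
by rewrite e1 /f /quadval N2E -!mulnn; clear -hx Y1 kY; split; nia.
Qed.

Lemma small_exists : exists x i : nat, [/\ (x < Y)%N, (i < len)%N,
  (\sum_(7 <= p < N1 | prime p) (p ^ 2 %| (30 * (b0 x + i) + 1) ^ 2 + 1) = 0)%N,
  (\sum_(7 <= p < N2 | prime p) (p ^ 2 %| f x) = 0)%N &
  (\sum_(7 <= q < N2 ^ 2 | prime q) ((q %| f x) * (q %| (30 * (b0 x + i) + 1) ^ 2 + 1)) = 0)%N].
Proof.
pose g b := (\sum_(7 <= p < N1 | prime p) (p ^ 2 %| (30 * b + 1) ^ 2 + 1))%N.
pose F1 x i := g (b0 x + i)%N.
pose F2 x := (\sum_(7 <= p < N2 | prime p) (p ^ 2 %| f x))%N.
pose F3 x i := (\sum_(7 <= q < N2 ^ 2 | prime q) ((q %| f x) * (q %| (30 * (b0 x + i) + 1) ^ 2 + 1)))%N.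
have sf : sievable 2 930 (930 * Y + 30) k.
  rewrite kE; apply: sievable_A; rewrite (_ : 930 * Y = 31 * (30 * Y))%N; last by lia.
  by rewrite -modnDml modnMr.
suff [x hx hF] : exists2 x, (x < Y)%N & (\sum_(i < len) (F1 x i + F2 x + F3 x i) < len)%N.
  have [i hi /eqP] := @sum_nat_lt_exists len (fun i => F1 x i + F2 x + F3 x i)%N hF.
  by rewrite !addn_eq0 => /andP[/andP[/eqP ? /eqP ?] /eqP ?]; exists x, i.
apply: (@sum_lt_exists Y len (fun x => \sum_(i < len) (F1 x i + F2 x + F3 x i))%N).
have -> : (\sum_(x < Y) \sum_(i < len) (F1 x i + F2 x + F3 x i) =
   \sum_(x < Y) \sum_(i < len) F1 x i + len * \sum_(x < Y) F2 x + \sum_(x < Y) \sum_(i < len) F3 x i)%N.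
  rewrite big_distrr /= -!big_split /=; apply: eq_bigr => x _.
  by rewrite !big_split /= sum_nat_const card_ord.
rewrite -(ltr_nat rat) !natrD !natrM.
have h1 : (\sum_(x < Y) \sum_(i < len) F1 x i)%:R <= (180 * 961 * (R%:R * Y%:R) + 3720 * R%:R + 1) / 6 + 2 * (primepi N1)%:R :> rat.
  apply: (@le_trans _ _ ((b0 Y - b0 0)%:R / 6 + 2 * (primepi N1)%:R)); last first.
    have : (b0 Y - b0 0)%:R <= 180 * 961 * (R%:R * Y%:R) + 3720 * R%:R + 1 :> rat.
      have h : (b0 Y - b0 0)%:R <= (180 * 961 * (R * Y) + 3720 * R + 1)%N%:R :> rat by rewrite ler_nat; exact: b0_range.
      exact: small_range_cast h.
    by move=> h; rewrite lerD2r ler_pM2r // invr_gt0.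
  apply: le_trans (sum_sqr_dvd (b0 Y - b0 0) N1 (@sievable_D (30 * b0 0 + 1)%N)).
  rewrite ler_nat; apply: leq_trans (disjoint_sum Y g b0_step) _.
  apply: eq_leq; apply: eq_bigr => i _; apply: eq_bigr => p _.
  by rewrite quadval_D.
have h2 := sum_sqr_dvd Y N2 sf.
have h3 : (\sum_(x < Y) \sum_(i < len) F3 x i)%:R <= len%:R * Y%:R / 3 + 4 * len%:R * J%:R + 2 * Y%:R * J%:R :> rat.
  apply: (@sum_gcd f (fun x i => (30 * (b0 x + i) + 1) ^ 2 + 1)%N).
  - exact: sum_inv_dvd.
  - move=> x hx; have [hf1 hf2] := f_bounds (ltnW hx); rewrite (leq_trans hf1 hJ) andbT.
    by rewrite /f /quadval addn_gt0 k0 orbT.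
  - move=> x q hx pq q7; have := @count_sievable 1 30 (30 * b0 x + 1) 1 q 1 len (@sievable_D _) pq q7 isT.
    by rewrite expn1; under eq_bigr => i _ do rewrite quadval_D.
have r0 : 1 <= R%:R :> rat by rewrite ler1n.
have y0 : 1000 <= Y%:R :> rat by rewrite ler_nat.
have l0 : 0 <= len%:R :> rat by rewrite ler0n.
apply: le_lt_trans (lerD (lerD h1 (ler_wpM2l l0 h2)) h3) _.
rewrite (small_cast_len lenE).
exact (small_arith r0 y0 (small_cast1 hpi1 N1E) (small_cast2 hpi2 N2E) (cast461 JY) (cast461 JR)).
Qed.

Lemma small_admissible C : (1000 * 1000 * 10 <= C)%N -> exists A B y : nat,
  [/\ admissible C A B y k, (R * Y <= B)%N, (B <= C * (R * Y))%N, (Y ^ 2 <= A)%N & (A <= C * Y ^ 2)%N].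
Proof.
move=> hC; have [x [i [hx hi z1 z2 z3]]] := small_exists.
have [f1 f2] := f_bounds (ltnW hx).
have h0 : (0 < 30 * k)%N by rewrite muln_gt0.
have b1 : (b0 x * (30 * k) <= f x)%N by apply: leq_divM.
have b2 : (f x < (b0 x + 1) * (30 * k))%N by rewrite addn1; apply: ltn_ceil.
have b3 : (60 * 961 * (R * Y) <= b0 x)%N.
  by rewrite /b0 leq_divRL // mulnAC.
have fE : f x = (2 * (930 * x + (930 * Y + 30)) ^ 2 + k)%N by [].
have kR : (k * len = 120 * 961 * Y)%N by rewrite lenE YE; clear; lia.
have RY1 : (1000 <= R * Y)%N by apply: leq_trans Y1 _; rewrite leq_pmull.
have YY : (k * (R * Y) = Y * Y)%N by rewrite mulnA -YE.
have N2S : (N2 ^ 2 = 9 * (1000 * 1000) * (Y * Y))%N by rewrite N2E -mulnn; clear; lia.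
set B := (30 * (b0 x + i) + 1)%N in z1 z3 *.
have BE : B = (30 * (b0 x + i) + 1)%N by [].
have bb : (b0 x <= 300 * 1000 * (R * Y))%N.
  rewrite -(leq_pmul2r h0); apply: leq_trans b1 _.
  have -> : (300 * 1000 * (R * Y) * (30 * k) = 9 * (1000 * 1000) * (k * (R * Y)))%N by clear; lia.
  by rewrite YY -N2S ltnW.
have lY : (len <= 116 * (R * Y))%N.
  by rewrite lenE; clear -Y1 R0; nia.
have Bu : (B < 10 * (1000 * 1000) * (R * Y))%N.
  by rewrite BE; move: bb lY hi RY1; move: (b0 x) (len) (R * Y)%N; clear; lia.
have yY : (Y <= 930 * x + (930 * Y + 30))%N by clear; lia.
exists (f x), B, (930 * x + (930 * Y + 30))%N; split.
(* Here y is 0 and k is 1 modulo 30, so A is 1 modulo 30. *)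
- have [w ew] := pow31_mod s; rewrite -kE in ew.
  have [f2' f3' f5'] : [/\ ~~ (2 %| f x)%N, ~~ (3 %| f x)%N & ~~ (5 %| f x)%N].
    rewrite fE ew (_ : 930 * x + (930 * Y + 30) = 30 * (31 * x + 31 * Y + 1))%N; last by clear; lia.
    by move: (31 * x + 31 * Y + 1)%N => u; rewrite -mulnn; clear; split; lia.
  have fx0 : (0 < f x)%N by rewrite fE addn_gt0 k0 orbT.
  split; split=> //.
  + by move: f2'; rewrite dvdn2 negbK.
  + by rewrite BE oddD oddM.
  + by apply: (@sqfree_A _ N2) => //; rewrite fx0.
  + apply: (@sqfree_D _ N1) => //; rewrite -BE N1E; move: Bu.
    by move: (10 * (1000 * 1000) * (R * Y))%N; clear => n h; rewrite -!mulnn; nia.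
  + by apply: (@coprime_sieve _ _ (N2 ^ 2)) => //; rewrite fx0.
  + by clear -yY Y1; lia.
  (* [b0 x] is the integer part of A/(30k), so kB - A is O(k len + k), which is O(Y) since k R =
     Y. *)
  + apply: admissible_ineq; rewrite BE.
      apply: (@leq_trans (k * (30 * (b0 x + i) + 1) + 30 * k)).
        by move: b2; move: (f x) (b0 x); clear; nia.
      by rewrite leq_add2l leq_mul //; [clear -hC; lia | apply: leq_trans kY _].
    apply: (@leq_trans (f x + (30 * (k * len) + 2 * k))).
      by move: b1 hi; move: (f x) (b0 x) (len); clear; nia.
    rewrite kR leq_add2l; apply: (@leq_trans (1000 * 1000 * 10 * Y)); last exact: leq_mul.
    by clear -kY; lia.
- by rewrite BE; move: b3; move: (b0 x) (R * Y)%N; clear; lia.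
- by apply: leq_trans (ltnW Bu) _; rewrite leq_mul2r; apply/orP; right; clear -hC; lia.
- by rewrite fE -!mulnn; clear -yY; nia.
- by apply: leq_trans (ltnW f1) _; rewrite N2S -mulnn leq_mul2r; apply/orP; right; clear -hC; lia.
Qed.
End Small.

Lemma parameters_small (m n : nat) : (0 < m)%N -> (m <= n)%N -> (n < 2 * m)%N ->
  exists2 C : nat, (0 < C)%N & forall T0 : nat,
  exists T A B y k : nat, [/\ (T0 <= T)%N, (0 < T)%N, admissible C A B y k,
    (T ^ m <= C * B)%N /\ (B <= C * T ^ m)%N & (T ^ n <= C * A)%N /\ (A <= C * T ^ n)%N].
Proof.
have [C hC] : exists C, (1000 * 1000 * 10 <= C)%N by eexists; exact: leqnn.
have e0 : (0 < 1000 * 1000)%N by rewrite muln_gt0.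
have [N0 hN0] := primepi_eventually e0.
have C0 : (0 < C)%N by apply: leq_trans hC; rewrite !muln_gt0.
move=> m0 mn n2; exists C => // T0.
pose c := (461 * (24 + 10 * n))%N.
have [j jE] : exists j, j = (T0 + N0 + c + 1000)%N by eexists.
have j2 : (j < 2 ^ j)%N by apply: ltn_expl.
(* With t a power of 31, k = t^(2(n - m)) is one too. Also t >= 4^j, so t dominates [J], which is
   linear in j. *)
have [t tE] : exists t, t = (31 ^ j)%N by eexists.
have t4 : (2 ^ j * 2 ^ j <= t)%N by rewrite tE -expnMn leq_exp2r //; lia.
have jt : (j <= t)%N by apply: leq_trans t4; nia.
have t0 : (0 < t)%N by lia.
pose J := (2 * (12 + 5 * (j * n)))%N.
have Jt : (461 * J <= t)%N.
  apply: leq_trans t4; apply: (@leq_trans (j * j)); last by apply: leq_mul; apply: ltnW.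
  apply: (@leq_trans (c * j)); last by rewrite leq_mul2r; apply/orP; right; rewrite jE; clear; lia.
  by rewrite /c /J; clear -jE; nia.
have tp d : (0 < d)%N -> (t <= t ^ d)%N by move=> d0; rewrite -{1}(expn1 t) leq_pexp2l.
have n0 : (0 < n)%N by apply: leq_trans mn.
have [Y YE] : exists Y, Y = (t ^ n)%N by eexists.
have [R RE] : exists R, R = (t ^ (2 * m - n))%N by eexists.
have [k kE] : exists k, k = (31 ^ (j * (2 * (n - m))))%N by eexists.
have kE' : k = (t ^ (2 * (n - m)))%N by rewrite kE tE -expnM.
have YkR : Y = (k * R)%N by rewrite YE kE' RE -expnD; congr expn; lia.
have tY : (t <= Y)%N by rewrite YE tp.
have tR : (t <= R)%N by rewrite RE tp //; lia.
have R0 : (0 < R)%N by apply: leq_trans tR.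
have RY : (R * Y = (t ^ 2) ^ m)%N by rewrite RE YE -expnD -expnM; congr expn; lia.
have YY : (Y ^ 2 = (t ^ 2) ^ n)%N by rewrite YE -!expnM mulnC.
have NY : (N0 <= Y)%N by apply: leq_trans tY; apply: leq_trans jt; lia.
have hp1 : (1000 * 1000 * primepi (10 * (1000 * 1000) * (R * Y)) <= 10 * (1000 * 1000) * (R * Y))%N.
  apply: hN0; apply: leq_trans NY _; rewrite mulnA leq_pmull //.
  by rewrite !muln_gt0.
have hp2 : (1000 * 1000 * primepi (3000 * Y) <= 3000 * Y)%N.
  by apply: hN0; apply: leq_trans NY _; rewrite leq_pmull.
have hJ : ((3000 * Y) ^ 2 <= 2 ^ J)%N.
  rewrite /J [(2 * _)%N]mulnC expnM leq_exp2r // expnD; apply: leq_mul.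
    have -> : (2 ^ 12 = 4 * 1024)%N by [].
    by clear; lia.
  rewrite YE tE -expnM (expnM 2 5) leq_exp2r // muln_gt0 n0 andbT.
  by rewrite jE addn_gt0 orbT.
have Y1 : (1000 <= Y)%N by apply: leq_trans tY; apply: leq_trans jt; rewrite jE; clear; lia.
have [A [B [y [h1 h2 h3 h4 h5]]]] := @small_admissible Y k R J _ _ _ _ kE YkR R0 erefl erefl erefl hp1 hp2 hJ
   (leq_trans Jt tY) (leq_trans Jt tR) Y1 C hC.
exists (t ^ 2)%N, A, B, y, k; split=> //.
- apply: (@leq_trans t); last exact: tp.
  by apply: leq_trans jt; rewrite jE; clear; lia.
- by rewrite expn_gt0 t0.
- by rewrite -RY; split=> //; apply: leq_trans h2 _; rewrite leq_pmull.
- by rewrite -YY; split=> //; apply: leq_trans h4 _; rewrite leq_pmull.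
Qed.

(** * The regime n > 2m *)

(** [k0] is the last k with ks <= 2y^2 + k, where s is the square root of B^2 + 1; beyond it ks
    exceeds A. *)
Definition crossing (B y k0 : nat) : Prop :=
  (k0 ^ 2 * (B ^ 2 + 1) <= (2 * y ^ 2 + k0) ^ 2)%N /\
  forall k, (k0 < k)%N -> ((2 * y ^ 2 + k) ^ 2 < k ^ 2 * (B ^ 2 + 1))%N.

Lemma crossing_le B y k : (k ^ 2 * (B ^ 2 + 1) <= (2 * y ^ 2 + k) ^ 2)%N -> (k * B <= 2 * y ^ 2 + k)%N.
Proof.
move=> h; rewrite -(@leq_exp2r _ _ 2) // (leq_trans _ h) // expnMn leq_mul2l leq_addr.
by rewrite orbT.
Qed.

Lemma crossing_gt B y k : ((2 * y ^ 2 + k) ^ 2 < k ^ 2 * (B ^ 2 + 1))%N -> (2 * y ^ 2 < k * B)%N.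
Proof.
move=> h; have : (2 * y ^ 2 + k < k * (B + 1))%N.
  rewrite -(@ltn_exp2r _ _ 2) // (leq_trans h) // expnMn leq_mul2l sqrnD.
  by apply/orP; right; lia.
by move: (y ^ 2)%N => z; rewrite mulnDr; lia.
Qed.

Lemma crossing_exists B y : (2 <= B)%N -> exists k0, crossing B y k0.
Proof.
move=> B2; pose P k := (k ^ 2 * (B ^ 2 + 1) <= (2 * y ^ 2 + k) ^ 2)%N.
have P0 : exists k, P k by exists 0%N; rewrite /P exp0n.
have Pb k : P k -> (k <= 2 * y ^ 2)%N.
  by move/crossing_le; move: (y ^ 2)%N => z; nia.
case: (ex_maxnP P0 Pb) => k0 h0 hmax; exists k0; split=> // k hk.
by rewrite ltnNge; apply/negP => /hmax; rewrite leqNgt hk.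
Qed.

Definition cross (B y : nat) : nat := epsilon (inhabits 0%N) (crossing B y).

Lemma crossP B y : (2 <= B)%N -> crossing B y (cross B y).
Proof. by move=> h; apply: epsilon_spec; apply: crossing_exists. Qed.

(** As s <= B + 1, each step past the crossing adds at most B + 1 to ks; the claim is this estimate
    squared. *)
Lemma crossing_upper B y k0 e : crossing B y k0 ->
  ((k0 + e) ^ 2 * (B ^ 2 + 1) <= (2 * y ^ 2 + k0 + e * (B + 1)) ^ 2)%N.
Proof.
move=> [h _]; set u := (2 * y ^ 2 + k0)%N in h *.
have hD : (B ^ 2 + 1 <= (B + 1) ^ 2)%N by rewrite sqrnD; lia.
move: h hD; move: u (B ^ 2 + 1)%N (B + 1)%N => u D b h h3.
have h2 : (k0 * D <= u * b)%N.
  by rewrite -(@leq_exp2r _ _ 2) // !expnMn -[X in (_ * X <= _)%N]mulnn mulnA; apply: leq_mul.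
rewrite -!mulnn in h h3 *.
have h4 : (e * (k0 * D) <= e * (u * b))%N by rewrite leq_mul2l h2 orbT.
have h5 : (e * e * D <= e * e * (b * b))%N by rewrite leq_mul2l h3 orbT.
lia.
Qed.

(** Reduction modulo L is injective on the set cut out by [P]. *)
Lemma sum_close n L (P : pred nat) : (0 < L)%N ->
  (forall y1 y2, (y1 < n)%N -> (y2 < n)%N -> P y1 -> P y2 -> (y1 < y2)%N -> (y2 - y1 < L)%N) ->
  (\sum_(y < n) P y <= L)%N.
Proof.
move=> L0 h; rewrite sum_nat_card.
pose g (y : 'I_n) := Ordinal (ltn_pmod y L0).
rewrite -[leqRHS]card_ord.
apply: (@leq_trans #|g @: [set y : 'I_n | P y]|); last exact: max_card.
rewrite card_in_imset // => y1 y2; rewrite !inE => h1 h2 /(congr1 val) /= e.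
have key (a b : 'I_n) : P a -> P b -> (a < b)%N -> a = b %[mod L] -> False.
  move=> pa pb ab /eqP; rewrite eq_sym eqn_mod_dvd ?(ltnW ab) // => /dvdn_leq.
  by rewrite subn_gt0 ab => /(_ isT); rewrite leqNgt h.
apply: val_inj => /=; have [l|l|//] := ltngtP y1 y2; exfalso.
  exact: key h1 h2 l e.
exact: key h2 h1 l (esym e).
Qed.

Lemma sum_unique n1 n2 (P : nat -> nat -> bool) :
  (forall x x' i i', (x < n1)%N -> (x' < n1)%N -> (i < n2)%N -> (i' < n2)%N ->
     P x i -> P x' i' -> x = x' /\ i = i') ->
  (\sum_(x < n1) \sum_(i < n2) P x i <= 1)%N.
Proof.
move=> h; rewrite pair_big /=.
have -> : (\sum_(p : 'I_n1 * 'I_n2) P p.1 p.2 = #|[set p : 'I_n1 * 'I_n2 | P p.1 p.2]|)%N.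
  by rewrite -sum1dep_card [RHS]big_mkcond /=; apply: eq_bigr => i _; case: (P _ _).
apply/card_le1_eqP => [[x i] [x' i']]; rewrite !inE /= => h1 h2.
by have [e1 e2] := h x' x i' i (ltn_ord _) (ltn_ord _) (ltn_ord _) (ltn_ord _) h2 h1; congr pair; apply: val_inj.
Qed.

(** As shares of all triples, the main terms are 1/6 for squares in D, 1/10 and 4/15 for squares in
    A of primes up to L and beyond, and 1/3 for common primes: 52/60 in total. *)
Lemma large_arith (X Y L J P1 : rat) : Y = L * X -> 1000 <= X -> 1 <= L ->
  200 * 200 * P1 <= 100 * X -> 240 * J <= X -> 2 * J <= L ->
  Y * (60 * L) * (X / 6 + 2 * P1) + X * Y * (60 * L / 12 + L) + L * (16 * Y ^+ 2 / L + 4 * Y) +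
  Y * (60 * L * X / 3 + 4 * (60 * L) * J + 2 * X * J) < X * (Y * (60 * L)).
Proof.
move=> -> X1 L1 p1 p2 p3.
have L0 : 0 < L by lra.
have X0 : 0 < X by lra.
have XL : 0 < L * X by rewrite mulr_gt0.
have XLL : 0 < L * L * X by rewrite !mulr_gt0.
have -> : L * (16 * (L * X) ^+ 2 / L + 4 * (L * X)) = 16 * (L * L * X * X) + 4 * (L * L * X).
  by field; rewrite gt_eqF.
have q1 := ler_wpM2l (ltW XLL) p1.
have q2 := ler_wpM2l (ltW XLL) p2.
have LXX : 0 < L * X * X by rewrite !mulr_gt0.
have q3 := ler_wpM2l (ltW LXX) p3.
have q4 := ler_wpM2l (ltW XLL) X1.
have q5 : 0 < L * L * X * X by rewrite !mulr_gt0.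
lra.
Qed.

Lemma sumr_const_ord n (c : rat) : \sum_(x < n) c = n%:R * c.
Proof. by rewrite sumr_const card_ord mulr_natl. Qed.

Lemma large_cast1 (P N x : nat) : (200 * 200 * P <= N)%N -> N = (100 * x)%N ->
  200 * 200 * P%:R <= 100 * x%:R :> rat.
Proof.
move=> h e; have {h} : (200 * 200 * P)%N%:R <= N%:R :> rat by rewrite ler_nat.
by rewrite e => h; lra.
Qed.

Lemma large_cast2 (j x : nat) : (240 * j <= x)%N -> 240 * j%:R <= x%:R :> rat.
Proof.
move=> h; have {h} : (240 * j)%N%:R <= x%:R :> rat by rewrite ler_nat.
by move=> h; lra.
Qed.

(** If windows over B1 < B2 shared a value, then 29k <= E (B2 - 1), although k B1 > 2Y^2; with E =
    O(L) and B1, B2 = O(X) this bounds L by an absolute constant below 200000. *)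
Lemma large_unique (X Y L E a k B1 B2 k02 z : nat) :
  Y = (L * X)%N -> (200 * 1000 <= L)%N -> (E <= 30 * (62 * L))%N -> (0 < X)%N ->
  (Y * Y <= z)%N -> (2 * z < k * B1)%N -> (k <= k02 + E)%N -> (k02 * B2 <= 2 * z + k02)%N ->
  (B1 + 30 <= B2)%N -> (B2 <= 60 * X + 1)%N -> False.
Proof.
move=> YE L1 hE X0 hz h1 h2 h3 h4 h5.
have a1 : (29 * k <= E * (B2 - 1))%N.
  have e1 : (k02 * (B2 - 1) <= 2 * z)%N by rewrite mulnBr muln1; lia.
  have e2 : (k * (B2 - 1) <= 2 * z + E * (B2 - 1))%N.
    by apply: leq_trans (leq_mul h2 (leqnn _)) _; rewrite mulnDl leq_add2r.
  have e3 : (k * (B1 + 29) <= k * (B2 - 1))%N by rewrite leq_mul2l; apply/orP; right; lia.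
  by rewrite mulnDr in e3; lia.
have a2 : (29 * k * B1 <= E * (60 * X) * (60 * X))%N.
  by apply: leq_mul; [apply: leq_trans a1 _; rewrite leq_mul2l; apply/orP; right; lia | lia].
have a3 : (29 * (2 * (Y * Y)) <= E * (60 * X) * (60 * X))%N.
  apply: leq_trans a2; rewrite -mulnA leq_mul2l /=; apply: leq_trans (ltnW h1); by rewrite leq_mul2l.
have a4 : (E * (60 * X) * (60 * X) <= 30 * (62 * L) * (60 * X) * (60 * X))%N by rewrite !leq_mul.
have a5 : (29 * (2 * (Y * Y)) = 58 * L * (L * (X * X)))%N by rewrite YE; lia.
have a6 : (30 * (62 * L) * (60 * X) * (60 * X) = 30 * 62 * 3600 * (L * (X * X)))%N by lia.
have p : (0 < L * (X * X))%N by rewrite !muln_gt0 X0 andbT; lia.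
have : (58 * L <= 30 * 62 * 3600)%N.
  by rewrite -(leq_pmul2r p) -a5 -a6; apply: leq_trans a3 a4.
by clear -L1; lia.
Qed.

Section Large.
Variables (X Y L J N1 len : nat).
Hypotheses (YE : Y = (L * X)%N) (X1 : (1000 <= X)%N) (L1 : (200 * 1000 <= L)%N).
Hypotheses (N1E : N1 = (100 * X)%N) (lenE : len = (60 * L)%N).
Hypotheses (hpi : (200 * 200 * primepi N1 <= N1)%N).
Hypotheses (hJ : (16 * Y ^ 2 <= 2 ^ J)%N) (JX : (240 * J <= X)%N) (JL : (2 * J <= L)%N).

Let b x := (30 * (X + x) + 1)%N.
Let k0 x y := cross (b x) (Y + y).
(** The starting point is chosen so that A runs through the progression 1 modulo 30 just above the
    crossing value of 2y^2 + k. *)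
Let a0 x y := ((2 * (Y + y) ^ 2 + k0 x y) %/ 30 + 1)%N.
Let A x y i := (30 * (a0 x y + i) + 1)%N.

Let X0 : (0 < X)%N. Proof. by apply: leq_trans X1. Qed.
Let L0 : (0 < L)%N. Proof. by apply: leq_trans L1; rewrite muln_gt0. Qed.
Let b2 x : (2 <= b x)%N. Proof. by rewrite /b; clear -X0; lia. Qed.

Lemma A_lower x y i : (2 * (Y + y) ^ 2 + k0 x y < A x y i)%N.
Proof.
rewrite /A /a0; have := divn_eq (2 * (Y + y) ^ 2 + k0 x y) 30.
have := @ltn_pmod (2 * (Y + y) ^ 2 + k0 x y) 30 isT.
move: (2 * (Y + y) ^ 2 + k0 x y)%N (_ %/ _)%N (_ %% _)%N; clear; lia.
Qed.

Lemma A_upper x y i : (i < len)%N -> (A x y i <= 2 * (Y + y) ^ 2 + k0 x y + 30 * (len + 2))%N.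
Proof.
move=> hi; rewrite /A /a0; have := divn_eq (2 * (Y + y) ^ 2 + k0 x y) 30; move: hi.
move: (2 * (Y + y) ^ 2 + k0 x y)%N (_ %/ _)%N (_ %% _)%N; clear; lia.
Qed.

Lemma k0_upper x y : (y < Y)%N -> (30 * k0 x y <= 8 * (L * Y))%N.
Proof.
move=> hy; have [h _] := crossP (Y + y) (b2 x); move/crossing_le: h; rewrite -/(k0 x y).
have hz : ((Y + y) ^ 2 <= 4 * (Y * Y))%N by rewrite -mulnn; clear -hy; nia.
move: hz; move: (k0 x y) ((Y + y) ^ 2)%N => k z hz; rewrite /b => h.
rewrite -(leq_pmul2r X0); apply: (@leq_trans (8 * (Y * Y))); last by rewrite {1}YE; clear; lia.
by clear YE; nia.
Qed.

Lemma A_window x y i : (y < Y)%N -> (i < len)%N -> (A x y i <= 2 * (Y + y) ^ 2 + L * Y)%N.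
Proof.
move=> hy hi; have := A_upper x y hi; have := k0_upper x hy.
have : (30 * (30 * (len + 2)) <= 22 * (L * Y))%N.
  have : (L * (200 * 1000) <= L * Y)%N.
    by rewrite leq_mul2l YE; apply/orP; right; apply: leq_trans L1 _; rewrite leq_pmulr.
  by rewrite lenE; clear -L0; nia.
by move: (A x y i) (2 * (Y + y) ^ 2)%N (k0 x y) (L * Y)%N (30 * (len + 2))%N; clear; lia.
Qed.

Lemma A_max x y i : (y < Y)%N -> (i < len)%N -> (A x y i < 16 * Y ^ 2)%N.
Proof.
move=> hy hi; apply: leq_ltn_trans (A_window x hy hi) _.
have LY : (L <= Y)%N by rewrite YE leq_pmulr.
have hLY : (L * Y <= Y * Y)%N by apply: leq_mul.
by rewrite -!mulnn; clear -hLY hy; nia.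
Qed.

(** The value lies within L Y above 2(Y + y)^2, which confines y to fewer than L consecutive
    integers; for each such y, [large_unique] allows only one pair (x, i). *)
Lemma A_mult a : (\sum_(y < Y) \sum_(x < X) \sum_(i < len) (A x y i == a) <= L)%N.
Proof.
pose P y := (2 * (Y + y) ^ 2 < a <= 2 * (Y + y) ^ 2 + L * Y)%N.
apply: (@leq_trans (\sum_(y < Y) P y)); last first.
  apply: sum_close => // y1 y2 h1 h2 /andP[_ p1] /andP[p2 _] l.
  have q : (2 * (Y + y2) ^ 2 < 2 * (Y + y1) ^ 2 + L * Y)%N by apply: leq_trans p2 p1.
  rewrite -!mulnn in q.
  have Y0 : (0 < Y)%N by apply: leq_ltn_trans h1.
  rewrite -(ltn_pmul2r Y0).
  have [d ed] : exists d, y2 = (y1 + d)%N by exists (y2 - y1)%N; rewrite subnKC // ltnW.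
  by rewrite ed addKn in q *; clear -q; nia.
apply: leq_sum => y _; case: (boolP (P y)) => hP; last first.
  rewrite big1 // => x _; rewrite big1 // => i _; case: eqP => // e; case/negP: hP.
  rewrite /P -e A_window // andbT; apply: leq_ltn_trans (A_lower x y i); exact: leq_addr.
apply: (@sum_unique X len (fun x i => A x y i == a)) => x x' i i' hx hx' hi hi' /eqP e /eqP e'.
have key (u u' v v' : nat) : (u < X)%N -> (u' < X)%N -> (v < len)%N -> (v' < len)%N ->
    A u y v = a -> A u' y v' = a -> (u < u')%N -> False.
  move=> hu hu' hv hv' e1 e2 lt.
  have [_ c1] := crossP (Y + y) (b2 u); have [c2 _] := crossP (Y + y) (b2 u').
  move/crossing_le: c2; rewrite -/(k0 u' y) => c2.
  have l1 := A_lower u y v; have u1 := A_upper u' y hv'; rewrite e1 in l1; rewrite e2 in u1.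
  have := c1 (a - 2 * (Y + y) ^ 2)%N; rewrite -/(k0 u y) => {}c1.
  have {}c1 := crossing_gt (c1 _).
  apply: (@large_unique X Y L (30 * (len + 2)) a (a - 2 * (Y + y) ^ 2) (b u) (b u') (k0 u' y) ((Y + y) ^ 2)) => //.
  - by rewrite lenE; clear -L0; nia.
  - by rewrite -mulnn; clear; nia.
  - by apply: c1; move: l1; clear; lia.
  - by move: u1; clear; lia.
  - by rewrite /b; clear -lt; lia.
  - by rewrite /b; clear -hu'; lia.
have ex : x = x'.
  have [l|l|//] := ltngtP x x'; exfalso; first exact: (key x x' i i').
  exact: (key x' x i' i).
split=> //; move: e; rewrite -e' ex /A => /eqP.
by rewrite eqn_add2r eqn_mul2l /= eqn_add2l => /eqP.
Qed.

(** For p > L a window of length 60 L is too short to control p^2. The triples are regrouped by the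
    value of A below 16 Y^2, each taken at most L times, and the tail of p^-2 is at most 1/L. *)
Lemma sum_large_primes : \sum_(x < X) \sum_(y < Y) \sum_(i < len)
    (\sum_(L.+1 <= p < 4 * Y | prime p) (p ^ 2 %| A x y i))%:R
  <= L%:R * (16 * Y%:R ^+ 2 / L%:R + 4 * Y%:R) :> rat.
Proof.
pose M := (16 * Y ^ 2)%N; pose g a := (\sum_(L.+1 <= p < 4 * Y | prime p) (p ^ 2 %| a))%N.
have h1 : (\sum_(x < X) \sum_(y < Y) \sum_(i < len) g (A x y i) <= L * \sum_(a < M) g a)%N.
  rewrite exchange_big /=.
  apply: (@leq_trans (\sum_(y < Y) \sum_(x < X) \sum_(i < len) \sum_(a < M) (A x y i == a) * g a)).
    apply: leq_sum => y _; apply: leq_sum => x _; apply: leq_sum => i _.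
    by rewrite (bigD1 (Ordinal (A_max x (ltn_ord y) (ltn_ord i)))) //= eqxx mul1n leq_addr.
  rewrite big_distrr /=.
  have -> : (\sum_(y < Y) \sum_(x < X) \sum_(i < len) \sum_(a < M) (A x y i == a) * g a =
     \sum_(a < M) (\sum_(y < Y) \sum_(x < X) \sum_(i < len) (A x y i == a)) * g a)%N.
    under eq_bigr => y _ do (under eq_bigr => x _ do rewrite exchange_big /=; rewrite exchange_big /=).
    rewrite exchange_big /=; apply: eq_bigr => a _.
    rewrite big_distrl /=; apply: eq_bigr => y _; rewrite big_distrl /=; apply: eq_bigr => x _.
    by rewrite big_distrl.
  by apply: leq_sum => a _; rewrite leq_mul2r A_mult orbT.
have -> : \sum_(x < X) \sum_(y < Y) \sum_(i < len) (g (A x y i))%:R =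
   (\sum_(x < X) \sum_(y < Y) \sum_(i < len) g (A x y i))%:R :> rat.
  rewrite natr_sum; apply: eq_bigr => x _; rewrite natr_sum; apply: eq_bigr => y _.
  by rewrite natr_sum.
apply: (@le_trans _ _ (L * \sum_(a < M) g a)%:R); first by rewrite ler_nat.
have l0 : 0 < L%:R :> rat by rewrite ltr0n.
rewrite natrM (ler_pM2l l0) /g exchange_big /= natr_sum.
apply: (@le_trans _ _ (\sum_(L.+1 <= p < 4 * Y | prime p) (M%:R * (p%:R ^+ 2)^-1 + 1))).
  apply: ler_sum => p pp.
  have p1 : ~~ (p %| 1)%N by rewrite dvdn1 neq_ltn prime_gt1 ?orbT.
  have cl : (\sum_(a < M) (p ^ 2 %| a) <= M %/ p ^ 2 + 1)%N.
    apply: leq_trans (@count_linear p 2 1 0 M pp p1).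
    by apply: leq_sum => a _; rewrite mul1n addn0.
  apply: (@le_trans _ _ (M %/ p ^ 2 + 1)%:R); first by rewrite ler_nat.
  rewrite natrD lerD2r ler_pdivlMr; first by rewrite -natrX -natrM ler_nat leq_divM.
  by rewrite exprn_gt0 // ltr0n prime_gt0.
rewrite big_split /= -mulr_sumr; apply: lerD.
  have := sum_inv_sqr_tail (4 * Y) L0.
  have -> : 16 * Y%:R ^+ 2 = M%:R :> rat by rewrite /M natrM natrX.
  by move=> h; apply: ler_wpM2l; rewrite ?ler0n.
have -> : \sum_(L.+1 <= p < 4 * Y | prime p) (1 : rat) = (\sum_(L.+1 <= p < 4 * Y | prime p) 1)%N%:R.
  by rewrite natr_sum.
rewrite -(natrM _ 4) ler_nat.
apply: (@leq_trans (\sum_(L.+1 <= p < 4 * Y) 1)); last by rewrite sum_nat_const_nat muln1 leq_subr.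
by rewrite big_mkcond /=; apply: leq_sum => p _; case: ifP.
Qed.

Lemma large_exists : exists x y i : nat, [/\ (x < X)%N, (y < Y)%N, (i < len)%N,
  (\sum_(7 <= p < N1 | prime p) (p ^ 2 %| b x ^ 2 + 1) = 0)%N &
  (\sum_(7 <= p < 4 * Y | prime p) (p ^ 2 %| A x y i) = 0)%N /\
  (\sum_(7 <= q < 16 * Y ^ 2 | prime q) ((q %| b x ^ 2 + 1) * (q %| A x y i)) = 0)%N].
Proof.
pose F1 x := (\sum_(7 <= p < N1 | prime p) (p ^ 2 %| b x ^ 2 + 1))%N.
pose F2 x y i := (\sum_(7 <= p < L.+1 | prime p) (p ^ 2 %| A x y i))%N.
pose F3 x y i := (\sum_(L.+1 <= p < 4 * Y | prime p) (p ^ 2 %| A x y i))%N.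
pose F4 x y i := (\sum_(7 <= q < 16 * Y ^ 2 | prime q) ((q %| b x ^ 2 + 1) * (q %| A x y i)))%N.
pose F x y i := (F1 x + F2 x y i + F3 x y i + F4 x y i)%N.
have L7 : (7 <= L.+1)%N by clear -L1; lia.
have LY : (L.+1 <= 4 * Y)%N.
  have : (L <= Y)%N by rewrite YE leq_pmulr.
  by clear -L0; lia.
suff [x hx hF] : exists2 x, (x < X)%N & (\sum_(y < Y) \sum_(i < len) F x y i < Y * len)%N.
  have [y hy hF'] := @sum_lt_exists Y len (fun y => \sum_(i < len) F x y i)%N hF.
  have [i hi /eqP] := @sum_nat_lt_exists len (F x y) hF'.
  rewrite !addn_eq0 => /andP[/andP[/andP[/eqP z1 /eqP z2] /eqP z3] /eqP z4].
  exists x, y, i; split=> //; split=> //.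
  by rewrite (@big_cat_nat _ _ _ L.+1) //= -/(F2 x y i) -/(F3 x y i) z2 z3.
apply: (@sum_lt_exists X (Y * len) (fun x => \sum_(y < Y) \sum_(i < len) F x y i)%N).
have -> : (\sum_(x < X) \sum_(y < Y) \sum_(i < len) F x y i =
   Y * len * \sum_(x < X) F1 x + \sum_(x < X) \sum_(y < Y) \sum_(i < len) F2 x y i +
   \sum_(x < X) \sum_(y < Y) \sum_(i < len) F3 x y i + \sum_(y < Y) \sum_(x < X) \sum_(i < len) F4 x y i)%N.
  rewrite [X in (_ = _ + X)%N]exchange_big /= big_distrr /= -!big_split /=; apply: eq_bigr => x _.
  have -> : (Y * len * F1 x = \sum_(y < Y) \sum_(i < len) F1 x)%N by rewrite !sum_nat_const !card_ord mulnA.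
  by rewrite -!big_split /=; apply: eq_bigr => y _; rewrite -!big_split.
have sD := @sievable_D (30 * X + 1)%N.
have h1 : (\sum_(x < X) F1 x)%:R <= X%:R / 6 + 2 * (primepi N1)%:R :> rat.
  apply: le_trans (sum_sqr_dvd X N1 sD); rewrite ler_nat; apply: leq_sum => x _.
  by apply: leq_sum => p _; rewrite quadval_D.
have cA (q e x y : nat) : prime q -> (7 <= q)%N ->
    (\sum_(i < len) (q ^ e %| A x y i))%:R <= len%:R / (q ^ e)%:R + 1 :> rat.
  move=> pq q7; have q30 : ~~ (q %| 30)%N by apply: prime7_ndvd.
  have q0 : 0 < (q ^ e)%:R :> rat by rewrite ltr0n expn_gt0 prime_gt0.
  apply: (@le_trans _ _ (len %/ q ^ e + 1)%:R).
    rewrite ler_nat; apply: leq_trans (count_linear e (30 * a0 x y + 1) len pq q30).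
    by apply: leq_sum => i _; rewrite /A mulnDr [(30 * a0 x y + _)%N]addnC addnA.
  by rewrite natrD lerD2r ler_pdivlMr // -natrM ler_nat leq_divM.
have h2 : (\sum_(x < X) \sum_(y < Y) \sum_(i < len) F2 x y i)%:R <= X%:R * Y%:R * (len%:R / 12 + L%:R) :> rat.
  have hxy x y : (\sum_(i < len) F2 x y i)%:R <= len%:R / 12 + L%:R :> rat.
    rewrite exchange_big /= natr_sum.
    apply: (@le_trans _ _ (\sum_(7 <= p < L.+1 | prime p) (len%:R * (p%:R ^+ 2)^-1 + 1))).
      rewrite big_nat_cond [leRHS]big_nat_cond; apply: ler_sum => p /andP[/andP[p7 _] pp].
      by rewrite -natrX; apply: cA.
    rewrite big_split /= -mulr_sumr; apply: lerD.
      have h := sum_inv_sqr_primes L.+1; rewrite div1r in h.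
      by apply: ler_wpM2l h; rewrite ler0n.
    have -> : \sum_(7 <= p < L.+1 | prime p) (1 : rat) = (\sum_(7 <= p < L.+1 | prime p) 1)%N%:R.
      by rewrite natr_sum.
    rewrite ler_nat.
    apply: (@leq_trans (\sum_(7 <= p < L.+1) 1)); last by rewrite sum_nat_const_nat muln1; clear; lia.
    by rewrite big_mkcond /=; apply: leq_sum => p _; case: ifP.
  rewrite natr_sum; apply: (@le_trans _ _ (\sum_(x < X) \sum_(y < Y) (len%:R / 12 + L%:R))).
    by apply: ler_sum => x _; rewrite natr_sum; apply: ler_sum => y _; apply: hxy.
  by rewrite !sumr_const_ord -(mulrA X%:R).
have h3 : (\sum_(x < X) \sum_(y < Y) \sum_(i < len) F3 x y i)%:R <= L%:R * (16 * Y%:R ^+ 2 / L%:R + 4 * Y%:R) :> rat.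
  apply: le_trans sum_large_primes; rewrite natr_sum; apply: ler_sum => x _.
  rewrite natr_sum; apply: ler_sum => y _; rewrite natr_sum; exact: lexx.
have h4 : (\sum_(y < Y) \sum_(x < X) \sum_(i < len) F4 x y i)%:R <=
    Y%:R * (len%:R * X%:R / 3 + 4 * len%:R * J%:R + 2 * X%:R * J%:R) :> rat.
  have hy y : (\sum_(x < X) \sum_(i < len) F4 x y i)%:R <= len%:R * X%:R / 3 + 4 * len%:R * J%:R + 2 * X%:R * J%:R :> rat.
    apply: (@sum_gcd (fun x => b x ^ 2 + 1)%N (fun x i => A x y i)).
    - apply: le_trans (sum_inv_dvd X sD hJ); apply: ler_sum => x _; apply: ler_sum => q _.
      by rewrite quadval_D.
    - move=> x hx; rewrite addn1 /=; apply: leq_trans hJ.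
      have XL : (X * (200 * 1000) <= Y)%N by rewrite YE mulnC leq_mul2r L1 orbT.
      by rewrite /b -!mulnn; clear -XL hx X1; nia.
    - move=> x q hx pq q7; have := cA q 1%N x y pq q7; rewrite expn1 => /le_trans; apply.
      have q0 : 0 <= len%:R / q%:R + 1 :> rat by rewrite addr_ge0 // divr_ge0 ?ler0n.
      by rewrite ler_peMl // ler1n.
  rewrite natr_sum; apply: (@le_trans _ _ (\sum_(y < Y) (len%:R * X%:R / 3 + 4 * len%:R * J%:R + 2 * X%:R * J%:R))).
    by apply: ler_sum => y _; apply: hy.
  by rewrite sumr_const_ord.
rewrite -(ltr_nat rat) !natrD (natrM _ (Y * len)) (natrM _ X) (natrM _ Y len).
have yl0 : 0 <= Y%:R * len%:R :> rat by rewrite mulr_ge0 ?ler0n.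
apply: le_lt_trans (lerD (lerD (lerD (ler_wpM2l yl0 h1) h2) h3) h4) _.
have lE : len%:R = 60 * L%:R :> rat by rewrite lenE (natrM _ 60).
rewrite lE.
have Y' : Y%:R = L%:R * X%:R :> rat by rewrite YE natrM.
have X' : 1000 <= X%:R :> rat by rewrite (ler_nat _ 1000).
have L' : 1 <= L%:R :> rat by rewrite ler1n.
have J' : 2 * J%:R <= L%:R :> rat by rewrite -(natrM _ 2) ler_nat.
exact (large_arith Y' X' L' (large_cast1 hpi N1E) (large_cast2 JX) J').
Qed.

Lemma large_admissible C : (200 * 1000 <= C)%N -> exists A B y k : nat,
  [/\ admissible C A B y k, (X <= B)%N, (B <= C * X)%N, (Y ^ 2 <= A)%N & (A <= C * Y ^ 2)%N].
Proof.
move=> hC; have [x [y [i [hx hy hi z1 [z2 z3]]]]] := large_exists.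
have lo := A_lower x y i; have up := A_upper x y hi; have mx := A_max x hy hi.
have cr := crossP (Y + y) (b2 x); rewrite -/(k0 x y) in cr.
have AE : A x y i = (30 * (a0 x y + i) + 1)%N by [].
have BE : b x = (30 * (X + x) + 1)%N by [].
have Y0 : (0 < Y)%N by apply: leq_ltn_trans hy.
have YX : (L * X = Y)%N by rewrite YE.
move: lo up mx AE BE z1 z2 z3 cr; move: (A x y i) (b x) (k0 x y) (a0 x y + i)%N => a B q0 w.
move=> lo up mx AE BE z1 z2 z3 cr.
have Bu : (B <= 60 * X)%N by rewrite BE; clear -hx; lia.
have ha0 : (0 < a)%N by apply: leq_ltn_trans lo.
have [a2 a3 a5] : [/\ ~~ (2 %| a)%N, ~~ (3 %| a)%N & ~~ (5 %| a)%N] by rewrite AE; clear; split; lia.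
pose yy := (Y + y)%N; have yyE : yy = (Y + y)%N by [].
rewrite -yyE in lo up cr.
pose k := (a - 2 * yy ^ 2)%N.
have le2 : (2 * yy ^ 2 <= a)%N by apply: leq_trans (leq_addr _ _) (ltnW lo).
have ak : a = (2 * yy ^ 2 + k)%N by rewrite /k subnKC.
have qk : (q0 < k)%N by rewrite /k ltn_subRL.
have ku : (k <= q0 + 30 * (len + 2))%N by rewrite /k leq_subLR addnA.
exists a, B, yy, k; split.
- split; split=> //.
  + by move: a2; rewrite dvdn2 negbK.
  + by rewrite BE oddD oddM.
  + by apply: (@sqfree_A _ (4 * Y)) => //; rewrite ha0 expnMn.
  + rewrite BE in z1 *; apply: (@sqfree_D _ N1) => //; rewrite -BE N1E -!mulnn.
    by clear -Bu X0; nia.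
  + apply: (@coprime_sieve _ _ (16 * Y ^ 2)) => //; first by rewrite ha0.
    by rewrite -[RHS]z3; apply: eq_bigr => q _; rewrite mulnC.
  + by rewrite yyE addn_gt0 Y0.
  (* The left inequality holds because k is past the crossing; on the right, k exceeds it by O(L)
     steps, worth O(L X) = O(Y). *)
  + have [c1 c2] := cr; apply/andP; split.
      apply: (@leq_trans (a ^ 2)); first by rewrite leq_exp2r // leq_subr.
      by rewrite {1}ak ltnW // c2.
    have := crossing_upper (k - q0) cr; rewrite subnKC ?(ltnW qk) // => /leq_trans; apply.
    rewrite leq_exp2r //; apply: leq_add; first exact: ltnW.
    apply: (@leq_trans (30 * (62 * L) * (61 * X))).
      apply: leq_mul; last by clear -Bu X1; lia.
      by rewrite leq_subLR; apply: leq_trans ku _; rewrite leq_add2l lenE; clear -L0; lia.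
    apply: (@leq_trans (200 * 1000 * Y)); first by rewrite -YX; clear; lia.
    by apply: leq_mul => //; rewrite yyE leq_addr.
- by rewrite BE; clear; lia.
- by apply: leq_trans Bu _; rewrite leq_mul2r; apply/orP; right; clear -hC; lia.
- apply: leq_trans le2; rewrite yyE -!mulnn; clear; nia.
- by apply: leq_trans (ltnW mx) _; rewrite leq_mul2r; apply/orP; right; clear -hC; lia.
Qed.

End Large.

Lemma parameters_large (m n : nat) : (0 < m)%N -> (2 * m < n)%N ->
  exists2 C : nat, (0 < C)%N & forall T0 : nat,
  exists T A B y k : nat, [/\ (T0 <= T)%N, (0 < T)%N, admissible C A B y k,
    (T ^ m <= C * B)%N /\ (B <= C * T ^ m)%N & (T ^ n <= C * A)%N /\ (A <= C * T ^ n)%N].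
Proof.
have [C hC] : exists C, (200 * 1000 <= C)%N by eexists; exact: leqnn.
have e0 : (0 < 200 * 200)%N by rewrite muln_gt0.
have [N0 hN0] := primepi_eventually e0.
have C0 : (0 < C)%N by apply: leq_trans hC; rewrite !muln_gt0.
move=> m0 mn; exists C => // T0.
pose c := (240 * (4 + 4 * n))%N.
have [j jE] : exists j, j = (T0 + N0 + c + 200 * 1000)%N by eexists.
have j2 : (j < 2 ^ j)%N by apply: ltn_expl.
(* t = 4^j is at least j^2 and so dominates [J], which is linear in j. *)
have [t tE] : exists t, t = (2 ^ (2 * j))%N by eexists.
have t4 : (j * j <= t)%N.
  by rewrite tE mul2n -addnn expnD; apply: leq_mul; apply: ltnW.
have j1 : (0 < j)%N by rewrite jE !addn_gt0 muln_gt0 !orbT.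
have jt : (j <= t)%N by apply: leq_trans t4; rewrite leq_pmulr.
have t0 : (0 < t)%N by apply: leq_trans jt.
pose J := (4 + 2 * (2 * j * n))%N.
have Jt : (240 * J <= t)%N.
  apply: leq_trans t4; apply: (@leq_trans (c * j)).
    by rewrite /c /J; clear -j1; nia.
  by rewrite leq_mul2r; apply/orP; right; rewrite jE; clear; lia.
have tp d : (0 < d)%N -> (t <= t ^ d)%N by move=> d0; rewrite -{1}(expn1 t) leq_pexp2l.
have [Y YE] : exists Y, Y = (t ^ n)%N by eexists.
have [X XE] : exists X, X = (t ^ (2 * m))%N by eexists.
have [L LE] : exists L, L = (t ^ (n - 2 * m))%N by eexists.
have YLX : Y = (L * X)%N by rewrite YE LE XE -expnD; congr expn; clear -mn; lia.
have tX : (t <= X)%N by rewrite XE tp // muln_gt0.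
have tL : (t <= L)%N by rewrite LE tp // subn_gt0.
have jL : (200 * 1000 <= j)%N by rewrite jE; clear; lia.
have jN : (N0 <= j)%N by rewrite jE; clear; lia.
have hp : (200 * 200 * primepi (100 * X) <= 100 * X)%N.
  by apply: hN0; apply: leq_trans jN _; apply: leq_trans jt _; apply: leq_trans tX _; rewrite leq_pmull.
have hJ : (16 * Y ^ 2 <= 2 ^ J)%N.
  have -> : (Y ^ 2 = 2 ^ (2 * (2 * j * n)))%N by rewrite YE tE -!expnM; congr expn; clear; lia.
  by rewrite /J expnD; apply: leq_mul.
have X1 : (1000 <= X)%N by apply: leq_trans tX; apply: leq_trans jt; apply: leq_trans jL; clear; lia.
have JL : (2 * J <= L)%N by apply: leq_trans tL; apply: leq_trans Jt; clear; lia.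
have [A [B [y [k [h1 h2 h3 h4 h5]]]]] := @large_admissible X Y L J _ _ YLX X1
   (leq_trans jL (leq_trans jt tL)) erefl erefl hp hJ (leq_trans Jt tX) JL C hC.
have XT : X = ((t ^ 2) ^ m)%N by rewrite XE expnM.
have YT : (Y ^ 2 = (t ^ 2) ^ n)%N by rewrite YE -!expnM mulnC.
exists (t ^ 2)%N, A, B, y, k; split=> //.
- apply: (@leq_trans t); last exact: tp.
  by apply: leq_trans jt; rewrite jE; clear; lia.
- by rewrite expn_gt0 t0.
- by rewrite -XT; split=> //; apply: leq_trans h2 _; rewrite leq_pmull.
- by rewrite -YT; split=> //; apply: leq_trans h4 _; rewrite leq_pmull.
Qed.

(** * Assembling the three regimes *)

Lemma parameters (m n : nat) : (0 < m <= n)%N -> exists2 C : nat, (0 < C)%N & forall T0 : nat,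
  exists T A B y k : nat, [/\ (T0 <= T)%N, (0 < T)%N, admissible C A B y k,
    (T ^ m <= C * B)%N /\ (B <= C * T ^ m)%N & (T ^ n <= C * A)%N /\ (A <= C * T ^ n)%N].
Proof.
move=> /andP[m0 mn]; have [h|h|->] := ltngtP n (2 * m)%N.
- exact: parameters_small.
- exact: parameters_large.
- exact: parameters_critical.
Qed.

Unset Implicit Arguments.

Theorem theorem1p3 (r : rat) :
  ABC -> 1 / 4 <= r -> r < 1 / 2 ->
  exists c1 c2 : algC, 0 < c1 /\ 0 < c2 /\
  exists theta : nat -> algC,
    (forall n m : nat, n <> m -> ~ (forall x, nfield (theta n) x <-> nfield (theta m) x)) /\
    (forall n : nat,
       totally_real (nfield (theta n)) /\ cyclic_quartic (theta n) /\
       exists D M : algC, abs_disc (nfield (theta n)) D /\ mahler_OK (nfield (theta n)) M /\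
         c1 * rpow D r <= M /\ M <= c2 * rpow D r).
Proof. by move=> _; apply: theorem_of_parameters; exact: parameters. Qed.
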